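(* Let $f:\mathbb{D}\to\mathbb{D}$ be a holomorphic function and $B$ a maximal Blaschke product for $f$. Assume further that $$\alpha_B:=\liminf_{z\to 1}\frac{1-|B(z)|}{1-|z|}\in(0,\infty)$$ and that $B(1)=1$, where $B(1)$ denotes the angular limit of $B$ at $1$. If there is a sequence $(z_n)\subseteq\mathbb{D}$ such that $z_n\to1$ non-tangentially as $n\to\infty$ and $$f(z_n)=B(z_n)+O(|1-z_n|)\quad\text{as }n\to\infty,$$ then the limit $$A:=\lim_{n\to\infty}\frac{1-|f(z_n)|}{1-|B(z_n)|}$$ exists and lies in $(0,\infty)$, and there is a simply connected domain $V\subseteq\mathbb{D}$ with $1\in\partial V$ such that $$\frac{|1-f(v)|^2}{1-|f(v)|^2}\le A\,\frac{|1-B(v)|^2}{1-|B(v)|^2}\qquad\text{for all }v\in V.$$ Moreover, if $$f(z_n)=B(z_n)+o(|1-z_n|)\quad\text{as }n\to\infty,$$ then $A=1$.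
   Context: $\mathbb{D}=\{z\in\mathbb{C}: |z|<1\}$ is the open unit disk. Critical points: a point $z\in\mathbb{D}$ is a critical point of multiplicity $m$ of a holomorphic $f:\mathbb{D}\to\mathbb{D}$ if it is a zero of multiplicity $m$ of $f'$. $\mathcal{C}_f$ denotes the collection of critical points of $f$ counting multiplicities. ''$\mathcal{C}_B$ is a subcollection of $\mathcal{C}_f$'' means that every critical point of $B$ is a critical point of $f$ with at least the same multiplicity. Maximal Blaschke product (MBP): let $f:\mathbb{D}\to\mathbb{D}$ be holomorphic. A (finite or infinite) Blaschke product $B$, regarded as a holomorphic self-map of $\mathbb{D}$, is called a maximal Blaschke product for $f$ if $\mathcal{C}_B$ is a subcollection of $\mathcal{C}_f$ and $$\frac{|g'(z)|}{1-|g(z)|^2}\le\frac{|B'(z)|}{1-|B(z)|^2}\qquad\text{for all }z\in\mathbb{D}$$ for every holomorphic function $g:\mathbb{D}\to\mathbb{D}$ such that $\mathcal{C}_B$ is also a subcollection of $\mathcal{C}_g$. Non-tangential convergence and angular limits: let $d_{\mathbb{D}}(z,w)=2\tanh^{-1}\left|\frac{z-w}{1-\overline{z}w}\right|$ be the hyperbolic distance, and for $\xi\in\partial\mathbb{D}$, $m>0$ let $S(m,\xi)=\{z\in\mathbb{D}: d_{\mathbb{D}}(z,(\xi,-\xi)_h)<m\}$, where $(\xi,-\xi)_h$ is the hyperbolic geodesic line with end points $\xi$ and $-\xi$ (the diameter $\{t\xi:-1<t<1\}$). A sequence $(z_n)\subseteq\mathbb{D}$ converges to $\xi$ non-tangentially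 if $z_n\to\xi$ and there is $m>0$ such that $z_n\in S(m,\xi)$ for all sufficiently large $n$. A holomorphic $g:\mathbb{D}\to\mathbb{D}$ has angular limit $\sigma\in\overline{\mathbb{D}}$ at $\xi$, written $g(\xi)=\sigma$, if for every $m>0$, $g(z)\to\sigma$ as $z\to\xi$ within $S(m,\xi)$. *)

(* Defs.v *)
From Stdlib Require Import Reals.
From Coquelicot Require Import Coquelicot.
Open Scope C_scope.

(* Stdlib's [R] with Coquelicot's [C].  A map on the disk is a total function
   [C -> C] of which only the values on [disk] are ever used. *)

Definition disk (z : C) : Prop := (Cmod z < 1)%R.

Definition holomorphic_on (D : C -> Prop) (f : C -> C) : Prop :=
  forall z, D z -> ex_derive f z.

Definition holomorphic_self_map (f : C -> C) : Prop :=
  holomorphic_on disk f /\ forall z, disk z -> disk (f z).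

Definition zero_mult_ge (F : C -> C) (a : C) (m : nat) : Prop :=
  exists h : C -> C,
    locally a (fun z => ex_derive h z /\ F z = (z - a) ^ m * h z).

Definition zero_mult (F : C -> C) (a : C) (m : nat) : Prop :=
  exists h : C -> C,
    locally a (fun z => ex_derive h z /\ F z = (z - a) ^ m * h z)
    /\ h a <> 0.

Definition critical_point (f : C -> C) (a : C) (m : nat) : Prop :=
  disk a /\ (0 < m)%nat /\ zero_mult (C_derive f) a m.

(* [zero_mult_ge] rather than [zero_mult] on the side of [f]: if [f] is
   constant, every point is a critical point of infinite multiplicity. *)
Definition critical_subcollection (B f : C -> C) : Prop :=
  forall a m, critical_point B a m -> zero_mult_ge (C_derive f) a m.

Fixpoint Cprod (u : nat -> C) (n : nat) : C :=
  match n with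
  | O => 1
  | S k => Cprod u k * u k
  end.

(* (|a|/a) (a - z) / (1 - conj(a) z), with the usual convention that the
   factor of a zero at the origin is z. *)
Definition blaschke_factor (a z : C) : C :=
  if Ceq_dec a 0 then z
  else RtoC (Cmod a) / a * ((a - z) / (1 - Cconj a * z)).

Definition finite_blaschke_product (B : C -> C) : Prop :=
  exists (c : C) (a : nat -> C) (n : nat),
    Cmod c = 1%R
    /\ (forall k, (k < n)%nat -> disk (a k))
    /\ forall z, disk z -> B z = c * Cprod (fun k => blaschke_factor (a k) z) n.

Definition infinite_blaschke_product (B : C -> C) : Prop :=
  exists (c : C) (a : nat -> C),
    Cmod c = 1%R
    /\ (forall k, disk (a k))
    /\ ex_series (fun k => 1 - Cmod (a k))%R
    /\ forall z, disk z ->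
         filterlim (fun n => c * Cprod (fun k => blaschke_factor (a k) z) n)
           eventually (locally (B z)).

Definition blaschke_product (B : C -> C) : Prop :=
  finite_blaschke_product B \/ infinite_blaschke_product B.

(* The pullback |f'(z)| / (1 - |f(z)|^2) of the hyperbolic density. *)
Definition hyp_derivative (f : C -> C) (z : C) : R :=
  (Cmod (C_derive f z) / (1 - Cmod (f z) ^ 2))%R.

Definition maximal_blaschke_product (f B : C -> C) : Prop :=
  holomorphic_self_map B
  /\ blaschke_product B
  /\ critical_subcollection B f
  /\ forall g, holomorphic_self_map g -> critical_subcollection B g ->
       forall z, disk z -> (hyp_derivative g z <= hyp_derivative B z)%R.

Definition atanh (x : R) : R := (/ 2 * ln ((1 + x) / (1 - x)))%R.

Definition hdist (z w : C) : R :=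
  (2 * atanh (Cmod ((z - w) / (1 - Cconj z * w))))%R.

Definition hdist_set (z : C) (E : C -> Prop) : Rbar :=
  Glb_Rbar (fun r => exists w, E w /\ r = hdist z w).

(* The hyperbolic geodesic line with end points xi and -xi. *)
Definition diameter (xi w : C) : Prop :=
  exists t : R, (-1 < t < 1)%R /\ w = RtoC t * xi.

Definition stolz (m : R) (xi z : C) : Prop :=
  disk z /\ Rbar_lt (hdist_set z (diameter xi)) m.

Definition nontangential (z : nat -> C) (xi : C) : Prop :=
  filterlim z eventually (locally xi)
  /\ exists m : R, (0 < m)%R /\ eventually (fun n => stolz m xi (z n)).

Definition angular_limit (g : C -> C) (xi sigma : C) : Prop :=
  forall m : R, (0 < m)%R ->
    filterlim g (within (stolz m xi) (locally xi)) (locally sigma).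

(* [is_LimInf_seq] with an arbitrary filter in place of [eventually]. *)
Definition is_LimInf {T : Type} (F : (T -> Prop) -> Prop) (u : T -> R)
    (l : Rbar) : Prop :=
  match l with
  | Finite l0 =>
      forall eps : posreal,
        (forall P, F P -> exists x, P x /\ (u x < l0 + eps)%R)
        /\ F (fun x => (l0 - eps < u x)%R)
  | p_infty => forall M : R, F (fun x => (M < u x)%R)
  | m_infty => forall (M : R) P, F P -> exists x, P x /\ (u x < M)%R
  end.

Definition bigO (u v : nat -> C) : Prop :=
  exists M : R, eventually (fun n => (Cmod (u n) <= M * Cmod (v n))%R).

(* Coquelicot's [is_domin F v u] takes the dominating function first. *)
Definition littleo (u v : nat -> C) : Prop := is_domin eventually v u.

Definition boundary (V : C -> Prop) (x : C) : Prop :=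
  forall P, locally x P ->
    (exists y, P y /\ V y) /\ (exists y, P y /\ ~ V y).

Definition connected (V : C -> Prop) : Prop :=
  forall U1 U2 : C -> Prop,
    open U1 -> open U2 ->
    (forall z, V z -> U1 z \/ U2 z) ->
    (forall z, V z -> ~ (U1 z /\ U2 z)) ->
    (forall z, V z -> U1 z) \/ (forall z, V z -> U2 z).

Definition planar_domain (V : C -> Prop) : Prop :=
  open V /\ connected V /\ exists z, V z.

Definition unit_interval (t : R) : Prop := (0 <= t <= 1)%R.

Definition unit_square (p : R * R) : Prop :=
  unit_interval (fst p) /\ unit_interval (snd p).

Definition loop_in (V : C -> Prop) (gamma : R -> C) : Prop :=
  continuous_on unit_interval gamma
  /\ (forall t, unit_interval t -> V (gamma t))
  /\ gamma 0%R = gamma 1%R.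

Definition null_homotopic_in (V : C -> Prop) (gamma : R -> C) : Prop :=
  exists H : R * R -> C,
    continuous_on unit_square H
    /\ (forall p, unit_square p -> V (H p))
    /\ (forall t, unit_interval t ->
          H (0%R, t) = gamma t /\ H (1%R, t) = gamma 0%R)
    /\ (forall s, unit_interval s ->
          H (s, 0%R) = gamma 0%R /\ H (s, 1%R) = gamma 0%R).

Definition simply_connected_domain (V : C -> Prop) : Prop :=
  planar_domain V /\ forall gamma, loop_in V gamma -> null_homotopic_in V gamma.

(* Main.v *)
(* In the half-plane coordinate (1+z)/(1-z), which sends 1 to infinity, let F and
   G be the lifts of B and f. Schwarz-Pick applied to F(z) - c z, where
   c = inf Re F(x)/x, gives F(z) = c z + o(z) and F' -> c in sectors, and c > 0
   because alpha_B is finite; likewise G(z) = kappa z + o(z), and f - B = O(1-z)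
   along (z_n) forces kappa > 0. Hence A = c/kappa. Maximality of B, tested on f, is
   |G'|/Re G <= |F'|/Re F. So Re G/Re F decreases along the curves W with
   F(W(s)) = F(z) + s, which exist for z far out in a sector since F' is close to
   c there; they tend to infinity in the sector, where Re G/Re F tends to kappa/c.
   Therefore Re F <= A Re G near infinity in a sector, which is the claim, since
   Re F = (1-|B|^2)/|1-B|^2.

   Holomorphic only means complex differentiable, so Schwarz-Pick is derived from
   Goursat's bisection argument, through circle means of f(z)/z. *)

(* Maximality compares only the moduli of F' and G', so it is integrated along curves that
   straighten F: F(W(s)) = F(z) + s gives W' = 1/F'(W), hence the derivative of Re G(W) is at most
   |G'|/|F'| <= Re G / Re F, while Re F(W) grows at unit rate. At infinity this needs only a lower
   bound for Re G (Julia) and an upper bound for Re F. The value of A is a matter of scaling. At a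
   point w of the disk, Re G is about kappa times Re of the coordinate of w, and |1 - f| = 2/|G + 1|
   is about |1 - w|/kappa, so 1 - |f| scales like 1/kappa; for B it scales like 1/c. Likewise f - B
   = O(1 - z) keeps 1/kappa finite, and o(1 - z) forces 1/kappa = 1/c. Positivity of c is delicate
   because the points realising alpha_B may approach 1 tangentially: the estimate is moved to the
   radius first, and then 1/F, again a map of the half-plane, is bounded. Schwarz-Pick acts
   throughout as a differential inequality: monotonicity, Harnack and Julia's inequality all come
   from integrating it. *)
Require Import Defs.
From Stdlib Require Import Reals Lra Lia Psatz ClassicalEpsilon.
From Coquelicot Require Import Coquelicot.
Open Scope R_scope.

(** * Goursat's theorem on rectangles *)

(** One of the two Cauchy-Riemann equations, P_x = Q_y; it suffices because only means of real parts
    are used. The partial derivatives need not be continuous, which rules out Green's theorem and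
    calls for bisection. *)
Definition divergence_free_on (P Q : R -> R -> R) (a b c d : R) : Prop :=
  forall x y, a <= x <= b -> c <= y <= d ->
    exists p q r, differentiable_pt_lim P x y p q /\ differentiable_pt_lim Q x y r p.

(* The outward flux of the field (P, -Q). *)
Definition flux (P Q : R -> R -> R) (a b c d : R) : R :=
  RInt (P b) c d - RInt (P a) c d
  - (RInt (fun x => Q x d) a b - RInt (fun x => Q x c) a b).

Lemma differentiable_continuous_l (P : R -> R -> R) (x y p q : R) :
  differentiable_pt_lim P x y p q -> continuous (fun u => P u y) x.
Proof.
intros H; apply (ex_derive_continuous (K := R_AbsRing) (V := R_NormedModule) (fun u => P u y)).
exists (p * 1 + q * 0); apply is_derive_Reals.
apply (derivable_pt_lim_comp_2d P (fun u => u) (fun _ => y)); [exact H| |].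
- apply derivable_pt_lim_id.
- apply derivable_pt_lim_const.
Qed.

Lemma differentiable_continuous_r (P : R -> R -> R) (x y p q : R) :
  differentiable_pt_lim P x y p q -> continuous (P x) y.
Proof.
intros H; apply (ex_derive_continuous (K := R_AbsRing) (V := R_NormedModule) (P x)).
exists (p * 0 + q * 1); apply is_derive_Reals.
apply (derivable_pt_lim_comp_2d P (fun _ => x) (fun u => u)); [exact H| |].
- apply derivable_pt_lim_const.
- apply derivable_pt_lim_id.
Qed.

Lemma divergence_free_on_incl {P Q : R -> R -> R} a b c d a' b' c' d' :
  divergence_free_on P Q a b c d -> a <= a' -> b' <= b -> c <= c' -> d' <= d ->
  divergence_free_on P Q a' b' c' d'.
Proof. intros H ? ? ? ? x y Hx Hy; apply H; lra. Qed.

Lemma ex_RInt_vertical {P Q : R -> R -> R} a b c d x :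
  divergence_free_on P Q a b c d -> a <= x <= b -> c <= d -> ex_RInt (P x) c d.
Proof.
intros H Hx Hcd; apply (ex_RInt_continuous (V := R_CompleteNormedModule)); intros y Hy.
rewrite Rmin_left, Rmax_right in Hy by assumption.
destruct (H x y Hx Hy) as (p & q & r & H1 & _).
exact (differentiable_continuous_r _ _ _ _ _ H1).
Qed.

Lemma ex_RInt_horizontal {P Q : R -> R -> R} a b c d y :
  divergence_free_on P Q a b c d -> c <= y <= d -> a <= b -> ex_RInt (fun x => Q x y) a b.
Proof.
intros H Hy Hab; apply (ex_RInt_continuous (V := R_CompleteNormedModule)); intros x Hx.
rewrite Rmin_left, Rmax_right in Hx by assumption.
destruct (H x y Hx Hy) as (p & q & r & _ & H1).
exact (differentiable_continuous_l _ _ _ _ _ H1).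
Qed.

Lemma flux_split_vertical {P Q : R -> R -> R} a b c d m :
  divergence_free_on P Q a b c d -> a <= m <= b -> c <= d ->
  flux P Q a b c d = flux P Q a m c d + flux P Q m b c d.
Proof.
intros H Hm Hcd; unfold flux.
assert (E : forall y, c <= y <= d ->
  RInt (fun x => Q x y) a b = RInt (fun x => Q x y) a m + RInt (fun x => Q x y) m b).
{ intros y Hy; symmetry; apply (RInt_Chasles (V := R_CompleteNormedModule) (fun x => Q x y)).
  - apply (ex_RInt_horizontal (P := P) a m c d); try lra.
    apply (divergence_free_on_incl a b c d); try lra; exact H.
  - apply (ex_RInt_horizontal (P := P) m b c d); try lra.
    apply (divergence_free_on_incl a b c d); try lra; exact H. }
rewrite (E c), (E d) by lra; ring.
Qed.

Lemma flux_split_horizontal {P Q : R -> R -> R} a b c d m :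
  divergence_free_on P Q a b c d -> a <= b -> c <= m <= d ->
  flux P Q a b c d = flux P Q a b c m + flux P Q a b m d.
Proof.
intros H Hab Hm; unfold flux.
assert (E : forall x, a <= x <= b -> RInt (P x) c d = RInt (P x) c m + RInt (P x) m d).
{ intros y Hy; symmetry; apply (RInt_Chasles (V := R_CompleteNormedModule) (P y)).
  - apply (ex_RInt_vertical (Q := Q) a b c m); try lra.
    apply (divergence_free_on_incl a b c d); try lra; exact H.
  - apply (ex_RInt_vertical (Q := Q) a b m d); try lra.
    apply (divergence_free_on_incl a b c d); try lra; exact H. }
rewrite (E a), (E b) by lra; ring.
Qed.

Lemma RInt_near_const (f : R -> R) (a b k M : R) :
  a <= b -> ex_RInt f a b -> (forall t, a <= t <= b -> Rabs (f t - k) <= M) ->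
  Rabs (RInt f a b - k * (b - a)) <= (b - a) * M.
Proof.
intros Hab Hf HM.
assert (Hk : ex_RInt (fun _ : R => k) a b) by apply ex_RInt_const.
replace (RInt f a b - k * (b - a)) with (RInt (fun t => f t - k) a b).
- apply abs_RInt_le_const; [exact Hab | | exact HM].
  apply (ex_RInt_minus (V := R_NormedModule) f (fun _ => k)); assumption.
- transitivity (RInt f a b - RInt (fun _ : R => k) a b).
  + apply (RInt_minus (V := R_CompleteNormedModule) f (fun _ => k)); assumption.
  + rewrite RInt_const; change scal with Rmult; simpl; ring.
Qed.

(* The flux of the affine approximation of [(P, Q)] at [(x0, y0)] vanishes. *)
Lemma flux_local {P Q : R -> R -> R} x0 y0 p q r (eps : posreal) :
  differentiable_pt_lim P x0 y0 p q -> differentiable_pt_lim Q x0 y0 r p ->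
  exists delta : posreal, forall a b c d,
    divergence_free_on P Q a b c d -> a <= x0 <= b -> c <= y0 <= d ->
    (b - a) + (d - c) < delta ->
    Rabs (flux P Q a b c d) <= eps * ((b - a) + (d - c)) ^ 2.
Proof.
intros HP HQ.
destruct (HP (pos_div_2 eps)) as [d1 H1]; destruct (HQ (pos_div_2 eps)) as [d2 H2].
assert (Hd : 0 < Rmin d1 d2) by (apply Rmin_pos; apply cond_pos).
exists (mkposreal _ Hd); simpl; intros a b c d Hdf Hx Hy Hs.
assert (Hs1 := Rlt_le_trans _ _ _ Hs (Rmin_l _ _)).
assert (Hs2 := Rlt_le_trans _ _ _ Hs (Rmin_r _ _)).
set (s := (b - a) + (d - c)) in *.
assert (Hs0 : 0 <= s) by (unfold s; lra).
pose proof (cond_pos eps) as He.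
assert (Hmax : forall x y, a <= x <= b -> c <= y <= d ->
  Rmax (Rabs (x - x0)) (Rabs (y - y0)) <= s).
{ intros x y Hx' Hy'; apply Rmax_lub; apply Rabs_le; unfold s; lra. }
assert (E1 : forall x y, a <= x <= b -> c <= y <= d ->
  Rabs (P x y - P x0 y0 - (p * (x - x0) + q * (y - y0))) <= eps / 2 * s).
{ intros x y Hx' Hy'.
  assert (Hxx : Rabs (x - x0) <= s) by (apply Rle_trans with (2 := Hmax x y Hx' Hy'), Rmax_l).
  assert (Hyy : Rabs (y - y0) <= s) by (apply Rle_trans with (2 := Hmax x y Hx' Hy'), Rmax_r).
  apply Rle_trans with (eps / 2 * Rmax (Rabs (x - x0)) (Rabs (y - y0))).
  - apply H1; lra.
  - apply Rmult_le_compat_l; [lra | apply Hmax; assumption]. }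
assert (E2 : forall x y, a <= x <= b -> c <= y <= d ->
  Rabs (Q x y - Q x0 y0 - (r * (x - x0) + p * (y - y0))) <= eps / 2 * s).
{ intros x y Hx' Hy'.
  assert (Hxx : Rabs (x - x0) <= s) by (apply Rle_trans with (2 := Hmax x y Hx' Hy'), Rmax_l).
  assert (Hyy : Rabs (y - y0) <= s) by (apply Rle_trans with (2 := Hmax x y Hx' Hy'), Rmax_r).
  apply Rle_trans with (eps / 2 * Rmax (Rabs (x - x0)) (Rabs (y - y0))).
  - apply H2; lra.
  - apply Rmult_le_compat_l; [lra | apply Hmax; assumption]. }
assert (Ea := ex_RInt_vertical a b c d a Hdf ltac:(lra) ltac:(lra)).
assert (Eb := ex_RInt_vertical a b c d b Hdf ltac:(lra) ltac:(lra)).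
assert (Ec := ex_RInt_horizontal a b c d c Hdf ltac:(lra) ltac:(lra)).
assert (Ed := ex_RInt_horizontal a b c d d Hdf ltac:(lra) ltac:(lra)).
(* Opposite sides are subtracted before integrating: the affine parts leave p (b - a) here and p (d
   - c) in [B2], which give the same area term and cancel in the flux. Each difference carries two
   errors eps/2 * s. *)
assert (B1 : Rabs (RInt (fun y => P b y - P a y) c d - p * (b - a) * (d - c))
             <= (d - c) * (eps * s)).
{ apply RInt_near_const; [lra | |].
  - apply (ex_RInt_minus (V := R_NormedModule) (P b) (P a)); assumption.
  - intros y Hy'.
    pose proof (E1 b y ltac:(lra) Hy') as U1; pose proof (E1 a y ltac:(lra) Hy') as U2.
    apply Rabs_le_between in U1; apply Rabs_le_between in U2; apply Rabs_le; nra. }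
assert (B2 : Rabs (RInt (fun x => Q x d - Q x c) a b - p * (d - c) * (b - a))
             <= (b - a) * (eps * s)).
{ apply RInt_near_const; [lra | |].
  - apply (ex_RInt_minus (V := R_NormedModule) (fun x => Q x d) (fun x => Q x c)); assumption.
  - intros x Hx'.
    pose proof (E2 x d Hx' ltac:(lra)) as U1; pose proof (E2 x c Hx' ltac:(lra)) as U2.
    apply Rabs_le_between in U1; apply Rabs_le_between in U2; apply Rabs_le; nra. }
rewrite (RInt_minus (V := R_CompleteNormedModule) (P b) (P a)) in B1 by assumption.
rewrite (RInt_minus (V := R_CompleteNormedModule) (fun x => Q x d) (fun x => Q x c))
  in B2 by assumption.
change minus with Rminus in B1, B2.
unfold flux.
apply Rabs_le_between in B1; apply Rabs_le_between in B2; apply Rabs_le.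
replace (eps * (s * (s * 1))) with ((d - c) * (eps * s) + (b - a) * (eps * s))
  by (unfold s; ring).
lra.
Qed.

(** Halving the sides divides the squared half-perimeter by 4, and the flux is the sum over 4
    quarters, so they cannot all satisfy the bound that the whole violates. *)
Lemma flux_quarter {P Q : R -> R -> R} a c l m k :
  0 <= l -> 0 <= m -> divergence_free_on P Q a (a + l) c (c + m) ->
  k * (l + m) ^ 2 < Rabs (flux P Q a (a + l) c (c + m)) ->
  exists a' c', (a <= a' <= a + l / 2) /\ (c <= c' <= c + m / 2) /\
    k * (l / 2 + m / 2) ^ 2 < Rabs (flux P Q a' (a' + l / 2) c' (c' + m / 2)).
Proof.
intros Hl Hm Hdf Hbig.
assert (E : flux P Q a (a + l) c (c + m)
  = flux P Q a (a + l / 2) c (c + m / 2)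
    + flux P Q a (a + l / 2) (c + m / 2) (c + m / 2 + m / 2)
    + flux P Q (a + l / 2) (a + l / 2 + l / 2) c (c + m / 2)
    + flux P Q (a + l / 2) (a + l / 2 + l / 2) (c + m / 2) (c + m / 2 + m / 2)).
{ replace (a + l / 2 + l / 2) with (a + l) by field.
  replace (c + m / 2 + m / 2) with (c + m) by field.
  rewrite (flux_split_vertical a (a + l) c (c + m) (a + l / 2)) by (assumption || lra).
  rewrite (flux_split_horizontal a (a + l / 2) c (c + m) (c + m / 2));
    [|apply (divergence_free_on_incl a (a + l) c (c + m)); (assumption || lra)|lra|lra].
  rewrite (flux_split_horizontal (a + l / 2) (a + l) c (c + m) (c + m / 2));
    [|apply (divergence_free_on_incl a (a + l) c (c + m)); (assumption || lra)|lra|lra].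
  ring. }
apply NNPP; intros Hno.
assert (Hsmall : forall a' c', a <= a' <= a + l / 2 -> c <= c' <= c + m / 2 ->
  Rabs (flux P Q a' (a' + l / 2) c' (c' + m / 2)) <= k * (l / 2 + m / 2) ^ 2).
{ intros a' c' Ha Hc; apply Rnot_lt_le; intros Hlt; apply Hno; exists a', c'; auto. }
pose proof (Hsmall a c ltac:(lra) ltac:(lra)) as S1.
pose proof (Hsmall a (c + m / 2) ltac:(lra) ltac:(lra)) as S2.
pose proof (Hsmall (a + l / 2) c ltac:(lra) ltac:(lra)) as S3.
pose proof (Hsmall (a + l / 2) (c + m / 2) ltac:(lra) ltac:(lra)) as S4.
apply (Rlt_not_le _ _ Hbig); rewrite E.
replace (k * (l + m) ^ 2) with (4 * (k * (l / 2 + m / 2) ^ 2)) by field.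
apply Rabs_le_between in S1, S2, S3, S4; apply Rabs_le; lra.
Qed.

Lemma nested_sequence (u : nat -> R) (l : R) :
  (forall n, u n <= u (S n) <= u n + l / 2 ^ S n) ->
  exists x, forall n, u n <= x <= u n + l / 2 ^ n.
Proof.
intros H.
assert (Hp : forall n, 0 < 2 ^ n) by (intros n; apply pow_lt; lra).
assert (Hv : forall n, u (S n) + l / 2 ^ S n <= u n + l / 2 ^ n).
{ intros n; specialize (H n); simpl in *; specialize (Hp n).
  replace (l / 2 ^ n) with (l / (2 * 2 ^ n) + l / (2 * 2 ^ n)) by (field; lra); lra. }
assert (Hup : forall n k, u n <= u (k + n)%nat).
{ intros n k; induction k as [|k IH]; simpl; [lra|]; pose proof (H (k + n)%nat); lra. }
assert (Hdn : forall n k, u (k + n)%nat + l / 2 ^ (k + n) <= u n + l / 2 ^ n).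
{ intros n k; induction k as [|k IH]; simpl; [lra|]; pose proof (Hv (k + n)%nat).
  simpl in *; lra. }
assert (Hl : 0 <= l).
{ pose proof (H 0%nat) as H0; simpl in H0; lra. }
assert (Hq : forall n, 0 <= l / 2 ^ n).
{ intros n; apply Rmult_le_pos; [exact Hl | left; apply Rinv_0_lt_compat, Hp]. }
assert (Hle : forall n m, u m <= u n + l / 2 ^ n).
{ intros n m; pose proof (Hup m n) as U1; pose proof (Hdn n m) as U2.
  pose proof (Hq (m + n)%nat); rewrite (PeanoNat.Nat.add_comm n m) in U1; lra. }
destruct (completeness (fun x => exists n, x = u n)) as [x [Hub Hlub]].
- exists (u 0%nat + l / 2 ^ 0); intros x [n ->]; apply Hle.
- exists (u 0%nat), 0%nat; reflexivity.
- exists x; intros n; split.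
  + apply Hub; exists n; reflexivity.
  + apply Hlub; intros y [m ->]; apply Hle.
Qed.

Lemma goursat {P Q : R -> R -> R} a b c d :
  a <= b -> c <= d -> divergence_free_on P Q a b c d -> flux P Q a b c d = 0.
Proof.
intros Hab Hcd Hdf.
apply NNPP; intros Hne.
set (l := b - a); set (m := d - c).
assert (Hl : 0 <= l) by (unfold l; lra); assert (Hm : 0 <= m) by (unfold m; lra).
assert (Hpos : 0 < Rabs (flux P Q a b c d)) by (apply Rabs_pos_lt; exact Hne).
assert (Hk : exists k, 0 < k /\ k * (l + m) ^ 2 < Rabs (flux P Q a b c d)).
(* The summand 1 keeps the quotient meaningful for a rectangle reduced to a point. *)
{ assert (Hsq : 0 < (l + m) ^ 2 + 1) by nra.
  exists (Rabs (flux P Q a b c d) / ((l + m) ^ 2 + 1)); split.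
  - apply Rdiv_lt_0_compat; assumption.
  - apply Rmult_lt_reg_r with ((l + m) ^ 2 + 1); [exact Hsq|].
    field_simplify; nra. }
destruct Hk as [k [Hk0 Hk]].
pose (bad := fun (n : nat) (p : R * R) =>
  a <= fst p /\ fst p + l / 2 ^ n <= b /\ c <= snd p /\ snd p + m / 2 ^ n <= d /\
  k * (l / 2 ^ n + m / 2 ^ n) ^ 2
    < Rabs (flux P Q (fst p) (fst p + l / 2 ^ n) (snd p) (snd p + m / 2 ^ n))).
assert (Hp2 : forall n, 0 < 2 ^ n) by (intros n; apply pow_lt; lra).
assert (Hl2 : forall n, 0 <= l / 2 ^ n).
{ intros n; apply Rmult_le_pos; [exact Hl | left; apply Rinv_0_lt_compat, Hp2]. }
assert (Hm2 : forall n, 0 <= m / 2 ^ n).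
{ intros n; apply Rmult_le_pos; [exact Hm | left; apply Rinv_0_lt_compat, Hp2]. }
assert (Hhalf : forall t n, t / 2 ^ S n = t / 2 ^ n / 2).
{ intros t n; specialize (Hp2 n); simpl; field; lra. }
(* The hypothesis [bad n p] sits under the existential, so that choice yields a total function
   [next] on lower-left corners. *)
assert (Hstep : forall n p, exists p', bad n p -> bad (S n) p' /\
  (fst p <= fst p' <= fst p + l / 2 ^ S n) /\ (snd p <= snd p' <= snd p + m / 2 ^ S n)).
{ intros n [x y]; destruct (classic (bad n (x, y))) as [Hb|Hb];
    [|exists (x, y); intros H'; contradiction].
  destruct Hb as (B1 & B2 & B3 & B4 & B5); simpl in B1, B2, B3, B4, B5.
  destruct (flux_quarter (P := P) (Q := Q) x y (l / 2 ^ n) (m / 2 ^ n) k) as (x' & y' & H1 & H2 & H3);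
    [apply Hl2 | apply Hm2 | | exact B5 |].
  - apply (divergence_free_on_incl a b c d); (assumption || lra).
  - exists (x', y'); intros _; unfold bad; cbn [fst snd]; rewrite !Hhalf.
    repeat split; try lra; exact H3. }
pose (next := fun n p => proj1_sig (constructive_indefinite_description _ (Hstep n p))).
assert (Hnext : forall n p, bad n p -> bad (S n) (next n p) /\
  (fst p <= fst (next n p) <= fst p + l / 2 ^ S n) /\
  (snd p <= snd (next n p) <= snd p + m / 2 ^ S n)).
{ intros n p; unfold next; destruct (constructive_indefinite_description _ _); auto. }
pose (s := fix s (n : nat) : R * R := match n with O => (a, c) | S n => next n (s n) end).
assert (Hbad : forall n, bad n (s n)).
{ induction n as [|n IH].
  - unfold bad; simpl; unfold Rdiv; rewrite Rinv_1, !Rmult_1_r.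
    replace (a + l) with b by (unfold l; ring); replace (c + m) with d by (unfold m; ring).
    repeat split; try lra; simpl in Hk; rewrite ?Rmult_1_r in *; exact Hk.
  - apply (Hnext n (s n) IH). }
destruct (nested_sequence (fun n => fst (s n)) l) as [x Hx].
{ intros n; apply (Hnext n (s n) (Hbad n)). }
destruct (nested_sequence (fun n => snd (s n)) m) as [y Hy].
{ intros n; apply (Hnext n (s n) (Hbad n)). }
destruct (Hdf x y) as (p & q & r & HP & HQ).
{ pose proof (Hx 0%nat) as H0; simpl in H0; unfold l, Rdiv in H0; rewrite Rinv_1 in H0; lra. }
{ pose proof (Hy 0%nat) as H0; simpl in H0; unfold m, Rdiv in H0; rewrite Rinv_1 in H0; lra. }
(* Differentiability at the common point of the nested rectangles bounds the flux of the small ones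
   by k times the squared half-perimeter, against [bad]. *)
destruct (flux_local (P := P) (Q := Q) x y p q r (mkposreal k Hk0) HP HQ) as [del Hdel].
assert (Hn : exists n, l / 2 ^ n + m / 2 ^ n < del).
{ destruct (pow_lt_1_zero (/ 2)) with (y := del / (l + m + 1)) as [N HN].
  - rewrite Rabs_pos_eq; lra.
  - apply Rdiv_lt_0_compat; [apply cond_pos | lra].
  - exists N; specialize (HN N (le_n N)).
    rewrite pow_inv, Rabs_pos_eq in HN by (left; apply Rinv_0_lt_compat, Hp2).
    assert (Hi : 0 < / 2 ^ N) by apply Rinv_0_lt_compat, Hp2.
    apply Rmult_lt_compat_r with (r := l + m + 1) in HN; [|lra].
    unfold Rdiv in HN |- *; rewrite Rmult_assoc, Rinv_l in HN by lra; nra. }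
destruct Hn as [n Hn].
destruct (Hbad n) as (B1 & B2 & B3 & B4 & B5).
apply (Rlt_not_le _ _ B5).
pose proof (Hdel (fst (s n)) (fst (s n) + l / 2 ^ n) (snd (s n)) (snd (s n) + m / 2 ^ n)) as D.
simpl in D.
replace (fst (s n) + l / 2 ^ n - fst (s n)) with (l / 2 ^ n) in D by ring.
replace (snd (s n) + m / 2 ^ n - snd (s n)) with (m / 2 ^ n) in D by ring.
apply D; [|apply Hx|apply Hy|exact Hn].
apply (divergence_free_on_incl a b c d); (assumption || lra).
Qed.

Open Scope C_scope.

(** * Complex derivatives *)

Lemma is_derive_C_iff (f : C -> C) (z d : C) :
  is_derive f z d <->
  forall eps : posreal, exists delta : posreal, forall w,
    (Cmod (w - z) < delta)%R ->
    (Cmod (f w - f z - d * (w - z)) <= eps * Cmod (w - z))%R.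
Proof.
split.
- intros [_ Hd] eps.
  destruct (Hd z (fun P HP => HP) eps) as [del Hdel].
  exists del; intros w Hw.
  replace (d * (w - z)) with ((w - z) * d) by ring.
  apply Hdel. exact Hw.
- intros H; split; [apply is_linear_scal_l|].
  intros x Hx eps.
  replace x with z
    by (apply (is_filter_lim_locally_unique (V := AbsRing_NormedModule C_AbsRing)); exact Hx).
  destruct (H eps) as [del Hdel].
  exists del; intros w Hw.
  change (Cmod (f w - f z - (w - z) * d) <= eps * Cmod (w - z))%R.
  replace ((w - z) * d) with (d * (w - z)) by ring.
  apply Hdel; exact Hw.
Qed.

(* Coquelicot puts two normed module structures on [C], with different uniform
   structures. *)
Lemma is_derive_C_AbsRing (f : C -> C) (z d : C) :
  @is_derive C_AbsRing (AbsRing_NormedModule C_AbsRing) f z d <->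
  @is_derive C_AbsRing C_NormedModule f z d.
Proof.
split; intros [[L1 L2 L3] H]; (split; [constructor; [exact L1 | exact L2 | exact L3] | exact H]).
Qed.

Lemma Re_le_Cmod (z : C) : (Re z <= Cmod z)%R.
Proof. apply Rle_trans with (1 := Rle_abs _), re_le_Cmod. Qed.

Lemma Im_le_Cmod (z : C) : (Rabs (Im z) <= Cmod z)%R.
Proof. eapply Rle_trans; [apply Rmax_r | apply Rmax_Cmod]. Qed.

Lemma Cmod_le_Rabs (z : C) : (Cmod z <= Rabs (Re z) + Rabs (Im z))%R.
Proof.
destruct z as [x y]; simpl.
replace (x, y) with (RtoC x + RtoC y * Ci) by (unfold RtoC, Ci; apply injective_projections; simpl; ring).
eapply Rle_trans; [apply Cmod_triangle|].
rewrite Cmod_mult, !Cmod_R, Cmod_Ci; lra.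
Qed.

Lemma Cmod_minus_sym (a b : C) : Cmod (a - b) = Cmod (b - a).
Proof. rewrite <- Cmod_opp; f_equal; ring. Qed.

Lemma is_derive_Cmult (f g : C -> C) (z df dg : C) :
  is_derive f z df -> is_derive g z dg ->
  is_derive (fun w => f w * g w) z (df * g z + f z * dg).
Proof.
rewrite <- !is_derive_C_AbsRing; intros Hf Hg.
exact (is_derive_mult f g z df dg Hf Hg Cmult_comm).
Qed.

Lemma is_derive_Cinv (z : C) : z <> 0 -> is_derive Cinv z (- / (z * z)).
Proof.
intros Hz; apply is_derive_C_iff; intros eps.
assert (Hm : (0 < Cmod z)%R) by (apply Cmod_gt_0; exact Hz).
(* The remainder is (w - z)^2 / (z^2 w). The first bound gives |w| > |z|/2; the second then makes |w
   - z| at most eps |z|^2 |w|. *)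
assert (Hd : (0 < Rmin (Cmod z / 2) (eps * Cmod z ^ 3 / 2))%R).
{ apply Rmin_pos; [lra|].
  pose proof (cond_pos eps); pose proof (pow_lt _ 3 Hm); nra. }
exists (mkposreal _ Hd); simpl; intros w Hw.
assert (H1 := Rlt_le_trans _ _ _ Hw (Rmin_l _ _)).
assert (H2 := Rlt_le_trans _ _ _ Hw (Rmin_r _ _)).
assert (H3 : (Cmod z / 2 < Cmod w)%R).
{ pose proof (Cmod_triangle w (z - w)) as T.
  replace (w + (z - w)) with z in T by ring.
  rewrite Cmod_minus_sym in T; lra. }
assert (Hw0 : w <> 0) by (apply Cmod_gt_0; lra).
replace (/ w - / z - - / (z * z) * (w - z)) with ((w - z) * (w - z) / (z * z * w))
  by (field; split; assumption).
rewrite Cmod_div, !Cmod_mult by (repeat apply Cmult_neq_0; assumption).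
assert (H4 : (0 < Cmod z * Cmod z * Cmod w)%R)
  by (apply Rmult_lt_0_compat; [apply Rmult_lt_0_compat|]; lra).
apply (Rmult_le_reg_r (Cmod z * Cmod z * Cmod w)); [exact H4|].
unfold Rdiv; rewrite Rmult_assoc, Rinv_l, Rmult_1_r by lra.
pose proof (Cmod_ge_0 (w - z)) as H5.
pose proof (cond_pos eps) as H6.
apply Rle_trans with (eps * Cmod z ^ 3 / 2 * Cmod (w - z))%R.
- apply Rmult_le_compat_r; lra.
- replace (eps * Cmod (w - z) * (Cmod z * Cmod z * Cmod w))%R
    with (eps * (Cmod z * Cmod z) * Cmod w * Cmod (w - z))%R by ring.
  apply Rmult_le_compat_r; [exact H5|].
  assert (0 < eps * (Cmod z * Cmod z))%R by (apply Rmult_lt_0_compat; nra).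
  replace (eps * Cmod z ^ 3 / 2)%R with (eps * (Cmod z * Cmod z) * (Cmod z / 2))%R by field.
  apply Rmult_le_compat_l; lra.
Qed.

Lemma is_derive_Cconst (c z : C) : is_derive (fun _ : C => c) z (0 : C).
Proof. apply (is_derive_const (K := C_AbsRing) (V := C_NormedModule)). Qed.

Lemma is_derive_Cid (z : C) : is_derive (fun w : C => w) z (1 : C).
Proof. apply is_derive_C_AbsRing, (is_derive_id (K := C_AbsRing)). Qed.

Lemma is_derive_Cplus (f g : C -> C) (z df dg : C) :
  is_derive f z df -> is_derive g z dg ->
  is_derive (fun w => f w + g w) z (df + dg).
Proof. exact (is_derive_plus f g z df dg). Qed.

Lemma is_derive_Cminus (f g : C -> C) (z df dg : C) :
  is_derive f z df -> is_derive g z dg ->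
  is_derive (fun w => f w - g w) z (df - dg).
Proof. exact (is_derive_minus f g z df dg). Qed.

Lemma is_derive_Ccomp (f g : C -> C) (z df dg : C) :
  is_derive f (g z) df -> is_derive g z dg ->
  is_derive (fun w => f (g w)) z (df * dg).
Proof.
rewrite <- (is_derive_C_AbsRing g); intros Hf Hg; rewrite Cmult_comm.
exact (is_derive_comp f g z df dg Hf Hg).
Qed.

Lemma is_derive_Cdiv (f g : C -> C) (z df dg : C) :
  is_derive f z df -> is_derive g z dg -> g z <> 0 ->
  is_derive (fun w => f w / g w) z ((df * g z - f z * dg) / (g z * g z)).
Proof.
intros Hf Hg Hz.
replace ((df * g z - f z * dg) / (g z * g z))
  with (df * / g z + f z * (- / (g z * g z) * dg)) by (field; assumption).
apply (is_derive_Cmult f (fun w => / g w)); [exact Hf|].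
apply (is_derive_Ccomp Cinv g); [apply is_derive_Cinv; exact Hz | exact Hg].
Qed.

Lemma Cmod_lt_Rmax (x y u v : R) (eps : posreal) :
  (Rabs (u - x) < eps / 2)%R -> (Rabs (v - y) < eps / 2)%R ->
  (Cmod ((u, v) - (x, y)) < eps)%R.
Proof.
intros Hu Hv; eapply Rle_lt_trans; [apply Cmod_le_Rabs|]; simpl.
replace (u + - x)%R with (u - x)%R by ring; replace (v + - y)%R with (v - y)%R by ring; lra.
Qed.

Lemma Cmod_le_2Rmax (x y u v : R) :
  (Cmod ((u, v) - (x, y)) <= 2 * Rmax (Rabs (u - x)) (Rabs (v - y)))%R.
Proof.
eapply Rle_trans; [apply Cmod_le_Rabs|]; simpl.
replace (u + - x)%R with (u - x)%R by ring; replace (v + - y)%R with (v - y)%R by ring.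
pose proof (Rmax_l (Rabs (u - x)) (Rabs (v - y)));
pose proof (Rmax_r (Rabs (u - x)) (Rabs (v - y))); lra.
Qed.

Lemma is_derive_differentiable_Re (f : C -> C) (x y : R) (d : C) :
  is_derive f (x, y) d ->
  differentiable_pt_lim (fun u v => Re (f (u, v))) x y (Re d) (- Im d).
Proof.
intros H eps.
destruct (proj1 (is_derive_C_iff _ _ _) H (pos_div_2 eps)) as [del Hdel].
exists (pos_div_2 del); intros u v Hu Hv.
specialize (Hdel (u, v) (Cmod_lt_Rmax x y u v del Hu Hv)).
pose proof (re_le_Cmod (f (u, v) - f (x, y) - d * ((u, v) - (x, y)))) as H1.
pose proof (Cmod_le_2Rmax x y u v) as H2.
pose proof (cond_pos eps) as H3; simpl in Hdel.
replace (Re (f (u, v)) - Re (f (x, y)) - (Re d * (u - x) + - Im d * (v - y)))%R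
  with (Re (f (u, v) - f (x, y) - d * ((u, v) - (x, y))))
  by (unfold Re, Im; simpl; ring).
nra.
Qed.

Lemma is_derive_differentiable_Im (f : C -> C) (x y : R) (d : C) :
  is_derive f (x, y) d ->
  differentiable_pt_lim (fun u v => Im (f (u, v))) x y (Im d) (Re d).
Proof.
intros H eps.
destruct (proj1 (is_derive_C_iff _ _ _) H (pos_div_2 eps)) as [del Hdel].
exists (pos_div_2 del); intros u v Hu Hv.
specialize (Hdel (u, v) (Cmod_lt_Rmax x y u v del Hu Hv)).
pose proof (Im_le_Cmod (f (u, v) - f (x, y) - d * ((u, v) - (x, y)))) as H1.
pose proof (Cmod_le_2Rmax x y u v) as H2.
pose proof (cond_pos eps) as H3; simpl in Hdel.
replace (Im (f (u, v)) - Im (f (x, y)) - (Im d * (u - x) + Re d * (v - y)))%R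
  with (Im (f (u, v) - f (x, y) - d * ((u, v) - (x, y))))
  by (unfold Re, Im; simpl; ring).
nra.
Qed.

Lemma is_derive_Re_curve (f g : R -> R) (F : C -> C) (t : R) (d : C) (f' g' : R) :
  is_derive F (f t, g t) d -> is_derive f t f' -> is_derive g t g' ->
  is_derive (fun s => Re (F (f s, g s))) t (Re (d * (f', g'))).
Proof.
intros HF Hf Hg; apply is_derive_Reals.
replace (Re (d * (f', g'))) with (Re d * f' + - Im d * g')%R by (unfold Re, Im; simpl; ring).
apply (derivable_pt_lim_comp_2d (fun u v => Re (F (u, v)))).
- apply is_derive_differentiable_Re; exact HF.
- apply is_derive_Reals; exact Hf.
- apply is_derive_Reals; exact Hg.
Qed.

Lemma is_derive_nonincreasing (f f' : R -> R) (a b : R) :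
  (a <= b)%R ->
  (forall t, (a <= t <= b)%R -> is_derive f t (f' t)) ->
  (forall t, (a <= t <= b)%R -> (f' t <= 0)%R) -> (f b <= f a)%R.
Proof.
intros Hab Hd Hs.
destruct (MVT_gen f a b f') as [c [Hc Heq]].
- intros x Hx; rewrite Rmin_left, Rmax_right in Hx by assumption; apply Hd; lra.
- intros x Hx; rewrite Rmin_left, Rmax_right in Hx by assumption.
  apply derivable_continuous_pt; exists (f' x).
  apply is_derive_Reals, Hd; exact Hx.
- rewrite Rmin_left, Rmax_right in Hc by assumption.
  specialize (Hs c Hc); nra.
Qed.

(** Reduces estimates of moduli to estimates of real parts, to which one-variable calculus applies.
    At z = 0 any unit number would do. *)
Lemma phase_exists (z : C) : exists e : C, Cmod e = 1%R /\ e * z = RtoC (Cmod z).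
Proof.
destruct (Ceq_dec z 0) as [->|Hz].
- exists 1; split; [apply Cmod_1|]; rewrite Cmod_0; ring.
- assert (Hm : Cmod z <> 0%R) by (intros H; apply Hz, Cmod_eq_0; exact H).
  assert (Hm' : RtoC (Cmod z) <> 0) by (intros H; apply Hm; injection H; auto).
  exists (Cconj z / RtoC (Cmod z)); split.
  + rewrite Cmod_div, Cmod_conj, Cmod_R, Rabs_pos_eq by (assumption || apply Cmod_ge_0).
    field; exact Hm.
  + replace (Cconj z / RtoC (Cmod z) * z) with (z * Cconj z / RtoC (Cmod z)) by (field; exact Hm').
    rewrite <- Cmod2_conj, RtoC_pow; field; exact Hm'.
Qed.

Lemma Re_mult_phase (e z : C) : Cmod e = 1%R -> (Re (e * z) <= Cmod z)%R.
Proof.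
intros He; eapply Rle_trans; [apply Re_le_Cmod|]; rewrite Cmod_mult, He; lra.
Qed.

Lemma is_derive_Cscal (f : C -> C) (e z d : C) :
  is_derive f z d -> is_derive (fun w => e * f w) z (e * d).
Proof.
intros H; replace (e * d) with (0 * f z + e * d) by ring.
apply (is_derive_Cmult (fun _ => e) f); [apply is_derive_Cconst | exact H].
Qed.

(** After rotating F b - F a onto the positive axis, its modulus is the increment of a real function
    along the segment, whose slope is at most M |b - a|. *)
Lemma mean_value_inequality (F F' : C -> C) (a b : C) (M : R) :
  (forall t, (0 <= t <= 1)%R ->
     is_derive F (a + RtoC t * (b - a)) (F' (a + RtoC t * (b - a)))
     /\ (Cmod (F' (a + RtoC t * (b - a))%C) <= M)%R) ->
  (Cmod (F b - F a) <= M * Cmod (b - a))%R.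
Proof.
intros H.
destruct (phase_exists (F b - F a)) as [e [He Hez]].
set (p := fun t : R => (Re a + t * Re (b - a)%C)%R).
set (q := fun t : R => (Im a + t * Im (b - a)%C)%R).
assert (Epq : forall t, (p t, q t) = (a + RtoC t * (b - a))%C).
{ intros t; apply injective_projections; unfold p, q, Re, Im; simpl; ring. }
set (phi := fun t : R => (Re (e * F (p t, q t)) - t * (M * Cmod (b - a)))%R).
set (phi' := fun t : R =>
  (Re (e * F' (p t, q t) * (Re (b - a), Im (b - a))) - M * Cmod (b - a))%R).
assert (Hp : forall t, is_derive p t (Re (b - a))).
{ intros t; unfold p; auto_derive; [exact I | apply Rmult_1_l]. }
assert (Hq : forall t, is_derive q t (Im (b - a))).
{ intros t; unfold q; auto_derive; [exact I | apply Rmult_1_l]. }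
assert (Hle : (phi 1 <= phi 0)%R).
{ apply (is_derive_nonincreasing phi phi' 0 1); [lra | |].
  - intros t Ht; destruct (H t Ht) as [Hd _]; rewrite <- Epq in Hd.
    apply (is_derive_minus (K := R_AbsRing) (V := R_NormedModule)
      (fun t => Re (e * F (p t, q t))) (fun t => (t * (M * Cmod (b - a)))%R)).
    + apply (is_derive_Re_curve p q (fun w => e * F w)); [|apply Hp|apply Hq].
      apply is_derive_Cscal; exact Hd.
    + auto_derive; [exact I | ring].
  - intros t Ht; destruct (H t Ht) as [_ Hb]; rewrite <- Epq in Hb; unfold phi'.
    pose proof (Re_le_Cmod (e * F' (p t, q t) * (Re (b - a), Im (b - a)))) as H1.
    rewrite !Cmod_mult, He in H1.
    replace (Re (b - a), Im (b - a)) with (b - a) in H1 at 2 by (destruct (b - a); reflexivity).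
    replace (Re (b - a), Im (b - a)) with (b - a) in H1 at 1 by (destruct (b - a); reflexivity).
    replace (Re (b - a), Im (b - a)) with (b - a) at 1 by (destruct (b - a); reflexivity).
    pose proof (Cmod_ge_0 (b - a)); nra. }
unfold phi in Hle; rewrite !Epq in Hle.
replace (a + RtoC 1 * (b - a)) with b in Hle by ring.
replace (a + RtoC 0 * (b - a)) with a in Hle by ring.
assert (Heq : Re (e * F b) = (Re (e * F a) + Cmod (F b - F a))%R).
{ replace (e * F b) with (e * F a + e * (F b - F a)) by ring.
  rewrite re_plus, Hez, re_RtoC; reflexivity. }
lra.
Qed.

(** * The Schwarz lemma *)

Lemma differentiable_pt_lim_Rmult (a b : R) :
  differentiable_pt_lim Rmult a b b a.
Proof.
intros eps; exists eps; intros u v Hu Hv.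
replace (u * v - a * b - (b * (u - a) + a * (v - b)))%R with ((u - a) * (v - b))%R by ring.
rewrite Rabs_mult.
pose proof (Rmax_r (Rabs (u - a)) (Rabs (v - b))) as H1.
pose proof (Rabs_pos (u - a)) as H2; pose proof (Rabs_pos (v - b)) as H3.
apply Rle_trans with (eps * Rabs (v - b))%R.
- apply Rmult_le_compat_r; lra.
- apply Rmult_le_compat_l; [left; apply cond_pos | exact H1].
Qed.

Lemma differentiable_pt_lim_proj2 (f : R -> R) (x y l : R) :
  derivable_pt_lim f y l -> differentiable_pt_lim (fun _ v => f v) x y 0 l.
Proof.
intros H.
replace 0%R with (l * 0 + 0 * 1)%R by ring; replace l with (l * 1 + 0 * 0)%R at 2 by ring.
apply (differentiable_pt_lim_comp (fun u _ => f u) (fun _ v => v) (fun u _ => u)).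
- apply differentiable_pt_lim_proj1_0; exact H.
- intros eps; exists eps; intros u v _ _.
  replace (v - y - (0 * (u - x) + 1 * (v - y)))%R with 0%R by ring; rewrite Rabs_R0.
  apply Rmult_le_pos; [left; apply cond_pos|].
  apply Rle_trans with (2 := Rmax_l _ _), Rabs_pos.
- apply (differentiable_pt_lim_proj1_0 (fun u => u)), derivable_pt_lim_id.
Qed.

Lemma differentiable_pt_lim_exp_mult (f : R -> R) (x y l : R) :
  derivable_pt_lim f y l ->
  differentiable_pt_lim (fun u v => (exp u * f v)%R) x y (exp x * f y) (exp x * l).
Proof.
intros H.
replace (exp x * f y)%R with (f y * exp x + exp x * 0)%R by ring.
replace (exp x * l)%R with (f y * 0 + exp x * l)%R by ring.
apply (differentiable_pt_lim_comp Rmult (fun u _ => exp u) (fun _ v => f v)).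
- apply differentiable_pt_lim_Rmult.
- apply differentiable_pt_lim_proj1_0, derivable_pt_lim_exp.
- apply differentiable_pt_lim_proj2; exact H.
Qed.

(** This is exp (x + iy): x is the logarithm of the radius. An annulus becomes a rectangle, and g
    composed with it is still holomorphic in x + iy. *)
Definition polar (x y : R) : C := ((exp x * cos y)%R, (exp x * sin y)%R).

Lemma Cmod_polar (x y : R) : Cmod (polar x y) = exp x.
Proof.
unfold Cmod, polar; simpl fst; simpl snd.
replace ((exp x * cos y) ^ 2 + (exp x * sin y) ^ 2)%R
  with (exp x ^ 2 * (Rsqr (sin y) + Rsqr (cos y)))%R by (unfold Rsqr; ring).
rewrite sin2_cos2, Rmult_1_r; apply sqrt_pow2; left; apply exp_pos.
Qed.

Lemma divergence_free_polar (g : C -> C) (a b c d : R) :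
  (forall x y, (a <= x <= b)%R -> ex_derive g (polar x y)) ->
  divergence_free_on (fun x y => Re (g (polar x y))) (fun x y => Im (g (polar x y))) a b c d.
Proof.
intros H x y Hx _; destruct (H x y Hx) as [l Hl].
pose proof (differentiable_pt_lim_exp_mult cos x y _ (derivable_pt_lim_cos y)) as HX.
pose proof (differentiable_pt_lim_exp_mult sin x y _ (derivable_pt_lim_sin y)) as HY.
exists (Re l * (exp x * cos y) + - Im l * (exp x * sin y))%R.
exists (Re l * (exp x * - sin y) + - Im l * (exp x * cos y))%R.
exists (Im l * (exp x * cos y) + Re l * (exp x * sin y))%R.
split.
- apply (differentiable_pt_lim_comp (fun u v => Re (g (u, v)))); [|exact HX|exact HY].
  apply is_derive_differentiable_Re; exact Hl.
- replace (Re l * (exp x * cos y) + - Im l * (exp x * sin y))%R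
    with (Im l * (exp x * - sin y) + Re l * (exp x * cos y))%R by ring.
  apply (differentiable_pt_lim_comp (fun u v => Im (g (u, v)))); [|exact HX|exact HY].
  apply is_derive_differentiable_Im; exact Hl.
Qed.

(** The sides y = 0 and y = 2 pi have the same image, so their contributions cancel and the
    vanishing flux equates the integrals over the two circles. *)
Lemma circle_mean_constant (g : C -> C) (a b : R) :
  (a <= b)%R -> (forall x y, (a <= x <= b)%R -> ex_derive g (polar x y)) ->
  RInt (fun y => Re (g (polar b y))) 0 (2 * PI) = RInt (fun y => Re (g (polar a y))) 0 (2 * PI).
Proof.
intros Hab H.
pose proof PI_RGT_0 as Hpi.
pose proof (goursat a b 0 (2 * PI) Hab ltac:(lra) (divergence_free_polar g a b _ _ H)) as G.
unfold flux in G.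
assert (E : forall x, polar x (2 * PI) = polar x 0).
{ intros x; unfold polar; rewrite cos_2PI, sin_2PI, cos_0, sin_0; reflexivity. }
rewrite (RInt_ext (fun x => Im (g (polar x (2 * PI)))) (fun x => Im (g (polar x 0)))) in G
  by (intros; rewrite E; reflexivity).
lra.
Qed.

(* The mean of [f z / z] over circles about 0 does not depend on the radius; it
   tends to [f' 0] as the radius tends to 0, and is at most 1/r. *)
Lemma schwarz_derivative (f : C -> C) (d : C) :
  holomorphic_on disk f -> (forall z, disk z -> (Cmod (f z) <= 1)%R) ->
  f 0 = 0 -> is_derive f (RtoC 0) d -> (Cmod d <= 1)%R.
Proof.
intros Hf Hb Hf0 Hd.
destruct (phase_exists d) as [k [Hk Hkd]].
set (g := fun z => k * f z / z).
assert (Hg : forall x y, (x < 0)%R -> ex_derive g (polar x y)).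
{ intros x y Hx.
  assert (Hz : polar x y <> 0) by (apply Cmod_gt_0; rewrite Cmod_polar; apply exp_pos).
  assert (Hdz : disk (polar x y)).
  { unfold disk; rewrite Cmod_polar, <- exp_0; apply exp_increasing; exact Hx. }
  destruct (Hf _ Hdz) as [l Hl].
  eexists; apply (is_derive_Cdiv (fun z => k * f z) (fun z => z)).
  - apply is_derive_Cscal; exact Hl.
  - apply is_derive_Cid.
  - exact Hz. }
assert (Hgb : forall x y, (x < 0)%R -> (Re (g (polar x y)) <= / exp x)%R).
{ intros x y Hx.
  assert (Hz : polar x y <> 0) by (apply Cmod_gt_0; rewrite Cmod_polar; apply exp_pos).
  assert (Hdz : disk (polar x y)).
  { unfold disk; rewrite Cmod_polar, <- exp_0; apply exp_increasing; exact Hx. }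
  eapply Rle_trans; [apply Re_le_Cmod|]; unfold g.
  rewrite Cmod_div, Cmod_mult, Hk, Cmod_polar by exact Hz.
  pose proof (Hb _ Hdz); pose proof (Rinv_0_lt_compat _ (exp_pos x)).
  unfold Rdiv; nra. }
assert (Hint : forall x, (x < 0)%R -> ex_RInt (fun y => Re (g (polar x y))) 0 (2 * PI)).
{ intros x Hx.
  apply (ex_RInt_vertical (P := fun x y => Re (g (polar x y)))
    (Q := fun x y => Im (g (polar x y))) x x 0 (2 * PI)); [|lra|pose proof PI_RGT_0; lra].
  apply divergence_free_polar; intros u v Hu; apply Hg; lra. }
assert (Hmain : forall b eps, (b < 0)%R -> (0 < eps)%R -> (Cmod d - eps <= / exp b)%R).
{ intros b eps Hb0 He.
  destruct (proj1 (is_derive_C_iff f (RtoC 0) d) Hd (mkposreal eps He)) as [del Hdel].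
  (* The inner circle has radius below [del], so that the first-order expansion of f at 0 holds on
     it; the outer one has radius exp b < 1. *)
  set (a := Rmin b (ln (del / 2))).
  assert (Ha : (a <= b)%R) by apply Rmin_l.
  assert (Ha2 : (exp a < del)%R).
  { pose proof (cond_pos del) as Hdp.
    apply Rle_lt_trans with (del / 2)%R; [|lra].
    rewrite <- (exp_ln (del / 2)) by lra.
    destruct (Rmin_r b (ln (del / 2))) as [Hlt|Heq].
    - left; apply exp_increasing; exact Hlt.
    - right; unfold a; rewrite Heq; reflexivity. }
  assert (Hlow : forall y, (Cmod d - eps <= Re (g (polar a y)))%R).
  { intros y.
    assert (Hz : polar a y <> 0) by (apply Cmod_gt_0; rewrite Cmod_polar; apply exp_pos).
    assert (Hlt : (Cmod (polar a y - 0) < del)%R).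
    { replace (polar a y - 0) with (polar a y) by ring; rewrite Cmod_polar; exact Ha2. }
    specialize (Hdel _ Hlt); simpl in Hdel; rewrite Hf0 in Hdel.
    replace (polar a y - 0) with (polar a y) in Hdel by ring.
    replace (g (polar a y)) with (RtoC (Cmod d) + k * ((f (polar a y) - 0 - d * polar a y) / polar a y))
      by (rewrite <- Hkd; unfold g; field; exact Hz).
    rewrite re_plus, re_RtoC.
    pose proof (re_le_Cmod (k * ((f (polar a y) - 0 - d * polar a y) / polar a y))) as H1.
    rewrite Cmod_mult, Hk, Cmod_div, Rmult_1_l in H1 by exact Hz.
    assert (H2 : (Cmod (f (polar a y) - 0 - d * polar a y) / Cmod (polar a y) <= eps)%R).
    { rewrite Cmod_polar in *; pose proof (exp_pos a) as Hp.
      apply Rmult_le_reg_r with (exp a); [exact Hp|]; unfold Rdiv.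
      rewrite Rmult_assoc, Rinv_l by lra; lra. }
    pose proof (Rle_trans _ _ _ H1 H2) as H3; apply Rabs_le_between in H3; lra. }
  pose proof PI_RGT_0 as Hpi.
  pose proof (circle_mean_constant g a b Ha ltac:(intros; apply Hg; lra)) as Hc.
  assert (L : ((Cmod d - eps) * (2 * PI) <= RInt (fun y => Re (g (polar a y))) 0 (2 * PI))%R).
  { replace ((Cmod d - eps) * (2 * PI))%R with (RInt (fun _ => Cmod d - eps)%R 0 (2 * PI))
      by (rewrite RInt_const; change scal with Rmult; simpl; ring).
    apply RInt_le; [lra | apply ex_RInt_const | apply Hint; lra | intros; apply Hlow]. }
  assert (U : (RInt (fun y => Re (g (polar b y))) 0 (2 * PI) <= / exp b * (2 * PI))%R).
  { replace (/ exp b * (2 * PI))%R with (RInt (fun _ => / exp b)%R 0 (2 * PI))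
      by (rewrite RInt_const; change scal with Rmult; simpl; ring).
    apply RInt_le; [lra | apply Hint; lra | apply ex_RInt_const | intros; apply Hgb; lra]. }
  nra. }
apply Rnot_lt_le; intros Hlt.
(* On the circle of radius 1/m the mean is at most m, halfway between 1 and |d|; an error of (|d| -
   1)/4 is too small to bridge the gap to |d|. *)
set (m := ((1 + Cmod d) / 2)%R).
assert (Hm : (1 < m)%R) by (unfold m; lra).
assert (Hln : (0 < ln m)%R) by (rewrite <- ln_1; apply ln_increasing; lra).
pose proof (Hmain (- ln m)%R ((Cmod d - 1) / 4)%R ltac:(lra) ltac:(lra)) as H.
rewrite exp_Ropp, exp_ln, Rinv_inv in H by lra; unfold m in H; lra.
Qed.

(** * Schwarz-Pick in the half-plane *)

Definition half_plane (z : C) : Prop := (0 < Re z)%R.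

(** The target is the closed half-plane: F z - c z must qualify when c is the extremal slope, and
    its real part may then vanish. *)
Definition half_plane_map (F : C -> C) : Prop :=
  holomorphic_on half_plane F /\ forall z, half_plane z -> (0 <= Re (F z))%R.

Lemma Re_Cdiv (a b : C) :
  Re (a / b) = ((Re a * Re b + Im a * Im b) / Cmod b ^ 2)%R.
Proof.
rewrite Cmod2_alt; destruct a as [a1 a2], b as [b1 b2]; unfold Cdiv, Cinv, Re, Im; simpl.
unfold Rdiv; ring.
Qed.

Lemma Cmod_le_sqr (a b : C) : (Cmod a ^ 2 <= Cmod b ^ 2)%R -> (Cmod a <= Cmod b)%R.
Proof. pose proof (Cmod_ge_0 a); pose proof (Cmod_ge_0 b); nra. Qed.

Lemma Cmod_sqr_pos (a : C) : a <> 0 -> (0 < Cmod a ^ 2)%R.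
Proof. intros H; apply pow_lt, Cmod_gt_0; exact H. Qed.

Lemma Re_neq_0 (a : C) : (0 < Re a)%R -> a <> 0.
Proof. intros H ->; unfold Re in H; simpl in H; lra. Qed.

Lemma disk_minus_neq_0 (w : C) : disk w -> 1 - w <> 0.
Proof.
intros Hw; apply Re_neq_0.
pose proof (Re_le_Cmod w); unfold disk in Hw; unfold Re in *; simpl; lra.
Qed.

Lemma disk_sqr (w : C) : disk w -> (Re w ^ 2 + Im w ^ 2 < 1)%R.
Proof.
unfold disk; intros Hw; rewrite <- Cmod2_alt; pose proof (Cmod_ge_0 w); nra.
Qed.

Lemma Cmod_minus_le_plus_conj (A a : C) :
  (0 <= Re A)%R -> (0 <= Re a)%R -> (Cmod (A - a) <= Cmod (A + Cconj a))%R.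
Proof.
intros HA Ha; apply Cmod_le_sqr; rewrite !Cmod2_alt.
destruct A as [x y], a as [u v]; unfold Re, Im in *; simpl in *; nra.
Qed.

Lemma schwarz_pick_positive (F : C -> C) (z d : C) :
  holomorphic_on half_plane F -> (forall z, half_plane z -> (0 < Re (F z))%R) ->
  half_plane z -> is_derive F z d -> (Cmod d * Re z <= Re (F z))%R.
Proof.
intros HF Hpos Hz Hd.
set (r := Re z); set (a := F z).
(* [phi] is i Im z + r (1 + w)/(1 - w), the Cayley map onto the half-plane with phi 0 = z; [g] sends
   a back to 0. Since phi' 0 = 2 r, the derivative of g at 0 is d r / Re a, and the Schwarz lemma
   bounds it by 1. *)
set (phi := fun w => z + RtoC (2 * r) * (w / (1 - w))).
set (g := fun w => (F (phi w) - a) / (F (phi w) + Cconj a)).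
assert (Hr : (0 < r)%R) by exact Hz.
assert (Ha : (0 < Re a)%R) by (apply Hpos; exact Hz).
assert (Hphi : forall w, disk w -> half_plane (phi w)).
{ intros w Hw; unfold half_plane, phi.
  pose proof (Cmod_sqr_pos _ (disk_minus_neq_0 w Hw)) as Hn.
  pose proof (disk_sqr w Hw) as Hs.
  rewrite re_plus, re_scal_l, Re_Cdiv.
  replace (Re z + 2 * r * ((Re w * Re (1 - w) + Im w * Im (1 - w)) / Cmod (1 - w) ^ 2))%R
    with (r * ((1 - (Re w ^ 2 + Im w ^ 2)) / Cmod (1 - w) ^ 2))%R.
  - apply Rmult_lt_0_compat; [exact Hr|]; apply Rdiv_lt_0_compat; [lra | exact Hn].
  - fold r; rewrite Cmod2_alt in *; unfold Re, Im in *; simpl in *; field; simpl; lra. }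
assert (Hden : forall w, disk w -> F (phi w) + Cconj a <> 0).
{ intros w Hw; apply Re_neq_0; rewrite re_plus, re_conj.
  pose proof (Hpos _ (Hphi w Hw)); lra. }
assert (Hdphi : forall w, disk w -> is_derive phi w
   (0 + RtoC (2 * r) * ((1 * (1 - w) - w * (0 - 1)) / ((1 - w) * (1 - w))))).
{ intros w Hw; apply is_derive_Cplus; [apply is_derive_Cconst|].
  apply is_derive_Cscal.
  apply (is_derive_Cdiv (fun w => w) (fun w => 1 - w)).
  - apply is_derive_Cid.
  - apply is_derive_Cminus; [apply is_derive_Cconst | apply is_derive_Cid].
  - apply disk_minus_neq_0; exact Hw. }
assert (Hdg : forall w l, disk w -> is_derive F (phi w) l -> forall p, is_derive phi w p ->
   is_derive g w ((l * p * (F (phi w) + Cconj a) - (F (phi w) - a) * (l * p))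
     / ((F (phi w) + Cconj a) * (F (phi w) + Cconj a)))).
{ intros w l Hw Hl p Hp.
  apply (is_derive_Cdiv (fun w => F (phi w) - a) (fun w => F (phi w) + Cconj a)).
  - replace (l * p) with (l * p - 0) by ring.
    apply is_derive_Cminus; [apply is_derive_Ccomp; assumption | apply is_derive_Cconst].
  - replace (l * p) with (l * p + 0) by ring.
    apply is_derive_Cplus; [apply is_derive_Ccomp; assumption | apply is_derive_Cconst].
  - apply Hden; exact Hw. }
assert (H0 : disk 0) by (unfold disk; rewrite Cmod_0; lra).
assert (Hphi0 : phi 0 = z) by (unfold phi; field; apply C1_nz).
assert (Haa : a + Cconj a = RtoC (2 * Re a)).
{ apply injective_projections; unfold Re; simpl; ring. }
assert (H2a : RtoC (2 * Re a) <> 0) by (intros H; injection H; lra).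
assert (Hle : (Cmod (d * RtoC (2 * r) / RtoC (2 * Re a)) <= 1)%R).
{ apply (schwarz_derivative g).
  - intros w Hw; destruct (HF _ (Hphi w Hw)) as [l Hl].
    eexists; apply (Hdg w l Hw Hl _ (Hdphi w Hw)).
  - intros w Hw; unfold g; rewrite Cmod_div by (apply Hden; exact Hw).
    pose proof (proj1 (Cmod_gt_0 _) (Hden w Hw)) as Hp.
    apply Rmult_le_reg_r with (1 := Hp); unfold Rdiv.
    rewrite Rmult_assoc, Rinv_l, Rmult_1_r, Rmult_1_l by lra.
    apply Cmod_minus_le_plus_conj; [left; apply Hpos, Hphi; exact Hw | lra].
  - unfold g; rewrite Hphi0; fold a.
    replace (a - a) with (RtoC 0) by ring; unfold Cdiv; ring.
  - replace (d * RtoC (2 * r) / RtoC (2 * Re a)) with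
      ((d * RtoC (2 * r) * (F (phi 0) + Cconj a) - (F (phi 0) - a) * (d * RtoC (2 * r)))
     / ((F (phi 0) + Cconj a) * (F (phi 0) + Cconj a))).
    + apply Hdg; [exact H0 | rewrite Hphi0; exact Hd |].
      replace (RtoC (2 * r)) with
        (0 + RtoC (2 * r) * ((1 * (1 - 0) - 0 * (0 - 1)) / ((1 - 0) * (1 - 0)))) at 1
        by (field; apply C1_nz).
      apply Hdphi; exact H0.
    + rewrite Hphi0; fold a; rewrite Haa; field; exact H2a. }
rewrite Cmod_div, Cmod_mult, !Cmod_R, !Rabs_pos_eq in Hle by (assumption || lra).
apply Rmult_le_compat_r with (r := (2 * Re a)%R) in Hle; [|lra].
unfold Rdiv in Hle; rewrite Rmult_assoc, Rinv_l in Hle by lra; lra.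
Qed.

(** A shift by eps > 0 makes the real part strictly positive without changing the derivative. *)
Lemma schwarz_pick (F : C -> C) (z d : C) :
  half_plane_map F -> half_plane z -> is_derive F z d -> (Cmod d * Re z <= Re (F z))%R.
Proof.
intros [HF Hpos] Hz Hd.
apply Rle_plus_epsilon; intros eps He.
replace (Re (F z) + eps)%R with (Re (F z + RtoC eps)) by (rewrite re_plus, re_RtoC; reflexivity).
apply (schwarz_pick_positive (fun w => F w + RtoC eps)).
- intros w Hw; destruct (HF w Hw) as [l Hl]; exists (l + 0).
  apply is_derive_Cplus; [exact Hl | apply is_derive_Cconst].
- intros w Hw; rewrite re_plus, re_RtoC; pose proof (Hpos w Hw); lra.
- exact Hz.
- replace d with (d + 0) by ring.
  apply is_derive_Cplus; [exact Hd | apply is_derive_Cconst].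
Qed.

(** * The angular derivative at infinity *)

Lemma holomorphic_is_derive (D : C -> Prop) (F : C -> C) (z : C) :
  holomorphic_on D F -> D z -> is_derive F z (C_derive F z).
Proof. intros H Hz; apply C_derive_correct; [exact 0 | apply H; exact Hz]. Qed.

Lemma half_plane_pair (x y : R) : (0 < x)%R -> half_plane (x, y).
Proof. intros H; exact H. Qed.

(** The numerator of the derivative of Re F / x is x Re F' - Re F, which Schwarz-Pick makes
    nonpositive. *)
Lemma half_plane_map_quotient_decreasing (F : C -> C) (x x' y : R) :
  half_plane_map F -> (0 < x <= x')%R ->
  (Re (F (x', y)) / x' <= Re (F (x, y)) / x)%R.
Proof.
intros HF Hx.
apply (is_derive_nonincreasing (fun t => Re (F (t, y)) / t)%R
  (fun t => (Re (C_derive F (t, y) * (1, 0)) * t - Re (F (t, y)) * 1) / t ^ 2)%R); [lra| |].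
- intros t Ht.
  apply (is_derive_div (fun t => Re (F (t, y))) (fun t => t)); [| |lra].
  + apply (is_derive_Re_curve (fun t => t) (fun _ => y)).
    * apply (holomorphic_is_derive half_plane); [apply HF | apply half_plane_pair; lra].
    * apply (is_derive_id (K := R_AbsRing)).
    * apply (is_derive_const (K := R_AbsRing) (V := R_NormedModule)).
  + apply (is_derive_id (K := R_AbsRing)).
- intros t Ht.
  assert (Hh : half_plane (t, y)) by (apply half_plane_pair; lra).
  pose proof (schwarz_pick F (t, y) _ HF Hh
    (holomorphic_is_derive half_plane F _ (proj1 HF) Hh)) as Hsp.
  pose proof (Re_le_Cmod (C_derive F (t, y) * (1, 0))) as H1.
  rewrite Cmod_mult in H1; change (1, 0) with (RtoC 1) in H1 at 2; rewrite Cmod_1 in H1.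
  change (Re (t, y)) with t in Hsp.
  assert (0 < / t ^ 2)%R by (apply Rinv_0_lt_compat, pow_lt; lra).
  assert (H2 : (Re (C_derive F (t, y) * (1, 0)) * t - Re (F (t, y)) * 1 <= 0)%R) by nra.
  unfold Rdiv; nra.
Qed.

(** Schwarz-Pick bounds the vertical derivative of Re F by Re F / x. The integrating factor exp (- t
    / x) is used rather than the logarithm of Re F, since Re F may be 0. *)
Lemma half_plane_map_vertical_harnack (F : C -> C) (x y y' : R) :
  half_plane_map F -> (0 < x)%R ->
  (Re (F (x, y')) <= exp (Rabs (y' - y) / x) * Re (F (x, y)))%R.
Proof.
intros HF Hx.
assert (Hs : exists s : R, Rabs s = 1%R /\ (y' = y + s * Rabs (y' - y))%R).
{ destruct (Rle_dec y y') as [Hle|Hle].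
  - exists 1%R; rewrite !Rabs_pos_eq by lra; split; lra.
  - exists (-1)%R; rewrite (Rabs_left (-1)), Rabs_left by lra; split; lra. }
destruct Hs as [s [Hs Ey]].
set (L := Rabs (y' - y)) in *.
assert (HL : (0 <= L)%R) by apply Rabs_pos.
assert (H : (exp (- L / x) * Re (F (x, y + s * L)) <= exp (- 0 / x) * Re (F (x, y + s * 0)))%R).
{ apply (is_derive_nonincreasing (fun t => exp (- t / x) * Re (F (x, y + s * t)))%R
    (fun t => - / x * exp (- t / x) * Re (F (x, y + s * t))
      + exp (- t / x) * Re (C_derive F (x, y + s * t)%R * (0, s)))%R); [exact HL| |].
  - intros t Ht.
    apply (is_derive_mult (fun t => exp (- t / x)) (fun t => Re (F (x, y + s * t)%R)));
      [| |exact Rmult_comm].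
    + auto_derive; [lra | unfold Rdiv; ring].
    + apply (is_derive_Re_curve (fun _ => x) (fun t => y + s * t)%R).
      * apply (holomorphic_is_derive half_plane); [apply HF | apply half_plane_pair; lra].
      * apply (is_derive_const (K := R_AbsRing) (V := R_NormedModule)).
      * auto_derive; [exact I | apply Rmult_1_r].
  - intros t Ht.
    assert (Hh : half_plane (x, y + s * t)%R) by (apply half_plane_pair; lra).
    pose proof (schwarz_pick F _ _ HF Hh
      (holomorphic_is_derive half_plane F _ (proj1 HF) Hh)) as Hsp.
    pose proof (Re_le_Cmod (C_derive F (x, y + s * t)%R * (0, s))) as H1.
    rewrite Cmod_mult in H1.
    replace (Cmod (0, s)) with 1%R in H1.
    2:{ replace ((0, s) : C) with (RtoC s * Ci) by (apply injective_projections; simpl; ring).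
        rewrite Cmod_mult, Cmod_Ci, Cmod_R, Hs; ring. }
    change (Re (x, (y + s * t)%R)) with x in Hsp.
    replace (- / x * exp (- t / x) * Re (F (x, y + s * t))
      + exp (- t / x) * Re (C_derive F (x, y + s * t)%R * (0, s)))%R
      with (exp (- t / x) * / x *
        (x * Re (C_derive F (x, y + s * t)%R * (0, s)) - Re (F (x, y + s * t))))%R
      by (field; lra).
    assert (0 < exp (- t / x) * / x)%R
      by (apply Rmult_lt_0_compat; [apply exp_pos | apply Rinv_0_lt_compat; exact Hx]).
    assert (H3 : (x * Re (C_derive F (x, y + s * t)%R * (0, s)) - Re (F (x, y + s * t)%R) <= 0)%R)
      by nra.
    nra. }
rewrite <- Ey in H.
replace (- 0 / x)%R with 0%R in H by (field; lra).
replace (y + s * 0)%R with y in H by ring.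
rewrite exp_0, Rmult_1_l in H.
apply Rmult_le_compat_l with (r := exp (L / x)) in H; [|left; apply exp_pos].
rewrite <- Rmult_assoc, <- exp_plus in H.
replace (L / x + - L / x)%R with 0%R in H by (field; lra).
rewrite exp_0, Rmult_1_l in H; exact H.
Qed.

(** The quotient decreases along the real axis, so its infimum is its limit at infinity.
    [completeness] supplies suprema, hence the sign changes. *)
Lemma half_plane_map_inf (F : C -> C) :
  half_plane_map F ->
  exists c : R, (0 <= c)%R /\ (forall x, (0 < x)%R -> (c <= Re (F (x, 0)) / x)%R)
    /\ forall eps, (0 < eps)%R -> exists x0, (0 < x0)%R /\
         forall x, (x0 <= x)%R -> (Re (F (x, 0)) / x <= c + eps)%R.
Proof.
intros HF.
set (u := fun x : R => (Re (F (x, 0)) / x)%R).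
assert (Hu : forall x, (0 < x)%R -> (0 <= u x)%R).
{ intros x Hx; apply Rdiv_le_0_compat; [apply HF; exact Hx | exact Hx]. }
destruct (completeness (fun v => exists x, (0 < x)%R /\ v = (- u x)%R)) as [m [Hub Hlub]].
- exists 0%R; intros v [x [Hx ->]]; pose proof (Hu x Hx); lra.
- exists (- u 1)%R, 1%R; split; [lra | reflexivity].
- exists (- m)%R; split; [|split].
  + cut (m <= 0)%R; [lra|]; apply Hlub; intros v [x [Hx ->]]; pose proof (Hu x Hx); lra.
  + intros x Hx; fold (u x); pose proof (Hub (- u x)%R (ex_intro _ x (conj Hx eq_refl))); lra.
  + intros eps He; apply NNPP; intros Hno.
    cut (m <= m - eps)%R; [lra|]; apply Hlub; intros v [x [Hx ->]].
    apply Rnot_lt_le; intros Hlt; apply Hno; exists x; split; [exact Hx|].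
    intros x' Hx'; pose proof (half_plane_map_quotient_decreasing F x x' 0 HF (conj Hx Hx')).
    unfold u in Hlt; lra.
Qed.

Lemma half_plane_map_julia (F : C -> C) (c : R) (z : C) :
  half_plane_map F -> (0 <= c)%R ->
  (forall x, (0 < x)%R -> (c <= Re (F (x, 0)) / x)%R) ->
  half_plane z -> (c * Re z <= Re (F z))%R.
Proof.
intros HF Hc0 Hc Hz; destruct z as [x y]; unfold half_plane, Re in Hz |- *; simpl in *.
fold (Re (F (x, y))).
set (q := (Re (F (x, y)) / x)%R).
assert (Hq : forall t, (0 < t)%R -> (c * (1 - t) <= q)%R).
{ intros t Ht.
  (* Far to the right the height y is small against X, so that moving from (X, y) to the real axis
     costs a Harnack factor of at most exp t; moving from x to X only lowers the quotient. Then t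
     tends to 0. *)
  set (X := Rmax x (Rabs y / t)).
  assert (HX : (x <= X)%R) by apply Rmax_l.
  assert (HXy : (Rabs y / X <= t)%R).
  { assert (H1 : (Rabs y / t <= X)%R) by apply Rmax_r.
    apply Rmult_le_compat_r with (r := t) in H1; [|lra].
    unfold Rdiv in H1; rewrite Rmult_assoc, Rinv_l, Rmult_1_r in H1 by lra.
    apply Rmult_le_reg_r with X; [lra|]; unfold Rdiv; rewrite Rmult_assoc, Rinv_l by lra; lra. }
  pose proof (half_plane_map_quotient_decreasing F x X y HF (conj Hz HX)) as H1; fold q in H1.
  pose proof (half_plane_map_vertical_harnack F X y 0 HF ltac:(lra)) as H2.
  pose proof (Hc X ltac:(lra)) as H3.
  replace (Rabs (0 - y)) with (Rabs y) in H2 by (rewrite <- Rabs_Ropp; f_equal; ring).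
  assert (H4 : (c <= exp (Rabs y / X) * q)%R).
  { apply Rle_trans with (1 := H3).
    apply Rle_trans with (exp (Rabs y / X) * (Re (F (X, y)) / X))%R.
    - unfold Rdiv; rewrite <- Rmult_assoc; apply Rmult_le_compat_r; [|exact H2].
      left; apply Rinv_0_lt_compat; lra.
    - apply Rmult_le_compat_l; [left; apply exp_pos | exact H1]. }
  apply Rmult_le_compat_l with (r := exp (- (Rabs y / X))) in H4; [|left; apply exp_pos].
  rewrite <- Rmult_assoc, <- exp_plus, Rplus_opp_l, exp_0, Rmult_1_l in H4.
  pose proof (exp_ineq1_le (- (Rabs y / X))) as H5.
  apply Rle_trans with (2 := H4); rewrite Rmult_comm; apply Rmult_le_compat_r; lra. }
assert (Hcq : (c <= q)%R).
{ destruct (Rle_lt_or_eq_dec 0 c Hc0) as [Hp|<-].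
  - apply Rle_plus_epsilon; intros e He.
    pose proof (Hq (e / c)%R (Rdiv_lt_0_compat _ _ He Hp)) as H1.
    replace (c * (1 - e / c))%R with (c - e)%R in H1 by (field; lra); lra.
  - pose proof (Hq 1%R ltac:(lra)); lra. }
apply Rmult_le_compat_r with (r := x) in Hcq; [|lra].
unfold q, Rdiv in Hcq; rewrite Rmult_assoc, Rinv_l, Rmult_1_r in Hcq by lra; exact Hcq.
Qed.

(** Angular derivative c at infinity. Errors are measured against Re z, which is comparable to |z|
    in each sector. *)
Definition sectorial_limit (F : C -> C) (c : R) : Prop :=
  forall K eps, (0 < K)%R -> (0 < eps)%R -> exists R0, (0 < R0)%R /\
    forall z, (R0 < Re z)%R -> (Rabs (Im z) <= K * Re z)%R ->
      (Cmod (F z - RtoC c * z) <= eps * Re z)%R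
      /\ (Cmod (C_derive F z - RtoC c) <= eps)%R.

(* Julia-Wolff-Caratheodory at infinity: apply Schwarz-Pick to [F z - c z],
   which by Julia's inequality still maps into the half-plane. *)
Lemma angular_derivative_at_infinity (F : C -> C) :
  half_plane_map F ->
  exists c : R, (0 <= c)%R
    /\ (forall z, half_plane z -> (c * Re z <= Re (F z))%R)
    /\ sectorial_limit F c.
Proof.
intros HF.
destruct (half_plane_map_inf F HF) as [c [Hc0 [Hinf Hlim]]].
exists c; split; [exact Hc0|].
assert (Hj : forall z, half_plane z -> (c * Re z <= Re (F z))%R).
{ intros z Hz; apply half_plane_map_julia; assumption. }
split; [exact Hj|].
intros K eps HK He.
set (F1 := fun z => F z - RtoC c * z).
assert (Hd1 : forall z, half_plane z -> is_derive F1 z (C_derive F z - RtoC c)).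
{ intros z Hz; replace (C_derive F z - RtoC c) with (C_derive F z - RtoC c * 1) by ring.
  apply is_derive_Cminus.
  - apply (holomorphic_is_derive half_plane); [apply HF | exact Hz].
  - apply is_derive_Cscal, is_derive_Cid. }
assert (Re1 : forall z, Re (F1 z) = (Re (F z) - c * Re z)%R).
{ intros z; unfold F1, Cminus; rewrite re_plus, re_opp, re_scal_l; ring. }
assert (HF1 : half_plane_map F1).
{ split.
  - intros z Hz; eexists; apply Hd1; exact Hz.
  - intros z Hz; rewrite Re1; pose proof (Hj z Hz); lra. }
(* The factor exp K is the Harnack loss from the axis to the edge of the sector. The first bound
   serves the derivative; the second, integrated over a path of length at most (1 + K) Re z, uses up
   half of eps. *)
set (eta := (Rmin eps (eps / (2 * (1 + K))) / exp K)%R).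
pose proof (exp_pos K) as HeK.
assert (Heta : (0 < eta)%R).
{ apply Rdiv_lt_0_compat; [apply Rmin_pos; [exact He|] | exact HeK].
  apply Rdiv_lt_0_compat; lra. }
assert (Eeta : (exp K * eta = Rmin eps (eps / (2 * (1 + K))))%R) by (unfold eta; field; lra).
assert (Heta1 : (exp K * eta <= eps)%R) by (rewrite Eeta; apply Rmin_l).
assert (Heta2 : (exp K * eta * (1 + K) <= eps / 2)%R).
{ apply Rle_trans with (eps / (2 * (1 + K)) * (1 + K))%R; [|right; field; lra].
  apply Rmult_le_compat_r; [lra|]; rewrite Eeta; apply Rmin_r. }
destruct (Hlim eta Heta) as [x0 [Hx0 Hsmall]].
assert (Hsec : forall z, (x0 <= Re z)%R -> (Rabs (Im z) <= K * Re z)%R ->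
  (Re (F1 z) <= exp K * eta * Re z)%R).
{ intros [x y] Hx Hy; change (Re (x, y)) with x in *; change (Im (x, y)) with y in *.
  pose proof (half_plane_map_vertical_harnack F1 x 0 y HF1 ltac:(lra)) as H1.
  rewrite Rminus_0_r in H1.
  assert (H2 : (Re (F1 (x, 0%R)) <= eta * x)%R).
  { rewrite Re1; change (Re (x, 0%R)) with x.
    pose proof (Hsmall x Hx) as H2.
    apply Rmult_le_compat_r with (r := x) in H2; [|lra].
    unfold Rdiv in H2; rewrite Rmult_assoc, Rinv_l in H2 by lra; lra. }
  assert (H3 : (exp (Rabs y / x) <= exp K)%R).
  { assert (H3 : (Rabs y / x <= K)%R).
    { apply Rmult_le_reg_r with x; [lra|]; unfold Rdiv; rewrite Rmult_assoc, Rinv_l by lra; lra. }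
    apply Rnot_lt_le; intros Hlt; apply exp_lt_inv in Hlt; lra. }
  assert (H4 : (0 <= Re (F1 (x, 0%R)))%R) by (apply HF1, half_plane_pair; lra).
  apply Rle_trans with (1 := H1).
  apply Rle_trans with (exp K * Re (F1 (x, 0%R)))%R.
  - apply Rmult_le_compat_r; assumption.
  - rewrite Rmult_assoc; apply Rmult_le_compat_l; lra. }
assert (Hder : forall z, (x0 <= Re z)%R -> (Rabs (Im z) <= K * Re z)%R ->
  (Cmod (C_derive F z - RtoC c) <= exp K * eta)%R).
{ intros z Hx Hy.
  assert (Hz : half_plane z) by (unfold half_plane; lra).
  pose proof (schwarz_pick F1 z _ HF1 Hz (Hd1 z Hz)) as H1.
  pose proof (Hsec z Hx Hy) as H2.
  apply Rmult_le_reg_r with (Re z); [exact Hz | lra]. }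
(* The other half of eps absorbs the fixed value of F1 at the start (x0, 0) of the path; the segment
   from there to z stays in the sector. *)
exists (Rmax x0 (2 * Cmod (F1 (x0, 0%R)) / eps)); split.
{ apply Rlt_le_trans with x0; [lra | apply Rmax_l]. }
intros z Hz Hy.
assert (Hz1 : (x0 < Re z)%R) by (eapply Rle_lt_trans; [apply Rmax_l | exact Hz]).
assert (Hz2 : (2 * Cmod (F1 (x0, 0%R)) / eps < Re z)%R)
  by (eapply Rle_lt_trans; [apply Rmax_r | exact Hz]).
split; [|eapply Rle_trans; [apply Hder; lra | exact Heta1]].
fold (F1 z).
assert (Hmv : (Cmod (F1 z - F1 (x0, 0%R)) <= exp K * eta * Cmod (z - (x0, 0%R)))%R).
{ apply (mean_value_inequality F1 (fun w => C_derive F w - RtoC c)).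
  intros t Ht; set (w := (x0, 0%R) + RtoC t * (z - (x0, 0%R))).
  assert (HRe : Re w = (x0 + t * (Re z - x0))%R) by (unfold w, Re; simpl; ring).
  assert (HIm : Im w = (t * Im z)%R) by (unfold w, Im; simpl; ring).
  assert (H1 : (x0 <= Re w)%R) by (rewrite HRe; nra).
  assert (H2 : (Rabs (Im w) <= K * Re w)%R).
  { rewrite HRe, HIm, Rabs_mult, (Rabs_pos_eq t) by lra.
    assert (t * Rabs (Im z) <= t * (K * Re z))%R by (apply Rmult_le_compat_l; lra).
    assert (0 <= K * x0 * (1 - t))%R by (apply Rmult_le_pos; [apply Rmult_le_pos|]; lra).
    lra. }
  split; [apply Hd1; unfold half_plane; lra | apply Hder; assumption]. }
assert (Hdist : (Cmod (z - (x0, 0%R)) <= (1 + K) * Re z)%R).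
{ eapply Rle_trans; [apply Cmod_le_Rabs|].
  replace (Re (z - (x0, 0%R))) with (Re z - x0)%R by (unfold Re; simpl; ring).
  replace (Im (z - (x0, 0%R))) with (Im z) by (unfold Im; simpl; ring).
  rewrite Rabs_pos_eq by lra; lra. }
assert (Htri : (Cmod (F1 z) <= Cmod (F1 (x0, 0%R)) + Cmod (F1 z - F1 (x0, 0%R)))%R).
{ replace (F1 z) with (F1 (x0, 0%R) + (F1 z - F1 (x0, 0%R))) at 1 by ring; apply Cmod_triangle. }
assert (Hhalf : (Cmod (F1 (x0, 0%R)) <= eps / 2 * Re z)%R).
{ apply Rmult_lt_compat_r with (r := (eps / 2)%R) in Hz2; [|lra].
  replace (2 * Cmod (F1 (x0, 0%R)) / eps * (eps / 2))%R with (Cmod (F1 (x0, 0%R))) in Hz2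
    by (field; lra).
  lra. }
assert (Hprod : (exp K * eta * Cmod (z - (x0, 0%R)) <= eps / 2 * Re z)%R).
{ apply Rle_trans with (exp K * eta * ((1 + K) * Re z))%R.
  - apply Rmult_le_compat_l; [apply Rmult_le_pos; lra | exact Hdist].
  - rewrite <- Rmult_assoc; apply Rmult_le_compat_r; lra. }
lra.
Qed.

(** * The Cayley transform *)

Definition cayley (w : C) : C := (1 + w) / (1 - w).

Definition cayley_inv (z : C) : C := (z - 1) / (z + 1).

Definition half_plane_lift (f : C -> C) (z : C) : C := cayley (f (cayley_inv z)).

Lemma RtoC_neq_0 (r : R) : r <> 0%R -> RtoC r <> 0.
Proof. intros H E; apply H; injection E; auto. Qed.

Lemma half_plane_plus_1_neq_0 (z : C) : half_plane z -> z + 1 <> 0.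
Proof.
intros Hz; apply Re_neq_0; rewrite re_plus, re_RtoC; unfold half_plane in Hz; lra.
Qed.

Lemma Re_cayley (w : C) : Re (cayley w) = ((1 - Cmod w ^ 2) / Cmod (1 - w) ^ 2)%R.
Proof.
unfold cayley; rewrite Re_Cdiv; f_equal; rewrite Cmod2_alt; unfold Re, Im; simpl; ring.
Qed.

Lemma cayley_half_plane (w : C) : disk w -> half_plane (cayley w).
Proof.
intros Hw; unfold half_plane; rewrite Re_cayley; apply Rdiv_lt_0_compat.
- rewrite Cmod2_alt; pose proof (disk_sqr w Hw); lra.
- apply Cmod_sqr_pos, disk_minus_neq_0; exact Hw.
Qed.

Lemma cayley_inv_disk (z : C) : half_plane z -> disk (cayley_inv z).
Proof.
intros Hz; unfold disk, cayley_inv; rewrite Cmod_div by (apply half_plane_plus_1_neq_0; exact Hz).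
pose proof (proj1 (Cmod_gt_0 _) (half_plane_plus_1_neq_0 z Hz)) as Hp.
apply Rmult_lt_reg_r with (1 := Hp); unfold Rdiv.
rewrite Rmult_assoc, Rinv_l, Rmult_1_r, Rmult_1_l by lra.
assert (Hsq : (Cmod (z - 1) ^ 2 < Cmod (z + 1) ^ 2)%R).
{ rewrite !Cmod2_alt; unfold half_plane in Hz; unfold Re, Im in *; simpl in *; nra. }
pose proof (Cmod_ge_0 (z - 1)); nra.
Qed.

Lemma cayley_plus_1 (w : C) : 1 - w <> 0 -> cayley w + 1 = 2 / (1 - w).
Proof. intros H; unfold cayley; field; exact H. Qed.

Lemma one_minus_cayley_inv (z : C) : z + 1 <> 0 -> 1 - cayley_inv z = 2 / (z + 1).
Proof. intros H; unfold cayley_inv; field; exact H. Qed.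

Lemma cayley_inv_cayley (w : C) : disk w -> cayley_inv (cayley w) = w.
Proof.
intros Hw; pose proof (disk_minus_neq_0 w Hw) as H.
unfold cayley_inv; rewrite cayley_plus_1 by exact H; unfold cayley; field.
exact H.
Qed.

Lemma is_derive_cayley_inv (z : C) :
  half_plane z -> is_derive cayley_inv z (2 / ((z + 1) * (z + 1))).
Proof.
intros Hz; pose proof (half_plane_plus_1_neq_0 z Hz) as H.
replace (2 / ((z + 1) * (z + 1))) with
  (((1 - 0) * (z + 1) - (z - 1) * (1 + 0)) / ((z + 1) * (z + 1))) by (field; exact H).
apply (is_derive_Cdiv (fun z => z - 1) (fun z => z + 1)); [| |exact H].
- apply is_derive_Cminus; [apply is_derive_Cid | apply is_derive_Cconst].
- apply is_derive_Cplus; [apply is_derive_Cid | apply is_derive_Cconst].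
Qed.

Lemma is_derive_cayley (w : C) :
  1 - w <> 0 -> is_derive cayley w (2 / ((1 - w) * (1 - w))).
Proof.
intros H.
replace (2 / ((1 - w) * (1 - w))) with
  (((0 + 1) * (1 - w) - (1 + w) * (0 - 1)) / ((1 - w) * (1 - w))) by (field; exact H).
apply (is_derive_Cdiv (fun w => 1 + w) (fun w => 1 - w)); [| |exact H].
- apply is_derive_Cplus; [apply is_derive_Cconst | apply is_derive_Cid].
- apply is_derive_Cminus; [apply is_derive_Cconst | apply is_derive_Cid].
Qed.

Lemma is_derive_half_plane_lift (f : C -> C) (z : C) :
  holomorphic_self_map f -> half_plane z ->
  let w := cayley_inv z in
  is_derive (half_plane_lift f) z
    (2 / ((1 - f w) * (1 - f w)) * (C_derive f w * (2 / ((z + 1) * (z + 1))))).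
Proof.
intros [Hf Hm] Hz w.
assert (Hw : disk w) by (apply cayley_inv_disk; exact Hz).
apply (is_derive_Ccomp cayley (fun z => f (cayley_inv z))).
- apply is_derive_cayley, disk_minus_neq_0, Hm; exact Hw.
- apply (is_derive_Ccomp f cayley_inv); [|apply is_derive_cayley_inv; exact Hz].
  apply (holomorphic_is_derive disk); assumption.
Qed.

Lemma half_plane_lift_pos (f : C -> C) (z : C) :
  holomorphic_self_map f -> half_plane z -> (0 < Re (half_plane_lift f z))%R.
Proof. intros [_ Hm] Hz; apply cayley_half_plane, Hm, cayley_inv_disk; exact Hz. Qed.

Lemma half_plane_lift_map (f : C -> C) :
  holomorphic_self_map f -> half_plane_map (half_plane_lift f).
Proof.
intros Hf; split.
- intros z Hz; eexists; apply is_derive_half_plane_lift; assumption.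
- intros z Hz; left; apply half_plane_lift_pos; assumption.
Qed.

Lemma Cmod_derive_half_plane_lift (f : C -> C) (z : C) :
  holomorphic_self_map f -> half_plane z ->
  let w := cayley_inv z in
  Cmod (C_derive (half_plane_lift f) z)
  = (Cmod (C_derive f w) * Cmod (1 - w) ^ 2 / Cmod (1 - f w) ^ 2)%R.
Proof.
intros Hf Hz w.
pose proof (half_plane_plus_1_neq_0 z Hz) as H1.
assert (H2 : 1 - f w <> 0) by (apply disk_minus_neq_0, Hf, cayley_inv_disk; exact Hz).
rewrite (is_C_derive_unique _ _ _ (is_derive_half_plane_lift f z Hf Hz)).
unfold w; rewrite one_minus_cayley_inv by exact H1.
pose proof (proj1 (Cmod_gt_0 _) H1); pose proof (proj1 (Cmod_gt_0 _) H2).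
rewrite !Cmod_mult, !Cmod_div by (try apply Cmult_neq_0; assumption).
rewrite !Cmod_mult, Cmod_R, Rabs_pos_eq by lra; field; repeat split; apply Rgt_not_eq; assumption.
Qed.

Lemma schwarz_pick_disk (f : C -> C) (z : C) :
  holomorphic_self_map f -> disk z ->
  (Cmod (C_derive f z) * (1 - Cmod z ^ 2) <= 1 - Cmod (f z) ^ 2)%R.
Proof.
intros Hf Hz.
pose proof (cayley_half_plane z Hz) as Hh.
pose proof (half_plane_lift_map f Hf) as HF.
pose proof (schwarz_pick _ _ _ HF Hh
  (holomorphic_is_derive half_plane _ _ (proj1 HF) Hh)) as H.
rewrite Cmod_derive_half_plane_lift in H by assumption.
unfold half_plane_lift in H; rewrite !cayley_inv_cayley, !Re_cayley in H by exact Hz.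
pose proof (proj1 (Cmod_gt_0 _) (disk_minus_neq_0 z Hz)) as P1.
pose proof (proj1 (Cmod_gt_0 _) (disk_minus_neq_0 (f z) (proj2 Hf z Hz))) as P2.
pose proof (pow_lt _ 2 P2) as P3.
apply Rmult_le_compat_r with (r := (Cmod (1 - f z) ^ 2)%R) in H; [|lra].
replace (Cmod (C_derive f z) * Cmod (1 - z) ^ 2 / Cmod (1 - f z) ^ 2 *
    ((1 - Cmod z ^ 2) / Cmod (1 - z) ^ 2) * Cmod (1 - f z) ^ 2)%R
  with (Cmod (C_derive f z) * (1 - Cmod z ^ 2))%R in H by (field; split; apply Rgt_not_eq; assumption).
replace ((1 - Cmod (f z) ^ 2) / Cmod (1 - f z) ^ 2 * Cmod (1 - f z) ^ 2)%R
  with (1 - Cmod (f z) ^ 2)%R in H by (field; apply Rgt_not_eq; assumption).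
exact H.
Qed.

(** For either map the ratio |F'| / Re F of the lift is the hyperbolic derivative times |1 - w|^2, w
    = [cayley_inv z], so the comparison passes to the lifts; it is stated without denominators. *)
Lemma hyp_derivative_half_plane_lift_le (f B : C -> C) (z : C) :
  holomorphic_self_map f -> holomorphic_self_map B -> half_plane z ->
  (hyp_derivative f (cayley_inv z) <= hyp_derivative B (cayley_inv z))%R ->
  (Cmod (C_derive (half_plane_lift f) z) * Re (half_plane_lift B z)
   <= Cmod (C_derive (half_plane_lift B) z) * Re (half_plane_lift f z))%R.
Proof.
intros Hf HB Hz H.
rewrite !Cmod_derive_half_plane_lift by assumption.
unfold half_plane_lift; rewrite !Re_cayley.
unfold hyp_derivative in H.
assert (Hw : disk (cayley_inv z)) by (apply cayley_inv_disk; exact Hz).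
set (w := cayley_inv z) in *.
pose proof (Cmod_sqr_pos _ (disk_minus_neq_0 _ (proj2 Hf w Hw))) as P1.
pose proof (Cmod_sqr_pos _ (disk_minus_neq_0 _ (proj2 HB w Hw))) as P2.
assert (D1 : (0 < 1 - Cmod (f w) ^ 2)%R).
{ rewrite Cmod2_alt; pose proof (disk_sqr _ (proj2 Hf w Hw)); lra. }
assert (D2 : (0 < 1 - Cmod (B w) ^ 2)%R).
{ rewrite Cmod2_alt; pose proof (disk_sqr _ (proj2 HB w Hw)); lra. }
set (a := Cmod (C_derive f w)) in *; set (b := Cmod (C_derive B w)) in *.
set (u := (1 - Cmod (f w) ^ 2)%R) in *; set (v := (1 - Cmod (B w) ^ 2)%R) in *.
set (n := (Cmod (1 - f w) ^ 2)%R) in *; set (m := (Cmod (1 - B w) ^ 2)%R) in *.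
pose proof (pow2_ge_0 (Cmod (1 - w))) as Hk.
set (k := (Cmod (1 - w) ^ 2)%R) in *.
assert (H' : (a * v <= b * u)%R).
{ apply Rmult_le_compat_r with (r := (u * v)%R) in H; [|apply Rmult_le_pos; lra].
  replace (a / u * (u * v))%R with (a * v)%R in H by (field; lra).
  replace (b / v * (u * v))%R with (b * u)%R in H by (field; lra); exact H. }
replace (a * k / n * (v / m))%R with (k / (n * m) * (a * v))%R by (field; lra).
replace (b * k / m * (u / n))%R with (k / (n * m) * (b * u))%R by (field; lra).
apply Rmult_le_compat_l; [|exact H'].
apply Rdiv_le_0_compat; [exact Hk | apply Rmult_lt_0_compat; assumption].
Qed.

(** The differential inequality says that artanh (p s) - artanh s is nonincreasing; the conclusion
    is its exponentiated form. *)
Lemma disk_schwarz_pick_integrated (p p' : R -> R) (t r : R) :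
  (0 <= t <= r)%R -> (r < 1)%R ->
  (forall s, (t <= s <= r)%R ->
     is_derive p s (p' s) /\ (-1 < p s < 1)%R /\ (p' s * (1 - s ^ 2) <= 1 - p s ^ 2)%R) ->
  ((1 - p t) * (1 + t) * ((1 + p r) * (1 - r))
   <= (1 - p r) * (1 + r) * ((1 + p t) * (1 - t)))%R.
Proof.
intros Ht Hr H.
set (L := fun s : R => (ln (1 + p s) - ln (1 - p s) - (ln (1 + s) - ln (1 - s)))%R).
assert (HL : (L r <= L t)%R).
{ apply (is_derive_nonincreasing L (fun s =>
    p' s / (1 + p s) + p' s / (1 - p s) - (1 / (1 + s) + 1 / (1 - s)))%R); [lra| |].
  - intros s Hs; destruct (H s Hs) as (Hd & Hb & _); unfold L.
    auto_derive.
    + assert (ex_derive p s) by (exists (p' s); exact Hd).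
      repeat split; try assumption; lra.
    + set (dd := Derive _ _); assert (E : dd = p' s) by (apply is_derive_unique; exact Hd).
      rewrite E; field; lra.
  - intros s Hs; destruct (H s Hs) as (_ & Hb & Hi).
    replace (p' s / (1 + p s) + p' s / (1 - p s) - (1 / (1 + s) + 1 / (1 - s)))%R
      with (2 * (p' s * (1 - s ^ 2) - (1 - p s ^ 2)) / ((1 - p s ^ 2) * (1 - s ^ 2)))%R
      by (field; repeat split; nra).
    assert (Hpos : (0 < (1 - p s ^ 2) * (1 - s ^ 2))%R)
      by (apply Rmult_lt_0_compat; nra).
    pose proof (Rinv_0_lt_compat _ Hpos); unfold Rdiv; nra. }
destruct (H t ltac:(lra)) as (_ & Hbt & _); destruct (H r ltac:(lra)) as (_ & Hbr & _).
unfold L in HL.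
apply Rnot_lt_le; intros Hlt; apply ln_increasing in Hlt.
- rewrite !ln_mult in Hlt by (try apply Rmult_lt_0_compat; lra); lra.
- repeat apply Rmult_lt_0_compat; lra.
Qed.

(** The integrated inequality is applied to p s = Re (k f(s e)), where k makes f(r e) nonnegative,
    so that 1 - p equals 1 - |f| at r and dominates it at t. The constant 4 bounds (1 + r)(1 + p
    t). *)
Lemma radial_growth (f : C -> C) (e : C) (K t r : R) :
  holomorphic_self_map f -> Cmod e = 1%R -> (0 <= t <= r)%R -> (r < 1)%R ->
  (1 - Cmod (f (RtoC r * e)%C) <= K * (1 - r))%R -> (0 <= K)%R ->
  (1 - Cmod (f (RtoC t * e)%C) <= 4 * K * (1 - t))%R.
Proof.
intros Hf He Ht Hr HK HK0.
destruct (phase_exists (f (RtoC r * e)%C)) as [k [Hk Hkf]].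
set (p := fun s : R => Re (k * f (RtoC s * e)%C)).
set (p' := fun s : R => Re (k * C_derive f (RtoC s * e)%C * e)).
assert (Hdisk : forall s, (0 <= s <= r)%R -> disk (RtoC s * e)).
{ intros s Hs; unfold disk; rewrite Cmod_mult, He, Cmod_R, Rabs_pos_eq; lra. }
assert (Hpf : forall s, (Rabs (p s) <= Cmod (f (RtoC s * e)%C))%R).
{ intros s; unfold p; eapply Rle_trans; [apply re_le_Cmod|]; rewrite Cmod_mult, Hk; lra. }
pose proof (disk_schwarz_pick_integrated p p' t r Ht Hr) as H.
assert (Hpr : p r = Cmod (f (RtoC r * e)%C)) by (unfold p; rewrite Hkf; apply re_RtoC).
assert (Hpt := Hpf t).
assert (Hft : disk (f (RtoC t * e)%C)) by (apply Hf, Hdisk; lra).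
assert (Hfr : disk (f (RtoC r * e)%C)) by (apply Hf, Hdisk; lra).
unfold disk in Hft, Hfr.
apply Rabs_le_between in Hpt.
assert (H0 : ((1 - p t) * (1 + t) * ((1 + p r) * (1 - r))
   <= (1 - p r) * (1 + r) * ((1 + p t) * (1 - t)))%R).
{ apply H; intros s Hs.
  assert (Hds := Hdisk s ltac:(lra)).
  assert (Hfs : disk (f (RtoC s * e)%C)) by (apply Hf; exact Hds).
  assert (Hps := Hpf s); unfold disk in Hfs.
  split; [|split].
  - unfold p.
    apply is_derive_ext with (f := fun s : R => Re (k * f ((s * Re e)%R, (s * Im e)%R))).
    { intros u; do 3 f_equal; apply injective_projections; unfold Re, Im; simpl; ring. }
    unfold p'; replace (k * C_derive f (RtoC s * e)%C * e) with
      (k * C_derive f (RtoC s * e)%C * ((Re e, Im e) : C)) by (destruct e; reflexivity).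
    replace (RtoC s * e) with (((s * Re e)%R, (s * Im e)%R) : C) in Hds |- *
      by (apply injective_projections; unfold Re, Im; simpl; ring).
    apply (is_derive_Re_curve (fun s => s * Re e)%R (fun s => s * Im e)%R (fun w => k * f w)).
    + apply is_derive_Cscal, (holomorphic_is_derive disk); [apply Hf | exact Hds].
    + auto_derive; [exact I | apply Rmult_1_l].
    + auto_derive; [exact I | apply Rmult_1_l].
  - apply Rabs_le_between in Hps; lra.
  - pose proof (schwarz_pick_disk f _ Hf Hds) as Hsp.
    rewrite Cmod_mult, He, Cmod_R, Rabs_pos_eq, Rmult_1_r in Hsp by lra.
    assert (H1 : (p' s <= Cmod (C_derive f (RtoC s * e)%C))%R).
    { unfold p'; eapply Rle_trans; [apply Re_le_Cmod|]; rewrite !Cmod_mult, Hk, He; lra. }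
    assert (H2 : (p s ^ 2 <= Cmod (f (RtoC s * e)%C) ^ 2)%R).
    { rewrite <- (pow2_abs (p s)); apply pow_incr; split; [apply Rabs_pos | exact Hps]. }
    assert (0 <= 1 - s ^ 2)%R by nra.
    nra. }
rewrite <- Hpr in HK.
assert (Hpr0 : (0 <= p r)%R) by (rewrite Hpr; apply Cmod_ge_0).
rewrite <- Hpr in Hfr.
assert (S1 : ((1 - p t) * (1 - r) <= (1 - p t) * (1 + t) * ((1 + p r) * (1 - r)))%R).
{ assert (0 <= (1 - p t) * (1 - r))%R by (apply Rmult_le_pos; lra).
  assert (1 <= (1 + t) * (1 + p r))%R by nra. nra. }
assert (S2 : ((1 - p r) * (1 + r) * ((1 + p t) * (1 - t)) <= 4 * K * (1 - t) * (1 - r))%R).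
{ assert (0 <= (1 + r) * (1 + p t) <= 4)%R by (split; [apply Rmult_le_pos|]; nra).
  assert (0 <= (1 - t) * (K * (1 - r)))%R by (repeat apply Rmult_le_pos; lra).
  apply Rle_trans with ((K * (1 - r)) * (1 + r) * ((1 + p t) * (1 - t)))%R.
  - apply Rmult_le_compat_r; [apply Rmult_le_pos; lra|]; apply Rmult_le_compat_r; lra.
  - nra. }
assert (S3 : ((1 - p t) * (1 - r) <= 4 * K * (1 - t) * (1 - r))%R) by lra.
apply Rmult_le_reg_r in S3; lra.
Qed.

(** * Positivity of the angular derivative *)

Lemma is_derive_C_continuous (f : C -> C) (z d : C) :
  is_derive f z d ->
  forall eps, (0 < eps)%R -> exists delta, (0 < delta)%R /\
    forall w, (Cmod (w - z) < delta)%R -> (Cmod (f w - f z) < eps)%R.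
Proof.
intros Hd eps He.
destruct (proj1 (is_derive_C_iff f z d) Hd (mkposreal 1 Rlt_0_1)) as [del Hdel].
simpl in Hdel.
pose proof (Cmod_ge_0 d) as Hc.
exists (Rmin del (eps / (Cmod d + 1))); split.
{ apply Rmin_pos; [apply cond_pos | apply Rdiv_lt_0_compat; lra]. }
intros w Hw.
assert (H1 := Rlt_le_trans _ _ _ Hw (Rmin_l _ _)).
assert (H2 := Rlt_le_trans _ _ _ Hw (Rmin_r _ _)).
specialize (Hdel w H1).
pose proof (Cmod_triangle (f w - f z - d * (w - z)) (d * (w - z))) as T.
replace (f w - f z - d * (w - z) + d * (w - z)) with (f w - f z) in T by ring.
rewrite Cmod_mult in T.
apply Rmult_lt_compat_r with (r := (Cmod d + 1)%R) in H2; [|lra].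
replace (eps / (Cmod d + 1) * (Cmod d + 1))%R with eps in H2 by (field; lra).
lra.
Qed.

(** The points z may be tangential. Each lies on a radius towards some e close to 1: [radial_growth]
    carries the bound inward to t e, and continuity of f carries it on to t. *)
Lemma radial_bound (f : C -> C) (K : R) :
  holomorphic_self_map f -> (0 <= K)%R ->
  (forall delta, (0 < delta)%R -> exists z, disk z /\ (Cmod (z - 1) < delta)%R
     /\ (1 - Cmod (f z) <= K * (1 - Cmod z))%R) ->
  forall t : R, (0 <= t < 1)%R -> (1 - Cmod (f (RtoC t)) <= 4 * K * (1 - t))%R.
Proof.
intros Hf HK H t Ht.
apply Rle_plus_epsilon; intros eps He.
assert (Htd : disk (RtoC t)) by (unfold disk; rewrite Cmod_R, Rabs_pos_eq; lra).
destruct (is_derive_C_continuous f _ _ (holomorphic_is_derive disk f _ (proj1 Hf) Htd) eps He)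
  as [d1 [Hd1 Hcont]].
(* The first bound forces |z| > t. The second gives |e - 1| < d1, since |e - z| = 1 - |z| <= |z -
   1|. *)
destruct (H (Rmin (1 - t) (d1 / 2))) as (z & Hz & Hz1 & Hzk).
{ apply Rmin_pos; lra. }
assert (B1 := Rlt_le_trans _ _ _ Hz1 (Rmin_l _ _)).
assert (B2 := Rlt_le_trans _ _ _ Hz1 (Rmin_r _ _)).
unfold disk in Hz.
set (r := Cmod z) in *.
assert (Htri : (1 - r <= Cmod (z - 1))%R).
{ pose proof (Cmod_triangle (1 - z) z) as T.
  replace (1 - z + z) with (RtoC 1) in T by ring.
  rewrite Cmod_1, Cmod_minus_sym in T; unfold r; lra. }
assert (Hr0 : (t < r)%R) by lra.
assert (Hrn : RtoC r <> 0) by (apply RtoC_neq_0; lra).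
set (e := z / RtoC r).
assert (He1 : Cmod e = 1%R).
{ unfold e; rewrite Cmod_div, Cmod_R, Rabs_pos_eq by (assumption || lra).
  fold r; field; lra. }
assert (Hre : RtoC r * e = z) by (unfold e; field; exact Hrn).
pose proof (radial_growth f e K t r Hf He1 ltac:(lra) Hz) as G.
rewrite Hre in G; specialize (G Hzk HK).
assert (Hee : (Cmod (e - 1) < d1)%R).
{ pose proof (Cmod_triangle (e - z) (z - 1)) as T.
  replace (e - z + (z - 1)) with (e - 1) in T by ring.
  assert (E : Cmod (e - z) = (1 - r)%R).
  { replace (e - z) with (RtoC (1 - r) * e)
      by (rewrite RtoC_minus, <- Hre; ring).
    rewrite Cmod_mult, He1, Cmod_R, Rabs_pos_eq; lra. }
  lra. }
assert (Hc : (Cmod (f (RtoC t * e)%C - f (RtoC t)) < eps)%R).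
{ apply Hcont.
  replace (RtoC t * e - RtoC t) with (RtoC t * (e - 1)) by ring.
  rewrite Cmod_mult, Cmod_R, Rabs_pos_eq by lra.
  pose proof (Cmod_ge_0 (e - 1)); nra. }
pose proof (Cmod_triangle (f (RtoC t * e)%C - f (RtoC t)) (f (RtoC t))) as T.
replace (f (RtoC t * e)%C - f (RtoC t) + f (RtoC t)) with (f (RtoC t * e)%C) in T by ring.
lra.
Qed.

Lemma holomorphic_self_map_opp (f : C -> C) :
  holomorphic_self_map f -> holomorphic_self_map (fun z => - f z).
Proof.
intros [Hf Hm]; split.
- intros z Hz; destruct (Hf z Hz) as [l Hl].
  exists (- (1) * l).
  apply (is_derive_ext (fun w => - (1) * f w)); [intros w; change (- (1) * f w = - f w); ring|].
  apply is_derive_Cscal; exact Hl.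
- intros z Hz; unfold disk; rewrite Cmod_opp; apply Hm; exact Hz.
Qed.

(** The reciprocal of the lift of f is the lift of -f, hence again a half-plane map to which
    Schwarz-Pick applies. *)
Lemma cayley_opp (w : C) : 1 - w <> 0 -> 1 + w <> 0 -> cayley w * cayley (- w) = 1.
Proof.
intros H1 H2; unfold cayley; replace (1 - - w) with (1 + w) by ring.
field; split; assumption.
Qed.

(* [1 / F] has derivative O(1/x^2) along the real axis and tends to 0, hence is
   O(1/x). *)
Lemma half_plane_lift_linear_growth (f : C -> C) (M : R) :
  holomorphic_self_map f -> (0 < M)%R ->
  (forall t : R, (0 <= t < 1)%R -> (1 - Cmod (f (RtoC t)) <= M * (1 - t))%R) ->
  (forall eps, (0 < eps)%R -> exists t0, (0 <= t0 < 1)%R /\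
     forall t, (t0 <= t < 1)%R -> (Cmod (f (RtoC t) - 1) < eps)%R) ->
  exists x1, (0 < x1)%R /\ forall x, (x1 <= x)%R ->
    (x <= 4 * M * Cmod (half_plane_lift f (RtoC x)))%R.
Proof.
intros Hf HM Hrad Hlim.
pose proof (holomorphic_self_map_opp f Hf) as Hg.
set (E := half_plane_lift (fun z => - f z)).
pose proof (half_plane_lift_map _ Hg) as HE; fold E in HE.
set (tt := fun x : R => ((x - 1) / (x + 1))%R).
assert (Htt : forall x, (0 < x)%R -> cayley_inv (RtoC x) = RtoC (tt x)).
{ intros x Hx; unfold cayley_inv, tt.
  rewrite RtoC_div, RtoC_minus, RtoC_plus by lra; reflexivity. }
assert (Htt1 : forall x, (0 < x)%R -> (1 - tt x = 2 / (x + 1))%R)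
  by (intros x Hx; unfold tt; field; lra).
assert (Htt2 : forall x, (0 < x)%R -> (tt x < 1)%R).
{ intros x Hx; pose proof (Htt1 x Hx).
  assert (0 < 2 / (x + 1))%R by (apply Rdiv_lt_0_compat; lra); lra. }
assert (Hlim' : forall eps, (0 < eps)%R -> exists x0, (1 <= x0)%R /\
  forall x, (x0 <= x)%R -> (Cmod (f (RtoC (tt x)) - 1) < eps)%R).
{ intros eps He; destruct (Hlim eps He) as (t0 & Ht0 & Ht).
  exists (Rmax 1 (2 / (1 - t0))); split; [apply Rmax_l|].
  intros x Hx.
  assert (H1 : (1 <= x)%R) by (apply Rle_trans with (2 := Hx), Rmax_l).
  assert (H2 : (2 / (1 - t0) <= x)%R) by (apply Rle_trans with (2 := Hx), Rmax_r).
  apply Ht; split; [|apply Htt2; lra].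
  pose proof (Htt1 x ltac:(lra)) as H3.
  apply Rmult_le_compat_r with (r := (1 - t0)%R) in H2; [|lra].
  replace (2 / (1 - t0) * (1 - t0))%R with 2%R in H2 by (field; lra).
  assert (2 / (x + 1) <= 1 - t0)%R; [|lra].
  apply Rmult_le_reg_r with (x + 1)%R; [lra|].
  replace (2 / (x + 1) * (x + 1))%R with 2%R by (field; lra); nra. }
(* Once |f - 1| < 1, the denominator 1 + f of E has modulus at least 1. *)
destruct (Hlim' 1%R Rlt_0_1) as (x1 & Hx1 & Hnear).
assert (Hplus : forall x, (x1 <= x)%R -> (1 <= Cmod (1 + f (RtoC (tt x))))%R).
{ intros x Hx; pose proof (Hnear x Hx) as H1.
  pose proof (Cmod_triangle (1 + f (RtoC (tt x))) (1 - f (RtoC (tt x)))) as T.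
  replace (1 + f (RtoC (tt x)) + (1 - f (RtoC (tt x)))) with (RtoC 2) in T by ring.
  rewrite Cmod_R, Rabs_pos_eq in T by lra; rewrite Cmod_minus_sym in H1; lra. }
assert (HEx : forall x, (x1 <= x)%R ->
  E (RtoC x) = (1 - f (RtoC (tt x))) / (1 + f (RtoC (tt x)))).
{ intros x Hx; unfold E, half_plane_lift, cayley; rewrite Htt by lra.
  f_equal; ring. }
assert (HEb : forall x, (x1 <= x)%R -> (Cmod (E (RtoC x)) <= Cmod (f (RtoC (tt x)) - 1))%R).
{ intros x Hx; rewrite HEx by exact Hx; pose proof (Hplus x Hx) as H1.
  rewrite Cmod_div by (apply Cmod_gt_0; lra).
  rewrite Cmod_minus_sym; pose proof (Cmod_ge_0 (f (RtoC (tt x)) - 1)) as H2.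
  apply Rmult_le_reg_r with (Cmod (1 + f (RtoC (tt x)))); [lra|].
  unfold Rdiv; rewrite Rmult_assoc, Rinv_l by lra; nra. }
assert (HEr : forall x, (x1 <= x)%R -> (Re (E (RtoC x)) <= 4 * M / x)%R).
{ intros x Hx; unfold E, half_plane_lift; rewrite Re_cayley, Htt by lra.
  replace (1 - - f (RtoC (tt x))) with (1 + f (RtoC (tt x))) by ring.
  rewrite Cmod_opp; pose proof (Hplus x Hx) as H1.
  assert (Hdt : disk (RtoC (tt x))) by (rewrite <- Htt by lra; apply cayley_inv_disk; unfold half_plane, Re; simpl; lra).
  pose proof (proj2 Hf _ Hdt) as H2; unfold disk in H2.
  assert (Ht0 : (0 <= tt x)%R).
  { unfold tt; apply Rdiv_le_0_compat; lra. }
  pose proof (Hrad (tt x) (conj Ht0 (Htt2 x ltac:(lra)))) as H3.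
  rewrite Htt1 in H3 by lra.
  pose proof (Cmod_ge_0 (f (RtoC (tt x)))) as H4.
  set (m := Cmod (f (RtoC (tt x)))) in *; set (q := Cmod (1 + f (RtoC (tt x)))) in *.
  assert (H5 : (1 - m ^ 2 <= 4 * M / x)%R).
  { apply Rle_trans with (2 * (M * (2 / (x + 1))))%R; [nra|].
    replace (2 * (M * (2 / (x + 1))))%R with (4 * M * / (x + 1))%R by (field; lra).
    apply Rmult_le_compat_l; [lra|]; apply Rinv_le_contravar; lra. }
  apply Rle_trans with (1 - m ^ 2)%R; [|exact H5].
  assert (H6 : (0 <= 1 - m ^ 2)%R) by nra.
  assert (H7 : (1 <= q ^ 2)%R) by nra.
  apply Rmult_le_reg_r with (q ^ 2)%R; [lra|].
  unfold Rdiv; rewrite Rmult_assoc, Rinv_l by lra; nra. }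
exists x1; split; [lra|].
intros x Hx.
assert (HEbound : (Cmod (E (RtoC x)) <= 4 * M / x)%R).
{ apply Rle_plus_epsilon; intros eps He.
  destruct (Hlim' eps He) as (x2 & Hx2 & Hnear2).
  set (X := Rmax x x2).
  assert (HX1 : (x <= X)%R) by apply Rmax_l.
  assert (HX2 : (x2 <= X)%R) by apply Rmax_r.
  destruct (phase_exists (E (RtoC x))) as [k [Hk Hke]].
  (* The bound |E'| <= 4 M / s^2 makes this difference decrease. As k rotates E x onto the positive
     axis, the right side is 4 M / x - |E x|, while the left side exceeds -eps. *)
  assert (Hmono : (4 * M / X - Re (k * E (X, 0%R)) <= 4 * M / x - Re (k * E (x, 0%R)))%R).
  { apply (is_derive_nonincreasing (fun s => 4 * M / s - Re (k * E (s, 0%R)))%R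
      (fun s => - (4 * M) / s ^ 2 - Re (k * C_derive E (s, 0%R) * (1, 0)))%R); [exact HX1| |].
    - intros s Hs.
      apply (is_derive_minus (K := R_AbsRing) (V := R_NormedModule)
        (fun s => (4 * M / s)%R) (fun s => Re (k * E (s, 0%R)))).
      + auto_derive; [lra | field; lra].
      + apply (is_derive_Re_curve (fun s => s) (fun _ => 0%R) (fun w => k * E w)).
        * apply is_derive_Cscal, (holomorphic_is_derive half_plane); [apply HE|].
          apply half_plane_pair; lra.
        * apply (is_derive_id (K := R_AbsRing)).
        * apply (is_derive_const (K := R_AbsRing) (V := R_NormedModule)).
    - intros s Hs.
      assert (Hh : half_plane (s, 0%R)) by (apply half_plane_pair; lra).
      pose proof (schwarz_pick E _ _ HE Hh
        (holomorphic_is_derive half_plane E _ (proj1 HE) Hh)) as Hsp.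
      change (Re (s, 0%R)) with s in Hsp.
      pose proof (HEr s ltac:(lra)) as H1; change (RtoC s) with ((s, 0%R) : C) in H1.
      pose proof (re_le_Cmod (k * C_derive E (s, 0%R) * (1, 0))) as H2.
      rewrite !Cmod_mult, Hk in H2.
      replace (Cmod (1%R, 0%R)) with 1%R in H2 by (symmetry; apply Cmod_1).
      apply Rabs_le_between in H2.
      assert (H3 : (Cmod (C_derive E (s, 0%R)) <= 4 * M / s ^ 2)%R).
      { apply Rmult_le_reg_r with s; [lra|].
        replace (4 * M / s ^ 2 * s)%R with (4 * M / s)%R by (field; lra); lra. }
      unfold Rdiv in *; lra. }
  change ((x, 0%R) : C) with (RtoC x) in Hmono; change ((X, 0%R) : C) with (RtoC X) in Hmono.
  rewrite Hke, re_RtoC in Hmono.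
  pose proof (Re_mult_phase k (E (RtoC X)) Hk) as H1.
  pose proof (HEb X ltac:(lra)) as H2; pose proof (Hnear2 X HX2) as H3.
  assert (0 < 4 * M / X)%R by (apply Rdiv_lt_0_compat; lra).
  lra. }
assert (Hprod : half_plane_lift f (RtoC x) * E (RtoC x) = 1).
{ unfold E, half_plane_lift; rewrite Htt by lra.
  apply cayley_opp; [|apply Cmod_gt_0; pose proof (Hplus x Hx); lra].
  apply disk_minus_neq_0, Hf; rewrite <- Htt by lra; apply cayley_inv_disk.
  unfold half_plane, Re; simpl; lra. }
apply (f_equal Cmod) in Hprod; rewrite Cmod_mult, Cmod_1 in Hprod.
set (F := Cmod (half_plane_lift f (RtoC x))) in *.
assert (HF : (0 <= F)%R) by apply Cmod_ge_0.
assert (H1 : (1 <= F * (4 * M / x))%R) by (rewrite <- Hprod; apply Rmult_le_compat_l; assumption).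
apply Rmult_le_compat_r with (r := x) in H1; [|lra].
replace (F * (4 * M / x) * x)%R with (4 * M * F)%R in H1 by (field; lra); lra.
Qed.

(** * Curves on which F has constant imaginary part *)

Lemma locally_C_iff (z : C) (P : C -> Prop) :
  locally z P <-> exists eps, (0 < eps)%R /\ forall w, (Cmod (w - z) < eps)%R -> P w.
Proof.
split.
- intros [eps H]; exists eps; split; [apply cond_pos|].
  intros w Hw; apply H; split.
  + eapply Rle_lt_trans; [apply (re_le_Cmod (w - z)) | exact Hw].
  + eapply Rle_lt_trans; [apply (Im_le_Cmod (w - z)) | exact Hw].
- intros [eps [He H]]; exists (pos_div_2 (mkposreal eps He)); intros w [H1 H2]; apply H.
  destruct w as [u v], z as [x y].
  apply (Cmod_lt_Rmax x y u v (mkposreal eps He)); [exact H1 | exact H2].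
Qed.

Lemma filterlim_C_seq (x : nat -> C) (l : C) (eps : R) :
  filterlim x eventually (locally l) -> (0 < eps)%R ->
  eventually (fun n => (Cmod (x n - l) < eps)%R).
Proof.
intros H He; refine (H (fun w => (Cmod (w - l) < eps)%R) _).
apply locally_C_iff; exists eps; split; auto.
Qed.

Lemma Cmod_0_eq (a b : C) : (forall eps, (0 < eps)%R -> (Cmod (a - b) <= eps)%R) -> a = b.
Proof.
intros H; apply Ceq_minus, Cmod_eq_0, Rle_antisym; [|apply Cmod_ge_0].
apply Rle_plus_epsilon; intros eps He; rewrite Rplus_0_l; apply H; exact He.
Qed.

(** Banach's theorem on a closed disk, which is mapped into itself because 3/4 + 1/4 = 1. The limit
    of the iterates is obtained as the sum of the series of their increments, dominated by a
    geometric one. *)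
Lemma contraction_fixed_point (Phi : C -> C) (w0 : C) (rho : R) :
  (0 <= rho)%R ->
  (forall a b, (Cmod (a - w0) <= rho)%R -> (Cmod (b - w0) <= rho)%R ->
     (Cmod (Phi a - Phi b) <= / 4 * Cmod (a - b))%R) ->
  (Cmod (Phi w0 - w0) <= 3 / 4 * rho)%R ->
  exists w, (Cmod (w - w0) <= rho)%R /\ Phi w = w.
Proof.
intros Hrho Hc H0.
set (x := fun n => Nat.iter n Phi w0).
assert (Hself : forall a, (Cmod (a - w0) <= rho)%R -> (Cmod (Phi a - w0) <= rho)%R).
{ intros a Ha.
  assert (Hw0 : (Cmod (w0 - w0) <= rho)%R)
    by (replace (w0 - w0) with (RtoC 0) by ring; rewrite Cmod_0; exact Hrho).
  pose proof (Hc a w0 Ha Hw0) as H1.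
  pose proof (Cmod_triangle (Phi a - Phi w0) (Phi w0 - w0)) as T.
  replace (Phi a - Phi w0 + (Phi w0 - w0)) with (Phi a - w0) in T by ring; lra. }
assert (Hin : forall n, (Cmod (x n - w0) <= rho)%R).
{ induction n as [|n IH]; [|apply Hself; exact IH].
  simpl; replace (w0 - w0) with (RtoC 0) by ring; rewrite Cmod_0; exact Hrho. }
assert (Hstep : forall n, (Cmod (x (S n) - x n) <= rho * (/ 4) ^ n)%R).
{ induction n as [|n IH]; [simpl; lra|].
  pose proof (Hc (x (S n)) (x n) (Hin (S n)) (Hin n)) as H1.
  change (x (S (S n))) with (Phi (x (S n))); change (x (S n)) with (Phi (x n)) at 2.
  apply Rle_trans with (1 := H1); simpl pow; lra. }
assert (Hser : ex_series (K := C_AbsRing) (V := C_NormedModule) (fun n => x (S n) - x n)).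
{ apply (ex_series_le (K := C_AbsRing) (V := C_CompleteNormedModule)
    (fun n => x (S n) - x n) (fun n => rho * (/ 4) ^ n)%R).
  - exact Hstep.
  - apply (ex_series_scal (K := R_AbsRing) (V := R_NormedModule) rho (fun n => (/ 4) ^ n)%R).
    apply ex_series_geom; rewrite Rabs_pos_eq; lra. }
destruct Hser as [l Hl].
assert (Hsum : forall n, sum_n (G := C_NormedModule) (fun n => x (S n) - x n) n = x (S n) - w0).
{ induction n as [|n IH]; [rewrite sum_O; reflexivity|].
  rewrite sum_Sn, IH.
  change (x (S n) - w0 + (x (S (S n)) - x (S n)) = x (S (S n)) - w0); ring. }
assert (Hlim : forall eps, (0 < eps)%R -> exists n, (Cmod (x (S n) - (w0 + l)) < eps)%R
   /\ (Cmod (x n - (w0 + l)) < eps)%R).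
{ intros eps He.
  destruct (filterlim_C_seq _ l eps Hl He) as [N HN].
  exists (S N); split.
  - pose proof (HN (S N) ltac:(lia)) as H1; rewrite Hsum in H1.
    replace (x (S (S N)) - (w0 + l)) with (x (S (S N)) - w0 - l) by ring; exact H1.
  - pose proof (HN N ltac:(lia)) as H1; rewrite Hsum in H1.
    replace (x (S N) - (w0 + l)) with (x (S N) - w0 - l) by ring; exact H1. }
assert (Hw : (Cmod (w0 + l - w0) <= rho)%R).
{ apply Rle_plus_epsilon; intros eps He.
  destruct (Hlim eps He) as (n & _ & H2).
  pose proof (Cmod_triangle (w0 + l - x n) (x n - w0)) as T.
  replace (w0 + l - x n + (x n - w0)) with (w0 + l - w0) in T by ring.
  rewrite (Cmod_minus_sym (w0 + l) (x n)) in T; pose proof (Hin n); lra. }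
exists (w0 + l); split; [exact Hw|].
apply Cmod_0_eq; intros eps He.
destruct (Hlim (eps / 2)%R ltac:(lra)) as (n & H1 & H2).
pose proof (Cmod_triangle (Phi (w0 + l) - x (S n)) (x (S n) - (w0 + l))) as T.
replace (Phi (w0 + l) - x (S n) + (x (S n) - (w0 + l))) with (Phi (w0 + l) - (w0 + l)) in T by ring.
pose proof (Hc (w0 + l) (x n) Hw (Hin n)) as H3.
rewrite (Cmod_minus_sym (w0 + l) (x n)) in H3; change (Phi (x n)) with (x (S n)) in H3; lra.
Qed.

Definition sector (R0 : R) (z : C) : Prop := (R0 < Re z)%R /\ (Rabs (Im z) <= Re z)%R.

(** Such a move adds at least 2u/3 to Re and at most u/3 to |Im|, so the opening |Im| <= Re is
    preserved. *)
Lemma sector_ball (R0 u : R) (z w : C) :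
  sector R0 z -> (0 <= u)%R -> (Cmod (w - (z + RtoC u)) <= u / 3)%R -> sector R0 w.
Proof.
intros [H1 H2] Hu Hw.
pose proof (re_le_Cmod (w - (z + RtoC u))) as A; pose proof (Im_le_Cmod (w - (z + RtoC u))) as B.
replace (Re (w - (z + RtoC u))) with (Re w - Re z - u)%R in A by (unfold Re; simpl; ring).
replace (Im (w - (z + RtoC u))) with (Im w - Im z)%R in B by (unfold Im; simpl; ring).
pose proof (Rle_trans _ _ _ A Hw) as A1; pose proof (Rle_trans _ _ _ B Hw) as B1.
apply Rabs_le_between in A1; apply Rabs_le_between in B1; apply Rabs_le_between in H2.
split; [lra | apply Rabs_le; lra].
Qed.

Lemma sector_segment (R0 t : R) (a b : C) :
  sector R0 a -> sector R0 b -> (0 <= t <= 1)%R -> sector R0 (a + RtoC t * (b - a)).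
Proof.
intros [A1 A2] [B1 B2] Ht; unfold sector.
replace (Re (a + RtoC t * (b - a))) with ((1 - t) * Re a + t * Re b)%R by (unfold Re; simpl; ring).
replace (Im (a + RtoC t * (b - a))) with ((1 - t) * Im a + t * Im b)%R by (unfold Im; simpl; ring).
apply Rabs_le_between in A2; apply Rabs_le_between in B2.
assert (Hm : (R0 < Rmin (Re a) (Re b))%R) by (apply Rmin_glb_lt; assumption).
pose proof (Rmin_l (Re a) (Re b)) as M1; pose proof (Rmin_r (Re a) (Re b)) as M2.
assert (P : forall x y : R, (0 <= x)%R -> (0 <= y)%R -> (0 <= (1 - t) * x + t * y)%R).
{ intros x y Hx Hy; apply Rplus_le_le_0_compat; apply Rmult_le_pos; lra. }
split; [|apply Rabs_le; split].
- pose proof (P (Re a - Rmin (Re a) (Re b))%R (Re b - Rmin (Re a) (Re b))%R ltac:(lra) ltac:(lra)).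
  lra.
- pose proof (P (Re a + Im a)%R (Re b + Im b)%R ltac:(lra) ltac:(lra)); lra.
- pose proof (P (Re a - Im a)%R (Re b - Im b)%R ltac:(lra) ltac:(lra)); lra.
Qed.

(** The error of the difference quotient of W against 1/d is the remainder of F divided by d h; the
    Lipschitz bound turns a remainder o(|W(s + h) - W(s)|) into o(h). The coordinates are separated
    to suit [is_derive_Re_curve]. *)
Lemma inverse_curve_derivative (F : C -> C) (W : R -> C) (s : R) (d : C) (L delta0 : R) :
  is_derive F (W s) d -> d <> 0 -> (0 < L)%R -> (0 < delta0)%R ->
  (forall s', (Rabs (s' - s) < delta0)%R ->
     F (W s') = F (W s) + RtoC (s' - s) /\ (Cmod (W s' - W s) <= L * Rabs (s' - s))%R) ->
  is_derive (fun u => Re (W u)) s (Re (/ d)) /\ is_derive (fun u => Im (W u)) s (Im (/ d)).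
Proof.
intros HF Hd HL Hdel0 H.
assert (Hdm : (0 < Cmod d)%R) by (apply Cmod_gt_0; exact Hd).
assert (Hmain : forall eps, (0 < eps)%R -> exists delta : posreal, forall h, h <> 0%R ->
  (Rabs h < delta)%R -> (Cmod ((W (s + h)%R - W s) / RtoC h - / d) < eps)%R).
{ intros eps He.
  assert (Hq : (0 < eps / 2 * Cmod d / L)%R)
    by (apply Rdiv_lt_0_compat; [apply Rmult_lt_0_compat|]; lra).
  destruct (proj1 (is_derive_C_iff F (W s) d) HF (mkposreal _ Hq)) as [del Hdel].
  simpl in Hdel.
  assert (Hp : (0 < Rmin delta0 (del / L))%R).
  { apply Rmin_pos; [exact Hdel0 | apply Rdiv_lt_0_compat; [apply cond_pos | exact HL]]. }
  exists (mkposreal _ Hp); simpl; intros h Hh0 Hh.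
  assert (B1 := Rlt_le_trans _ _ _ Hh (Rmin_l _ _)).
  assert (B2 := Rlt_le_trans _ _ _ Hh (Rmin_r _ _)).
  destruct (H (s + h)%R) as [E1 E2]; [replace (s + h - s)%R with h by ring; exact B1|].
  replace (s + h - s)%R with h in E1, E2 by ring.
  assert (Hhp : (0 < Rabs h)%R) by (apply Rabs_pos_lt; exact Hh0).
  assert (B3 : (Cmod (W (s + h)%R - W s) < del)%R).
  { apply Rle_lt_trans with (1 := E2).
    apply Rmult_lt_compat_l with (r := L) in B2; [|exact HL].
    replace (L * (del / L))%R with (pos del) in B2 by (field; lra); exact B2. }
  specialize (Hdel _ B3); rewrite E1 in Hdel.
  replace (F (W s) + RtoC h - F (W s) - d * (W (s + h)%R - W s))
    with (RtoC h - d * (W (s + h)%R - W s)) in Hdel by ring.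
  replace ((W (s + h)%R - W s) / RtoC h - / d)
    with (- (RtoC h - d * (W (s + h)%R - W s)) / (d * RtoC h))
    by (field; split; [exact Hd | apply RtoC_neq_0; exact Hh0]).
  rewrite Cmod_div, Cmod_opp, Cmod_mult, Cmod_R
    by (apply Cmult_neq_0; [exact Hd | apply RtoC_neq_0; exact Hh0]).
  assert (Hpp : (0 < Cmod d * Rabs h)%R) by (apply Rmult_lt_0_compat; assumption).
  apply Rmult_lt_reg_r with (1 := Hpp); unfold Rdiv at 1.
  rewrite Rmult_assoc, Rinv_l, Rmult_1_r by lra.
  apply Rle_lt_trans with (1 := Hdel).
  apply Rle_lt_trans with (eps / 2 * Cmod d / L * (L * Rabs h))%R.
  - apply Rmult_le_compat_l; [lra | exact E2].
  - replace (eps / 2 * Cmod d / L * (L * Rabs h))%R with (eps / 2 * (Cmod d * Rabs h))%R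
      by (field; lra).
    apply Rmult_lt_compat_r; lra. }
split; apply is_derive_Reals; intros eps He; destruct (Hmain eps He) as [del Hdel];
  exists del; intros h Hh0 Hh; specialize (Hdel h Hh0 Hh);
  assert (Hn : RtoC h <> 0) by (apply RtoC_neq_0; exact Hh0).
- replace ((Re (W (s + h)%R) - Re (W s)) / h - Re (/ d))%R
    with (Re ((W (s + h)%R - W s) / RtoC h - / d)).
  + eapply Rle_lt_trans; [apply re_le_Cmod | exact Hdel].
  + unfold Cdiv; rewrite <- RtoC_inv by exact Hh0; unfold Cminus at 1.
    rewrite re_plus, re_opp, re_scal_r; unfold Cminus; rewrite re_plus, re_opp; unfold Rdiv; ring.
- replace ((Im (W (s + h)%R) - Im (W s)) / h - Im (/ d))%R
    with (Im ((W (s + h)%R - W s) / RtoC h - / d)).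
  + eapply Rle_lt_trans; [apply Im_le_Cmod | exact Hdel].
  + unfold Cdiv; rewrite <- RtoC_inv by exact Hh0; unfold Cminus at 1.
    rewrite im_plus, im_opp, im_scal_r; unfold Cminus; rewrite im_plus, im_opp; unfold Rdiv; ring.
Qed.

(** The sector is convex, so the mean value inequality applies to F z - c z. With c > 0 this makes F
    injective there. *)
Lemma near_linear_on_sector (F : C -> C) (c R0 : R) (a b : C) :
  (0 <= R0)%R -> holomorphic_on half_plane F ->
  (forall z, sector R0 z -> (Cmod (C_derive F z - RtoC c) <= c / 4)%R) ->
  sector R0 a -> sector R0 b ->
  (Cmod (F b - F a - RtoC c * (b - a)) <= c / 4 * Cmod (b - a))%R.
Proof.
intros HR HF Hc Ha Hb.
replace (F b - F a - RtoC c * (b - a)) with ((F b - RtoC c * b) - (F a - RtoC c * a)) by ring.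
apply (mean_value_inequality (fun z => F z - RtoC c * z) (fun z => C_derive F z - RtoC c)).
intros t Ht; pose proof (sector_segment R0 t a b Ha Hb Ht) as Hs.
split; [|apply Hc; exact Hs].
replace (C_derive F (a + RtoC t * (b - a)) - RtoC c)
  with (C_derive F (a + RtoC t * (b - a)) - RtoC c * 1) by ring.
apply is_derive_Cminus.
- apply (holomorphic_is_derive half_plane); [exact HF|].
  destruct Hs as [H1 _]; unfold half_plane; lra.
- apply is_derive_Cscal, is_derive_Cid.
Qed.

(* Newton-type iteration [w - (F w - F z - s) / c]. *)
Lemma flow_line_exists (F : C -> C) (c R0 s : R) (z : C) :
  (0 <= R0)%R -> (0 < c)%R -> holomorphic_on half_plane F ->
  (forall z, sector R0 z -> (Cmod (C_derive F z - RtoC c) <= c / 4)%R) ->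
  sector R0 z -> (0 <= s)%R ->
  exists w, (Cmod (w - (z + RtoC (s / c))) <= s / c / 3)%R /\ F w = F z + RtoC s.
Proof.
intros HR Hc HF Hder Hz Hs.
set (u := (s / c)%R).
assert (Hu : (0 <= u)%R) by (apply Rdiv_le_0_compat; assumption).
assert (Hcn : RtoC c <> 0) by (apply RtoC_neq_0; lra).
assert (Hsc : RtoC s = RtoC c * RtoC u).
{ rewrite <- RtoC_mult; f_equal; unfold u; field; lra. }
assert (Hsec : forall w, (Cmod (w - (z + RtoC u)) <= u / 3)%R -> sector R0 w).
{ intros w Hw; apply (sector_ball R0 u z); assumption. }
(* The start z + u is the exact solution when F is c z plus a constant. The bound c/4 yields
   contraction factor 1/4 and a first step of at most u/4, which is 3/4 of the radius u/3. *)
destruct (contraction_fixed_point (fun w => w - (F w - F z - RtoC s) / RtoC c)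
  (z + RtoC u) (u / 3)%R) as [w [Hw Hfix]].
- lra.
- intros a b Ha Hb.
  pose proof (near_linear_on_sector F c R0 b a HR HF Hder (Hsec b Hb) (Hsec a Ha)) as H.
  replace (a - (F a - F z - RtoC s) / RtoC c - (b - (F b - F z - RtoC s) / RtoC c))
    with (- (F a - F b - RtoC c * (a - b)) / RtoC c) by (field; exact Hcn).
  rewrite Cmod_div, Cmod_opp, Cmod_R, Rabs_pos_eq by (assumption || lra).
  apply Rmult_le_reg_r with c; [exact Hc|].
  unfold Rdiv; rewrite Rmult_assoc, Rinv_l by lra; lra.
- assert (H0 : sector R0 (z + RtoC u)).
  { apply Hsec; replace (z + RtoC u - (z + RtoC u)) with (RtoC 0) by ring; rewrite Cmod_0; lra. }
  pose proof (near_linear_on_sector F c R0 z (z + RtoC u) HR HF Hder Hz H0) as H.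
  replace (z + RtoC u - z) with (RtoC u) in H by ring.
  rewrite Cmod_R, (Rabs_pos_eq u) in H by exact Hu.
  replace (z + RtoC u - (F (z + RtoC u) - F z - RtoC s) / RtoC c - (z + RtoC u))
    with (- (F (z + RtoC u) - F z - RtoC c * RtoC u) / RtoC c)
    by (rewrite Hsc; field; exact Hcn).
  rewrite Cmod_div, Cmod_opp, Cmod_R, Rabs_pos_eq by (assumption || lra).
  apply Rmult_le_reg_r with c; [exact Hc|].
  unfold Rdiv; rewrite Rmult_assoc, Rinv_l by lra; lra.
- exists w; split; [exact Hw|].
  assert (E : (F w - F z - RtoC s) / RtoC c = 0).
  { replace ((F w - F z - RtoC s) / RtoC c)
      with (w - (w - (F w - F z - RtoC s) / RtoC c)) by ring.
    rewrite Hfix; ring. }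
  replace (F w) with (RtoC c * ((F w - F z - RtoC s) / RtoC c) + (F z + RtoC s))
    by (field; exact Hcn).
  rewrite E; ring.
Qed.

(* Along the curves [F (W s) = F z + s] the quotient [Re G / Re F] decreases, and
   they run to infinity inside the sector. *)
Lemma real_part_comparison (F G : C -> C) (c kappa R0 : R) :
  half_plane_map F -> half_plane_map G ->
  (forall z, half_plane z -> (0 < Re (F z))%R) ->
  (forall z, half_plane z -> (0 < Re (G z))%R) ->
  (forall z, half_plane z ->
     (Cmod (C_derive G z) * Re (F z) <= Cmod (C_derive F z) * Re (G z))%R) ->
  (0 < c)%R -> (0 <= kappa)%R -> (0 <= R0)%R ->
  (forall z, half_plane z -> (kappa * Re z <= Re (G z))%R) ->
  (forall z, sector R0 z -> (Cmod (C_derive F z - RtoC c) <= c / 4)%R) ->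
  (forall eps, (0 < eps)%R -> exists R1, forall z,
     sector R1 z -> (Re (F z) <= (c + eps) * Re z)%R) ->
  forall z, sector R0 z -> (kappa * Re (F z) <= c * Re (G z))%R.
Proof.
intros HF HG PF PG Hcomp Hc Hk HR Hkappa Hder Hasym z Hz.
(* W is chosen separately at each s, with no regularity built in; for s < 0 its value is
   irrelevant. *)
assert (HW : forall s, exists w, (0 <= s)%R ->
  (Cmod (w - (z + RtoC (s / c))) <= s / c / 3)%R /\ F w = F z + RtoC s).
{ intros s; destruct (Rle_dec 0 s) as [Hs|Hs]; [|exists 0; lra].
  destruct (flow_line_exists F c R0 s z HR Hc (proj1 HF) Hder Hz Hs) as [w Hw].
  exists w; intros _; exact Hw. }
pose (W := fun s => proj1_sig (constructive_indefinite_description _ (HW s))).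
assert (HWs : forall s, (0 <= s)%R ->
  (Cmod (W s - (z + RtoC (s / c))) <= s / c / 3)%R /\ F (W s) = F z + RtoC s).
{ intros s Hs; unfold W; destruct (constructive_indefinite_description _ (HW s)) as [w Hw].
  apply Hw; exact Hs. }
assert (Hsec : forall s, (0 <= s)%R -> sector R0 (W s)).
{ intros s Hs; apply (sector_ball R0 (s / c) z); [exact Hz | apply Rdiv_le_0_compat; assumption|].
  apply HWs; exact Hs. }
assert (Hsechp : forall w, sector R0 w -> half_plane w)
  by (intros w [H1 _]; unfold half_plane; lra).
assert (HReF : forall s, (0 <= s)%R -> Re (F (W s)) = (Re (F z) + s)%R).
{ intros s Hs; rewrite (proj2 (HWs s Hs)), re_plus, re_RtoC; reflexivity. }
assert (Hlow : forall w, sector R0 w -> (3 / 4 * c <= Cmod (C_derive F w))%R).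
{ intros w Hw; pose proof (Hder w Hw) as H1.
  pose proof (Cmod_triangle (RtoC c - C_derive F w) (C_derive F w)) as T.
  replace (RtoC c - C_derive F w + C_derive F w) with (RtoC c) in T by ring.
  rewrite Cmod_R, Rabs_pos_eq, Cmod_minus_sym in T by lra; lra. }
(* Regularity of W comes from near-linearity: |F b - F a| is at least 3c/4 |b - a| on the sector. *)
assert (Hlip : forall s s', (0 <= s)%R -> (0 <= s')%R ->
  (Cmod (W s' - W s) <= 4 / (3 * c) * Rabs (s' - s))%R).
{ intros s s' Hs Hs'.
  pose proof (near_linear_on_sector F c R0 (W s) (W s') HR (proj1 HF) Hder
    (Hsec s Hs) (Hsec s' Hs')) as H1.
  rewrite (proj2 (HWs s Hs)), (proj2 (HWs s' Hs')) in H1.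
  replace (F z + RtoC s' - (F z + RtoC s) - RtoC c * (W s' - W s))
    with (RtoC (s' - s) - RtoC c * (W s' - W s)) in H1 by (rewrite RtoC_minus; ring).
  pose proof (Cmod_triangle (RtoC (s' - s)) (- (RtoC (s' - s) - RtoC c * (W s' - W s)))) as T.
  replace (RtoC (s' - s) + - (RtoC (s' - s) - RtoC c * (W s' - W s)))
    with (RtoC c * (W s' - W s)) in T by ring.
  rewrite Cmod_opp, Cmod_mult, !Cmod_R, (Rabs_pos_eq c) in T by lra.
  apply Rmult_le_reg_l with (3 / 4 * c)%R; [lra|].
  replace (3 / 4 * c * (4 / (3 * c) * Rabs (s' - s)))%R with (Rabs (s' - s)) by (field; lra).
  lra. }
assert (HdW : forall s, (0 < s)%R ->
  is_derive (fun u => Re (W u)) s (Re (/ C_derive F (W s)))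
  /\ is_derive (fun u => Im (W u)) s (Im (/ C_derive F (W s)))).
{ intros s Hs; assert (Hs0 := Hsec s ltac:(lra)).
  apply (inverse_curve_derivative F W s _ (4 / (3 * c)) s).
  - apply (holomorphic_is_derive half_plane); [apply HF | apply Hsechp; exact Hs0].
  - apply Cmod_gt_0; pose proof (Hlow _ Hs0); lra.
  - apply Rdiv_lt_0_compat; lra.
  - exact Hs.
  - intros s' Hs'; apply Rabs_lt_between in Hs'; split; [|apply Hlip; lra].
    rewrite (proj2 (HWs s ltac:(lra))), (proj2 (HWs s' ltac:(lra))), RtoC_minus; ring. }
set (q := fun s => (Re (G (W s)) / (Re (F z) + s))%R).
pose proof (PF z (Hsechp z Hz)) as HFz.
(* Only s > 0 is allowed, as the two-sided derivative of W does not exist at 0; the value at z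
   itself is recovered at the end by letting s tend to 0 and using continuity of G. *)
assert (Hq : forall s S, (0 < s <= S)%R -> (q S <= q s)%R).
{ intros s S HsS.
  apply (is_derive_nonincreasing q (fun u =>
    (Re (C_derive G (W u) * (Re (/ C_derive F (W u)), Im (/ C_derive F (W u)))) * (Re (F z) + u)
      - Re (G (W u)) * 1) / (Re (F z) + u) ^ 2)%R); [lra| |].
  - intros u Hu; destruct (HdW u ltac:(lra)) as [D1 D2].
    apply (is_derive_div (fun u => Re (G (W u))) (fun u => Re (F z) + u)%R); [| |lra].
    + apply is_derive_ext with (f := fun u => Re (G (Re (W u), Im (W u)))).
      { intros v; do 2 f_equal; destruct (W v); reflexivity. }
      apply (is_derive_Re_curve (fun u => Re (W u)) (fun u => Im (W u)) G); [|exact D1|exact D2].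
      replace ((Re (W u), Im (W u)) : C) with (W u) by (destruct (W u); reflexivity).
      apply (holomorphic_is_derive half_plane); [apply HG | apply Hsechp, Hsec; lra].
    + auto_derive; [exact I | ring].
  - intros u Hu; assert (Hs0 := Hsec u ltac:(lra)).
    replace ((Re (/ C_derive F (W u)), Im (/ C_derive F (W u))) : C) with (/ C_derive F (W u))
      by (destruct (/ C_derive F (W u)); reflexivity).
    pose proof (Hcomp _ (Hsechp _ Hs0)) as H1; rewrite HReF in H1 by lra.
    pose proof (Hlow _ Hs0) as H2.
    pose proof (Re_le_Cmod (C_derive G (W u) * / C_derive F (W u))) as H3.
    rewrite Cmod_mult, Cmod_inv in H3 by (apply Cmod_gt_0; lra).
    set (dF := Cmod (C_derive F (W u))) in *; set (dG := Cmod (C_derive G (W u))) in *.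
    assert (H4 : (dG * / dF * (Re (F z) + u) <= Re (G (W u)))%R).
    { apply Rmult_le_reg_l with dF; [lra|].
      replace (dF * (dG * / dF * (Re (F z) + u)))%R with (dG * (Re (F z) + u))%R by (field; lra).
      exact H1. }
    assert (H5 : (Re (C_derive G (W u) * / C_derive F (W u)) * (Re (F z) + u)
      - Re (G (W u)) * 1 <= 0)%R) by nra.
    assert (H6 : (0 < / (Re (F z) + u) ^ 2)%R) by (apply Rinv_0_lt_compat, pow_lt; lra).
    unfold Rdiv; nra. }
assert (Hs : forall s, (0 < s)%R -> (kappa * (Re (F z) + s) <= c * Re (G (W s)))%R).
{ intros s Hs.
  pose proof (PG _ (Hsechp _ (Hsec s ltac:(lra)))) as HGs.
  apply Rle_plus_epsilon; intros e He.
  (* Chosen so that the final error Re (G (W s)) * eps is exactly e. *)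
  set (eps := (e / Re (G (W s)))%R).
  assert (Heps : (0 < eps)%R) by (apply Rdiv_lt_0_compat; assumption).
  destruct (Hasym eps Heps) as [R1 HR1].
  (* Since Re (W S) >= Re z + (2/3) S / c, this S puts W S beyond R1, where the asymptotic bound for
     Re F holds. *)
  set (S := Rmax s (2 * c * Rmax 0 R1)).
  assert (HS1 : (s <= S)%R) by apply Rmax_l.
  assert (HS2 : (2 * c * Rmax 0 R1 <= S)%R) by apply Rmax_r.
  assert (HS3 : (Rmax 0 R1 <= S / c / 2)%R).
  { apply Rmult_le_reg_l with (2 * c)%R; [lra|].
    replace (2 * c * (S / c / 2))%R with S by (field; lra); exact HS2. }
  assert (HS0 : (0 < S / c)%R) by (apply Rdiv_lt_0_compat; lra).
  assert (HWR : (R1 < Re (W S))%R).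
  { pose proof (proj1 (HWs S ltac:(lra))) as H1.
    pose proof (re_le_Cmod (W S - (z + RtoC (S / c)))) as H2.
    pose proof (Rle_trans _ _ _ H2 H1) as H3; apply Rabs_le_between in H3.
    replace (Re (W S - (z + RtoC (S / c)))) with (Re (W S) - Re z - S / c)%R in H3
      by (unfold Re; simpl; ring).
    destruct Hz as [Hz1 _]; pose proof (Rmax_r 0 R1); lra. }
  pose proof (Hsec S ltac:(lra)) as HsS.
  pose proof (HR1 (W S) (conj HWR (proj2 HsS))) as H1.
  pose proof (Hkappa _ (Hsechp _ HsS)) as H2.
  pose proof (Hq s S (conj Hs HS1)) as H3; unfold q in H3.
  rewrite HReF in H1 by lra.
  pose proof (Hsechp _ HsS) as HWp; unfold half_plane in HWp.
  set (g := Re (G (W s))) in *; set (gS := Re (G (W S))) in *.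
  set (m := (Re (F z) + s)%R) in *; set (M := (Re (F z) + S)%R) in *.
  assert (Hm : (0 < m)%R) by (unfold m; lra); assert (HM : (0 < M)%R) by (unfold M; lra).
  assert (H4 : (gS * m <= g * M)%R).
  { apply Rmult_le_compat_r with (r := (m * M)%R) in H3; [|apply Rmult_le_pos; lra].
    replace (gS / M * (m * M))%R with (gS * m)%R in H3 by (field; lra).
    replace (g / m * (m * M))%R with (g * M)%R in H3 by (field; lra); exact H3. }
  assert (H5 : (kappa * m <= g * (c + eps))%R).
  { apply Rmult_le_reg_r with (Re (W S)); [exact HWp|].
    apply Rle_trans with (gS * m)%R.
    - replace (kappa * m * Re (W S))%R with (kappa * Re (W S) * m)%R by ring.
      apply Rmult_le_compat_r; lra.
    - apply Rle_trans with (1 := H4); rewrite Rmult_assoc; apply Rmult_le_compat_l; lra. }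
  replace (g * (c + eps))%R with (c * g + e)%R in H5 by (unfold eps; field; lra).
  exact H5. }
apply Rle_plus_epsilon; intros e He.
pose proof (holomorphic_is_derive half_plane G z (proj1 HG) (Hsechp z Hz)) as HdG.
destruct (is_derive_C_continuous G z _ HdG (e / c) ltac:(apply Rdiv_lt_0_compat; assumption))
  as (del & Hdel & Hcont).
set (s := (del * c / 4)%R).
assert (Hs0 : (0 < s)%R).
{ unfold s; apply Rdiv_lt_0_compat; [apply Rmult_lt_0_compat; assumption | lra]. }
assert (Hnear : (Cmod (W s - z) < del)%R).
{ pose proof (proj1 (HWs s ltac:(lra))) as H1.
  assert (Esc : (s / c = del / 4)%R) by (unfold s; field; lra).
  rewrite Esc in H1.
  pose proof (Cmod_triangle (W s - (z + RtoC (del / 4))) (RtoC (del / 4))) as T.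
  replace (W s - (z + RtoC (del / 4)) + RtoC (del / 4)) with (W s - z) in T by ring.
  rewrite Cmod_R, Rabs_pos_eq in T by lra; lra. }
pose proof (Hcont _ Hnear) as H1.
pose proof (Hs s Hs0) as H2.
pose proof (Re_le_Cmod (G (W s) - G z)) as H3.
unfold Cminus in H3; rewrite re_plus, re_opp in H3.
change (G (W s) + - G z) with (G (W s) - G z) in H3.
assert (H4 : (c * (Re (G (W s)) - Re (G z)) <= e)%R).
{ apply Rle_trans with (c * (e / c))%R; [apply Rmult_le_compat_l; lra | right; field; lra]. }
assert (0 <= kappa * s)%R by (apply Rmult_le_pos; lra).
lra.
Qed.

(** * Topology of the triangle at 1 and non-tangential approach *)

Definition convex (V : C -> Prop) : Prop :=
  forall a b t, V a -> V b -> (0 <= t <= 1)%R -> V (a + RtoC t * (b - a)).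

(** A segment joining a point outside U1 to one outside U2 would carry a continuous function with
    values 0 and 1 only, against the intermediate value theorem. *)
Lemma convex_connected (V : C -> Prop) : convex V -> connected V.
Proof.
intros Hconv U1 U2 HU1 HU2 Hcov Hdisj.
destruct (classic (forall z, V z -> U1 z)) as [H|H]; [left; exact H|right].
apply not_all_ex_not in H; destruct H as [z1 H].
apply imply_to_and in H; destruct H as [Hz1 HnU1].
intros z0 Hz0; apply NNPP; intros HnU2.
assert (H0 : U1 z0) by (destruct (Hcov z0 Hz0); tauto).
(* [IVT_gen] wants continuity on the whole line, so the segment is prolonged by its end points. *)
set (clamp := fun t : R => Rmax 0 (Rmin 1 t)).
assert (Hclamp : forall t, (0 <= clamp t <= 1)%R).
{ intros t; unfold clamp; split; [apply Rmax_l|].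
  apply Rmax_lub; [lra | apply Rmin_l]. }
assert (Hlip : forall s t, (Rabs (clamp s - clamp t) <= Rabs (s - t))%R).
{ intros s t; unfold clamp, Rmax, Rmin, Rabs.
  repeat (destruct Rle_dec || destruct Rcase_abs); lra. }
set (p := fun t : R => z0 + RtoC (clamp t) * (z1 - z0)).
assert (Hp : forall t, V (p t)) by (intros t; apply Hconv; auto).
set (phi := fun t : R => if excluded_middle_informative (U1 (p t)) then 0%R else 1%R).
assert (Hcont : continuity phi).
{ intros t.
  assert (Hloc : exists eps, (0 < eps)%R /\
    forall w, V w -> (Cmod (w - p t) < eps)%R -> (U1 w <-> U1 (p t))).
  { destruct (Hcov (p t) (Hp t)) as [Hu|Hu].
    - destruct (proj1 (locally_C_iff _ _) (HU1 _ Hu)) as (eps & He & Hw).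
      exists eps; split; [exact He|]; intros w _ Hwe; split; auto.
    - destruct (proj1 (locally_C_iff _ _) (HU2 _ Hu)) as (eps & He & Hw).
      exists eps; split; [exact He|]; intros w HVw Hwe; split; intros Hx; exfalso.
      + apply (Hdisj w HVw); split; [exact Hx | apply Hw; exact Hwe].
      + apply (Hdisj (p t) (Hp t)); split; assumption. }
  destruct Hloc as (eps & He & Hloc).
  pose proof (Cmod_ge_0 (z1 - z0)) as Hm.
  apply continuity_pt_filterlim, filterlim_locally; intros e.
  assert (Hd : (0 < eps / (Cmod (z1 - z0) + 1))%R) by (apply Rdiv_lt_0_compat; lra).
  exists (mkposreal _ Hd); intros s Hs.
  assert (Hs' : (Rabs (s - t) < eps / (Cmod (z1 - z0) + 1))%R) by exact Hs.
  assert (Hps : (Cmod (p s - p t) < eps)%R).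
  { unfold p; replace (z0 + RtoC (clamp s) * (z1 - z0) - (z0 + RtoC (clamp t) * (z1 - z0)))
      with (RtoC (clamp s - clamp t) * (z1 - z0)) by (rewrite RtoC_minus; ring).
    rewrite Cmod_mult, Cmod_R; pose proof (Hlip s t) as H1.
    apply Rmult_lt_compat_r with (r := (Cmod (z1 - z0) + 1)%R) in Hs'; [|lra].
    replace (eps / (Cmod (z1 - z0) + 1) * (Cmod (z1 - z0) + 1))%R with eps in Hs' by (field; lra).
    apply Rle_lt_trans with (2 := Hs').
    apply Rmult_le_compat; [apply Rabs_pos | exact Hm | exact H1 | lra]. }
  specialize (Hloc (p s) (Hp s) Hps); unfold phi.
  destruct (excluded_middle_informative (U1 (p s))), (excluded_middle_informative (U1 (p t)));
    try tauto; apply ball_center. }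
assert (E0 : p 0%R = z0).
{ unfold p, clamp; rewrite Rmin_right, Rmax_left by lra; ring. }
assert (E1 : p 1%R = z1).
{ unfold p, clamp; rewrite Rmin_left, Rmax_right by lra; ring. }
assert (P0 : phi 0%R = 0%R).
{ unfold phi; destruct excluded_middle_informative as [|n]; [reflexivity|].
  rewrite E0 in n; contradiction. }
assert (P1 : phi 1%R = 1%R).
{ unfold phi; destruct excluded_middle_informative as [u|]; [|reflexivity].
  rewrite E1 in u; contradiction. }
destruct (IVT_gen phi 0 1 (/ 2) Hcont) as [x [_ Hx]].
{ rewrite P0, P1, Rmin_left, Rmax_right by lra; lra. }
unfold phi in Hx; destruct excluded_middle_informative; lra.
Qed.

(** Straight-line contraction to gamma 0; the ends stay fixed because the loop closes there. *)
Lemma convex_null_homotopic (V : C -> Prop) (gamma : R -> C) :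
  convex V -> loop_in V gamma -> null_homotopic_in V gamma.
Proof.
intros Hconv (Hcont & HV & Hloop).
assert (I0 : unit_interval 0) by (unfold unit_interval; lra).
exists (fun p => gamma (snd p) + RtoC (fst p) * (gamma 0%R - gamma (snd p))).
split; [|split; [|split]].
- intros [s t] [Hs Ht]; simpl in Hs, Ht |- *.
  apply filterlim_locally; intros eps.
  set (D := Cmod (gamma 0%R - gamma t)).
  pose proof (Cmod_ge_0 (gamma 0%R - gamma t)) as HD; fold D in HD.
  pose proof (cond_pos eps) as He.
  assert (Hg : locally (gamma t) (fun w => (Cmod (w - gamma t) < eps / 2)%R)).
  { apply locally_C_iff; exists (eps / 2)%R; split; [lra | auto]. }
  destruct (Hcont t Ht _ Hg) as [d1 Hd1].
  assert (Hd : (0 < Rmin d1 (eps / (2 * (D + 1))))%R).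
  { apply Rmin_pos; [apply cond_pos | apply Rdiv_lt_0_compat; lra]. }
  exists (mkposreal _ Hd); intros [s' t'] [Bs Bt] [Hs' Ht']; simpl in Hs', Ht' |- *.
  assert (Bs' : (Rabs (s' - s) < Rmin d1 (eps / (2 * (D + 1))))%R) by exact Bs.
  assert (Bt' : (Rabs (t' - t) < Rmin d1 (eps / (2 * (D + 1))))%R) by exact Bt.
  assert (G1 : (Cmod (gamma t' - gamma t) < eps / 2)%R).
  { apply Hd1; [|exact Ht'].
    exact (Rlt_le_trans _ _ _ Bt' (Rmin_l _ _)). }
  assert (G2 : (Rabs (s' - s) * D <= eps / 2)%R).
  { pose proof (Rlt_le_trans _ _ _ Bs' (Rmin_r _ _)) as H1.
    apply Rle_trans with (eps / (2 * (D + 1)) * (D + 1))%R; [|right; field; lra].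
    apply Rmult_le_compat; [apply Rabs_pos | exact HD | lra | lra]. }
  set (h := gamma t + RtoC s * (gamma 0%R - gamma t)).
  set (h' := gamma t' + RtoC s' * (gamma 0%R - gamma t')).
  assert (Hlt : (Cmod (h' - h) < eps)%R).
  { replace (h' - h) with
      (RtoC (1 - s') * (gamma t' - gamma t) + RtoC (s' - s) * (gamma 0%R - gamma t))
      by (unfold h, h'; rewrite !RtoC_minus; ring).
    eapply Rle_lt_trans; [apply Cmod_triangle|].
    rewrite !Cmod_mult, !Cmod_R; fold D.
    unfold unit_interval in Hs'; rewrite (Rabs_pos_eq (1 - s')) by lra.
    pose proof (Cmod_ge_0 (gamma t' - gamma t)); nra. }
  split.
  + eapply Rle_lt_trans; [apply (re_le_Cmod (h' - h)) | exact Hlt].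
  + eapply Rle_lt_trans; [apply (Im_le_Cmod (h' - h)) | exact Hlt].
- intros [s t] [Hs Ht]; simpl; apply Hconv; auto.
- intros t Ht; simpl; split; ring.
- intros s Hs; simpl; rewrite <- Hloop; split; ring.
Qed.

Lemma convex_simply_connected (V : C -> Prop) :
  open V -> convex V -> (exists z, V z) -> simply_connected_domain V.
Proof.
intros Ho Hc Hne; split.
- split; [exact Ho | split; [apply convex_connected; exact Hc | exact Hne]].
- intros gamma Hg; apply convex_null_homotopic; assumption.
Qed.

(** Convexity makes simple connectedness immediate. The slope 1/2 is narrow enough for the Cayley
    image to fall inside the sector of opening |Im| <= Re. *)
Definition triangle_at_1 (delta : R) (z : C) : Prop :=
  (Rabs (Im z) < (1 - Re z) / 2)%R /\ (1 - Re z < delta)%R.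

Lemma triangle_at_1_open (delta : R) : open (triangle_at_1 delta).
Proof.
intros z [H1 H2]; apply locally_C_iff.
exists (Rmin (((1 - Re z) / 2 - Rabs (Im z)) / 2) (delta - (1 - Re z))); split.
{ apply Rmin_pos; lra. }
intros w Hw.
assert (B1 := Rlt_le_trans _ _ _ Hw (Rmin_l _ _)).
assert (B2 := Rlt_le_trans _ _ _ Hw (Rmin_r _ _)).
pose proof (re_le_Cmod (w - z)) as R1; pose proof (Im_le_Cmod (w - z)) as R2.
unfold Cminus in R1, R2; rewrite re_plus, re_opp in R1; rewrite im_plus, im_opp in R2.
change (w + - z) with (w - z) in R1, R2.
apply Rabs_le_between in R1.
assert (R3 : (Rabs (Im w) <= Rabs (Im z) + Rabs (Im w + - Im z))%R).
{ replace (Im w) with (Im z + (Im w + - Im z))%R at 1 by ring; apply Rabs_triang. }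
split; lra.
Qed.

Lemma triangle_at_1_convex (delta : R) : convex (triangle_at_1 delta).
Proof.
intros a b t [A1 A2] [B1 B2] Ht; unfold triangle_at_1.
replace (Re (a + RtoC t * (b - a))) with ((1 - t) * Re a + t * Re b)%R by (unfold Re; simpl; ring).
replace (Im (a + RtoC t * (b - a))) with ((1 - t) * Im a + t * Im b)%R by (unfold Im; simpl; ring).
assert (P : forall x y : R, (0 < x)%R -> (0 < y)%R -> (0 < (1 - t) * x + t * y)%R).
{ intros x y Hx Hy; destruct (Rlt_le_dec t 1).
  - assert (0 < (1 - t) * x)%R by (apply Rmult_lt_0_compat; lra).
    assert (0 <= t * y)%R by (apply Rmult_le_pos; lra); lra.
  - replace t with 1%R by lra; lra. }
apply Rabs_lt_between in A1; apply Rabs_lt_between in B1.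
split; [apply Rabs_lt_between; split|].
- pose proof (P (Im a + (1 - Re a) / 2)%R (Im b + (1 - Re b) / 2)%R ltac:(lra) ltac:(lra)); lra.
- pose proof (P ((1 - Re a) / 2 - Im a)%R ((1 - Re b) / 2 - Im b)%R ltac:(lra) ltac:(lra)); lra.
- pose proof (P (delta - (1 - Re a))%R (delta - (1 - Re b))%R ltac:(lra) ltac:(lra)); lra.
Qed.

Lemma triangle_at_1_real (delta t : R) :
  (0 < t < delta)%R -> triangle_at_1 delta (RtoC (1 - t)).
Proof.
intros Ht; unfold triangle_at_1; rewrite re_RtoC, im_RtoC, Rabs_R0; lra.
Qed.

Lemma triangle_at_1_boundary (delta : R) :
  (0 < delta)%R -> boundary (triangle_at_1 delta) 1.
Proof.
intros Hd P HP; split.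
- destruct (proj1 (locally_C_iff _ _) HP) as (eps & He & H).
  set (t := (Rmin eps delta / 2)%R).
  assert (Hm : (0 < Rmin eps delta)%R) by (apply Rmin_pos; assumption).
  pose proof (Rmin_l eps delta); pose proof (Rmin_r eps delta).
  exists (RtoC (1 - t)); split.
  + apply H; rewrite <- RtoC_minus, Cmod_R.
    replace (1 - t - 1)%R with (- t)%R by ring; rewrite Rabs_Ropp, Rabs_pos_eq; unfold t; lra.
  + apply triangle_at_1_real; unfold t; lra.
- exists (RtoC 1); split; [exact (locally_singleton (T := C_UniformSpace) (RtoC 1) P HP)|].
  intros [H _]; rewrite re_RtoC, im_RtoC, Rabs_R0 in H; lra.
Qed.

Lemma triangle_at_1_disk (delta : R) (z : C) :
  (delta <= 1)%R -> triangle_at_1 delta z -> disk z.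
Proof.
intros Hd [H1 H2]; unfold disk.
assert (Hsq : (Cmod z ^ 2 < 1)%R).
{ rewrite Cmod2_alt; apply Rabs_lt_between in H1.
  assert (Im z ^ 2 <= ((1 - Re z) / 2) ^ 2)%R by nra; nra. }
pose proof (Cmod_ge_0 z); nra.
Qed.

Lemma Im_cayley (w : C) : Im (cayley w) = (2 * Im w / Cmod (1 - w) ^ 2)%R.
Proof.
rewrite Cmod2_alt; unfold cayley; destruct w as [x y]; unfold Cdiv, Cinv, Re, Im; simpl.
unfold Rdiv; ring.
Qed.

(** With a = 1 - Re z and N = |1 - z|^2 <= (5/4) a^2, the Cayley image has real part (2 a - N)/N and
    imaginary part of modulus 2 |Im z| / N < a / N. The bound a < 4/5 gives N <= a, hence the
    opening; a (R0 + 1) < 1 gives N (R0 + 1) < 2 a, hence the real part beyond R0. *)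
Lemma triangle_at_1_sector (R0 delta : R) (z : C) :
  (0 <= R0)%R -> (delta <= 4 / 5)%R -> (delta * (R0 + 1) <= 1)%R ->
  triangle_at_1 delta z -> sector R0 (cayley z).
Proof.
intros HR Hd1 Hd2 Hz.
assert (Hdz : disk z) by (apply (triangle_at_1_disk delta); [lra | exact Hz]).
pose proof (Cmod_sqr_pos _ (disk_minus_neq_0 z Hdz)) as Hn.
destruct Hz as [H1 H2].
unfold sector; rewrite Re_cayley, Im_cayley.
rewrite !Cmod2_alt in *.
replace (Re (1 - z)) with (1 - Re z)%R in * by (unfold Re; simpl; ring).
replace (Im (1 - z)) with (- Im z)%R in * by (unfold Im; simpl; ring).
set (a := (1 - Re z)%R) in *; set (y := Im z) in *.
replace (Re z) with (1 - a)%R by (unfold a; ring).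
assert (Ha : (0 < a)%R) by (pose proof (Rabs_pos y); lra).
assert (Hy : (y ^ 2 <= a ^ 2 / 4)%R).
{ rewrite <- (pow2_abs y); pose proof (Rabs_pos y); nra. }
set (N := (a ^ 2 + (- y) ^ 2)%R) in *.
assert (HN : (N <= 5 / 4 * a ^ 2)%R) by (unfold N; nra).
replace (1 - ((1 - a) ^ 2 + y ^ 2))%R with (2 * a - N)%R by (unfold N; ring).
split.
- apply Rmult_lt_reg_r with N; [exact Hn|].
  unfold Rdiv; rewrite Rmult_assoc, Rinv_l, Rmult_1_r by lra.
  assert (a * (R0 + 1) < 1)%R by nra.
  assert (N * (R0 + 1) <= 5 / 4 * a * (a * (R0 + 1)))%R by nra.
  nra.
- unfold Rdiv; rewrite Rabs_mult, (Rabs_pos_eq (/ N)) by (left; apply Rinv_0_lt_compat; exact Hn).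
  apply Rmult_le_compat_r; [left; apply Rinv_0_lt_compat; exact Hn|].
  rewrite Rabs_mult, Rabs_pos_eq by lra; nra.
Qed.

(** For t on the diameter within distance m of z, the pseudo-hyperbolic distance rho satisfies Q (1
    - rho^2) = (1 - |z|^2)(1 - t^2). With |Im z| (1 - t^2) <= 4 Q and 1 - rho^2 >= exp (- m) this
    bounds |Im z| by 4 exp m (1 - |z|^2), whence K = 8 exp m. *)
Lemma stolz_cayley (m : R) :
  exists K, (0 < K)%R /\ forall z, stolz m 1 z ->
    (Rabs (Im (cayley z)) <= K * Re (cayley z))%R.
Proof.
set (eta := exp (- m)).
assert (Heta : (0 < eta)%R) by apply exp_pos.
exists (8 / eta)%R; split; [apply Rdiv_lt_0_compat; lra|].
intros z [Hz Hst].
assert (Hex : exists t : R, (-1 < t < 1)%R /\ (hdist z (RtoC t * 1) < m)%R).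
{ apply NNPP; intros Hno.
  apply (Rbar_lt_not_le _ _ Hst).
  apply (proj2 (Glb_Rbar_correct (fun r => exists w, diameter 1 w /\ r = hdist z w))).
  intros r [w [[t [Ht ->]] ->]]; simpl; apply Rnot_lt_le; intros Hlt; apply Hno.
  exists t; split; assumption. }
destruct Hex as [t [Ht Hdist]]; rewrite Cmult_1_r in Hdist.
unfold hdist, atanh in Hdist.
assert (Hden : 1 - Cconj z * RtoC t <> 0).
{ apply disk_minus_neq_0; unfold disk in *; rewrite Cmod_mult, Cmod_conj, Cmod_R.
  pose proof (Cmod_ge_0 z); pose proof (Rabs_pos t).
  assert (Rabs t < 1)%R by (apply Rabs_lt_between; lra); nra. }
set (rho := Cmod ((z - RtoC t) / (1 - Cconj z * RtoC t))) in *.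
pose proof (Cmod_sqr_pos _ Hden) as Hq.
set (Q := (Cmod (1 - Cconj z * RtoC t) ^ 2)%R) in *.
assert (Erho : (rho ^ 2 * Q = Cmod (z - RtoC t) ^ 2)%R).
{ unfold rho, Q; rewrite Cmod_div by exact Hden; field.
  apply Rgt_not_eq, Cmod_gt_0; exact Hden. }
pose proof (disk_sqr z Hz) as Hzs.
assert (Hid : (Q - Cmod (z - RtoC t) ^ 2 = (1 - (Re z ^ 2 + Im z ^ 2)) * (1 - t ^ 2))%R).
{ unfold Q; rewrite !Cmod2_alt; unfold Re, Im; simpl; ring. }
assert (Ht2 : (0 < 1 - t ^ 2)%R) by nra.
assert (Hid2 : (Q * (1 - rho ^ 2) = (1 - (Re z ^ 2 + Im z ^ 2)) * (1 - t ^ 2))%R) by lra.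
assert (Hrho0 : (0 <= rho)%R) by apply Cmod_ge_0.
(* Needed before the logarithm in [hdist] can be inverted, since [ln] is total. *)
assert (Hrho1 : (rho < 1)%R).
{ apply Rnot_le_lt; intros Hle.
  assert (0 < (1 - (Re z ^ 2 + Im z ^ 2)) * (1 - t ^ 2))%R by (apply Rmult_lt_0_compat; lra).
  assert (1 - rho ^ 2 <= 0)%R by nra.
  assert (0 <= Q * - (1 - rho ^ 2))%R by (apply Rmult_le_pos; lra).
  lra. }
assert (Hrho2 : (eta <= 1 - rho ^ 2)%R).
{ assert (Hlt : (ln ((1 + rho) / (1 - rho)) < m)%R) by lra.
  assert (Hp : (0 < (1 + rho) / (1 - rho))%R) by (apply Rdiv_lt_0_compat; lra).
  apply exp_increasing in Hlt; rewrite exp_ln in Hlt by exact Hp.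
  assert (Hem : (exp m * eta = 1)%R)
    by (unfold eta; rewrite <- exp_plus, Rplus_opp_r, exp_0; reflexivity).
  apply Rmult_lt_compat_r with (r := (1 - rho)%R) in Hlt; [|lra].
  replace ((1 + rho) / (1 - rho) * (1 - rho))%R with (1 + rho)%R in Hlt by (field; lra).
  apply Rmult_lt_compat_r with (r := eta) in Hlt; [|exact Heta].
  replace (exp m * (1 - rho) * eta)%R with (exp m * eta * (1 - rho))%R in Hlt by ring.
  rewrite Hem in Hlt; nra. }
assert (HQ : (Rabs (Im z) * (1 - t ^ 2) <= 4 * Q)%R).
{ unfold Q; rewrite Cmod2_alt.
  replace (Re (1 - Cconj z * RtoC t)) with (1 - Re z * t)%R by (unfold Re; simpl; ring).
  replace (Im (1 - Cconj z * RtoC t)) with (Im z * t)%R by (unfold Im; simpl; ring).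
  assert (Hx : (Rabs (Re z) < 1)%R).
  { apply Rle_lt_trans with (1 := re_le_Cmod z); exact Hz. }
  assert (Hy : (Rabs (Im z) < 1)%R).
  { apply Rle_lt_trans with (1 := Im_le_Cmod z); exact Hz. }
  pose proof (Rabs_pos (Im z)) as Hy0; pose proof (Rabs_pos t) as Ht0.
  assert (Hxt : (1 - Rabs t <= 1 - Re z * t)%R).
  { pose proof (Rle_abs (Re z * t)) as H1; rewrite Rabs_mult in H1; nra. }
  replace ((Im z * t) ^ 2)%R with ((Rabs (Im z) * Rabs t) ^ 2)%R
    by (rewrite Rpow_mult_distr, !pow2_abs; ring).
  replace (t ^ 2)%R with (Rabs t ^ 2)%R in * by apply pow2_abs.
  set (y := Rabs (Im z)) in *; set (s := Rabs t) in *; set (x := (1 - Re z * t)%R) in *.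
  assert (Hs1 : (s < 1)%R) by (unfold s; apply Rabs_lt_between; lra).
  (* For |t| >= 1/2, Q >= 2 x y s by the square of a difference, and x >= 1 - s. For |t| < 1/2,
     already x^2 >= 1/4. *)
  destruct (Rle_dec (/ 2) s) as [Hs|Hs].
  - assert (2 * (x * (y * s)) <= x ^ 2 + (y * s) ^ 2)%R by (pose proof (pow2_ge_0 (x - y * s)); lra).
    assert (y * (1 - s) * s <= x * y * s)%R.
    { apply Rmult_le_compat_r; [lra|]; rewrite (Rmult_comm x); apply Rmult_le_compat_l; lra. }
    assert (0 <= y * (1 - s))%R by (apply Rmult_le_pos; lra).
    nra.
  - assert (1 / 4 <= x ^ 2)%R by nra.
    assert (y * (1 - s ^ 2) <= 1)%R by nra.
    pose proof (pow2_ge_0 (y * s)); lra. }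
rewrite Re_cayley, Im_cayley.
pose proof (Cmod_sqr_pos _ (disk_minus_neq_0 z Hz)) as Hn.
assert (Hfin : (eta * Rabs (Im z) <= 4 * (1 - Cmod z ^ 2))%R).
{ rewrite Cmod2_alt; apply Rmult_le_reg_r with (1 - t ^ 2)%R; [exact Ht2|].
  apply Rle_trans with (4 * (eta * Q))%R; [nra|].
  rewrite Rmult_assoc, <- Hid2; nra. }
unfold Rdiv; rewrite !Rabs_mult, (Rabs_pos_eq 2), (Rabs_pos_eq (/ _))
  by (lra || (left; apply Rinv_0_lt_compat; exact Hn)).
rewrite <- !Rmult_assoc; apply Rmult_le_compat_r; [left; apply Rinv_0_lt_compat; exact Hn|].
apply Rmult_le_reg_l with eta; [exact Heta|].
replace (eta * (8 * / eta * (1 - Cmod z ^ 2)))%R with (8 * (1 - Cmod z ^ 2))%R by (field; lra).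
lra.
Qed.

Lemma stolz_real (m t : R) : (0 < m)%R -> (-1 < t < 1)%R -> stolz m 1 (RtoC t).
Proof.
intros Hm Ht; split.
- unfold disk; rewrite Cmod_R; apply Rabs_lt_between; lra.
- apply Rbar_le_lt_trans with 0%R; [|exact Hm].
  apply (proj1 (Glb_Rbar_correct (fun r => exists w, diameter 1 w /\ r = hdist (RtoC t) w))).
  exists (RtoC t * 1); split; [exists t; auto|].
  unfold hdist, atanh; rewrite Cmult_1_r.
  replace (RtoC t - RtoC t) with (RtoC 0) by ring.
  unfold Cdiv; rewrite Cmult_0_l, Cmod_0, Rplus_0_r, Rminus_0_r.
  unfold Rdiv; rewrite Rinv_1, Rmult_1_r, ln_1; ring.
Qed.

(** * Boundary limits and the theorem *)

Lemma sectorial_limit_Re (F : C -> C) (c K : R) (z : nat -> C) :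
  sectorial_limit F c -> (0 < K)%R ->
  (forall n, half_plane (z n)) -> is_lim_seq (fun n => Re (z n)) p_infty ->
  eventually (fun n => (Rabs (Im (z n)) <= K * Re (z n))%R) ->
  is_lim_seq (fun n => (Re (F (z n)) / Re (z n))%R) c.
Proof.
intros HF HK Hz Hinf Hsec; apply is_lim_seq_spec; intros eps.
destruct (HF K (eps / 2)%R HK (is_pos_div_2 eps)) as (R0 & HR0 & H).
apply is_lim_seq_spec in Hinf.
generalize (filter_and _ _ (Hinf R0) Hsec); apply filter_imp; intros n [H1 H2].
destruct (H (z n) H1 H2) as [H3 _].
assert (Hp : (0 < Re (z n))%R) by apply Hz.
pose proof (re_le_Cmod (F (z n) - RtoC c * z n)) as H4.
unfold Cminus in H4; rewrite re_plus, re_opp, re_scal_l in H4.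
change (F (z n) + - (RtoC c * z n)) with (F (z n) - RtoC c * z n) in H4.
replace (Re (F (z n)) / Re (z n) - c)%R
  with ((Re (F (z n)) + - (c * Re (z n))) / Re (z n))%R by (field; lra).
unfold Rdiv; rewrite Rabs_mult, (Rabs_pos_eq (/ _)) by (left; apply Rinv_0_lt_compat; exact Hp).
pose proof (cond_pos eps) as He.
apply Rmult_lt_reg_r with (Re (z n)); [exact Hp|].
rewrite Rmult_assoc, Rinv_l, Rmult_1_r by lra; nra.
Qed.

(** The shifts by 1 come from |1 - w| = 2 / |cayley w + 1|: for a lift of g this is the limit of |1
    - z_n| / |1 - g(z_n)|. *)
Lemma sectorial_limit_Cmod (F : C -> C) (c K : R) (z : nat -> C) :
  sectorial_limit F c -> (0 <= c)%R -> (0 < K)%R ->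
  (forall n, half_plane (z n)) -> is_lim_seq (fun n => Re (z n)) p_infty ->
  eventually (fun n => (Rabs (Im (z n)) <= K * Re (z n))%R) ->
  is_lim_seq (fun n => (Cmod (F (z n) + 1) / Cmod (z n + 1))%R) c.
Proof.
intros HF Hc HK Hz Hinf Hsec; apply is_lim_seq_spec; intros eps.
destruct (HF K (eps / 2)%R HK (is_pos_div_2 eps)) as (R0 & HR0 & H).
apply is_lim_seq_spec in Hinf.
pose proof (cond_pos eps) as He.
generalize (filter_and _ _ (filter_and _ _ (Hinf R0) (Hinf (2 * (1 + c) / eps)%R)) Hsec).
apply filter_imp; intros n [[H1 H0] H2].
destruct (H (z n) H1 H2) as [H3 _].
assert (Hp : (0 < Re (z n))%R) by apply Hz.
assert (Hz1 : (Re (z n) < Cmod (z n + 1))%R).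
{ pose proof (Re_le_Cmod (z n + 1)) as H4; rewrite re_plus, re_RtoC in H4; lra. }
assert (H5 : (Rabs (Cmod (F (z n) + 1) - c * Cmod (z n + 1))
  <= Cmod (F (z n) + 1 - RtoC c * (z n + 1)))%R).
{ replace (c * Cmod (z n + 1))%R with (Cmod (RtoC c * (z n + 1)))
    by (rewrite Cmod_mult, Cmod_R, Rabs_pos_eq; lra).
  apply Rabs_le; split.
  - pose proof (Cmod_triangle (F (z n) + 1) (- (F (z n) + 1 - RtoC c * (z n + 1)))) as T.
    replace (F (z n) + 1 + - (F (z n) + 1 - RtoC c * (z n + 1)))
      with (RtoC c * (z n + 1)) in T by ring.
    rewrite Cmod_opp in T; lra.
  - pose proof (Cmod_triangle (RtoC c * (z n + 1)) (F (z n) + 1 - RtoC c * (z n + 1))) as T.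
    replace (RtoC c * (z n + 1) + (F (z n) + 1 - RtoC c * (z n + 1)))
      with (F (z n) + 1) in T by ring; lra. }
assert (H6 : (Cmod (F (z n) + 1 - RtoC c * (z n + 1)) <= eps / 2 * Re (z n) + (1 + c))%R).
{ replace (F (z n) + 1 - RtoC c * (z n + 1)) with (F (z n) - RtoC c * z n + RtoC (1 - c))
    by (rewrite RtoC_minus; ring).
  eapply Rle_trans; [apply Cmod_triangle|]; rewrite Cmod_R.
  assert (Rabs (1 - c) <= 1 + c)%R by (apply Rabs_le; lra); lra. }
assert (H7 : (1 + c < eps / 2 * Re (z n))%R).
{ apply Rmult_lt_compat_r with (r := (eps / 2)%R) in H0; [|lra].
  replace (2 * (1 + c) / eps * (eps / 2))%R with (1 + c)%R in H0 by (field; lra); lra. }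
replace (Cmod (F (z n) + 1) / Cmod (z n + 1) - c)%R
  with ((Cmod (F (z n) + 1) - c * Cmod (z n + 1)) / Cmod (z n + 1))%R by (field; lra).
unfold Rdiv; rewrite Rabs_mult, (Rabs_pos_eq (/ _)) by (left; apply Rinv_0_lt_compat; lra).
apply Rmult_lt_reg_r with (Cmod (z n + 1)); [lra|].
rewrite Rmult_assoc, Rinv_l, Rmult_1_r by lra; nra.
Qed.

(** Convergence to 1 only makes the modulus of the Cayley image tend to infinity; the sector bound
    on the imaginary part passes this on to the real part. *)
Lemma nontangential_cayley (z : nat -> C) :
  (forall n, disk (z n)) -> nontangential z 1 ->
  is_lim_seq (fun n => Re (cayley (z n))) p_infty
  /\ exists K, (0 < K)%R /\
       eventually (fun n => (Rabs (Im (cayley (z n))) <= K * Re (cayley (z n)))%R).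
Proof.
intros Hz [Hlim [m [Hm Hst]]].
destruct (stolz_cayley m) as [K [HK HKs]].
assert (Hsec : eventually (fun n => (Rabs (Im (cayley (z n))) <= K * Re (cayley (z n)))%R)).
{ revert Hst; apply filter_imp; intros n; apply HKs. }
split; [|exists K; split; assumption].
apply is_lim_seq_spec; intros M.
set (d := (2 / ((1 + K) * (Rabs M + 1) + 1))%R).
assert (Hd0 : (0 < (1 + K) * (Rabs M + 1) + 1)%R) by (pose proof (Rabs_pos M); nra).
assert (Hd : (0 < d)%R) by (apply Rdiv_lt_0_compat; lra).
assert (Hnear : eventually (fun n => (Cmod (z n - 1) < d)%R)).
{ apply filterlim_C_seq; assumption. }
generalize (filter_and _ _ Hnear Hsec); apply filter_imp; intros n [H1 H2].
pose proof (cayley_half_plane _ (Hz n)) as Hp; unfold half_plane in Hp.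
pose proof (disk_minus_neq_0 _ (Hz n)) as Hn.
pose proof (f_equal Cmod (cayley_plus_1 _ Hn)) as E.
rewrite Cmod_div, Cmod_R, Rabs_pos_eq in E by (assumption || lra).
rewrite Cmod_minus_sym in H1.
pose proof (proj1 (Cmod_gt_0 _) Hn) as Hn'.
assert (H3 : ((1 + K) * (Rabs M + 1) + 1 < Cmod (cayley (z n) + 1))%R).
{ rewrite E; apply Rmult_lt_reg_r with (Cmod (1 - z n)); [exact Hn'|].
  unfold Rdiv; rewrite Rmult_assoc, Rinv_l, Rmult_1_r by lra.
  apply Rmult_lt_compat_l with (r := ((1 + K) * (Rabs M + 1) + 1)%R) in H1; [|exact Hd0].
  replace (((1 + K) * (Rabs M + 1) + 1) * d)%R with 2%R in H1 by (unfold d; field; lra).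
  exact H1. }
pose proof (Cmod_le_Rabs (cayley (z n) + 1)) as H4.
rewrite re_plus, im_plus, re_RtoC, im_RtoC, Rplus_0_r, (Rabs_pos_eq (Re _ + 1)) in H4 by lra.
assert (H5 : ((1 + K) * (Rabs M + 1) < (1 + K) * Re (cayley (z n)))%R) by lra.
apply Rmult_lt_reg_l in H5; [|lra].
pose proof (Rle_abs M); lra.
Qed.

Lemma half_plane_lift_cayley (f : C -> C) (w : C) :
  disk w -> half_plane_lift f (cayley w) = cayley (f w).
Proof. intros Hw; unfold half_plane_lift; rewrite cayley_inv_cayley by exact Hw; reflexivity. Qed.

Lemma Cmod_one_minus (w : C) : disk w -> Cmod (1 - w) = (2 / Cmod (cayley w + 1))%R.
Proof.
intros Hw; pose proof (disk_minus_neq_0 w Hw) as H.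
rewrite cayley_plus_1, Cmod_div, Cmod_R, Rabs_pos_eq by (assumption || lra).
pose proof (proj1 (Cmod_gt_0 _) H); field; lra.
Qed.

(** If c were 0, the lift would be o(x) on the real axis, against its linear lower bound. The
    constant alpha + 1 is the liminf condition with eps = 1. *)
Lemma positive_angular_derivative (B : C -> C) (alpha c : R) :
  holomorphic_self_map B -> (0 < alpha)%R ->
  is_LimInf (within disk (locally (1 : C)))
    (fun z => (1 - Cmod (B z)) / (1 - Cmod z))%R alpha ->
  angular_limit B 1 1 ->
  (0 <= c)%R -> sectorial_limit (half_plane_lift B) c -> (0 < c)%R.
Proof.
intros HB Halpha Hinf Hang Hc Hsec.
assert (Hclose : forall delta, (0 < delta)%R -> exists z, disk z /\ (Cmod (z - 1) < delta)%R
     /\ (1 - Cmod (B z) <= (alpha + 1) * (1 - Cmod z))%R).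
{ intros delta Hd.
  destruct (Hinf (mkposreal 1 Rlt_0_1)) as [H _].
  destruct (H (fun z => disk z /\ (Cmod (z - 1) < delta)%R)) as [z [[Hz Hz1] Hz2]].
  - apply locally_C_iff; exists delta; split; [exact Hd|]; intros w Hw Hdw; split; assumption.
  - exists z; split; [exact Hz | split; [exact Hz1|]]; simpl in Hz2; unfold disk in Hz.
    apply Rmult_lt_compat_r with (r := (1 - Cmod z)%R) in Hz2; [|lra].
    unfold Rdiv in Hz2; rewrite Rmult_assoc, Rinv_l in Hz2 by lra; lra. }
assert (Hrad : forall t : R, (0 <= t < 1)%R ->
  (1 - Cmod (B (RtoC t)) <= 4 * (alpha + 1) * (1 - t))%R).
{ apply radial_bound; [exact HB | lra | exact Hclose]. }
assert (Hlim : forall eps, (0 < eps)%R -> exists t0, (0 <= t0 < 1)%R /\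
     forall t, (t0 <= t < 1)%R -> (Cmod (B (RtoC t) - 1) < eps)%R).
{ intros eps He.
  assert (Hl : locally (1 : C) (fun w => (Cmod (w - 1) < eps)%R)).
  { apply locally_C_iff; exists eps; split; [exact He | auto]. }
  destruct (proj1 (locally_C_iff _ _) (Hang 1%R Rlt_0_1 _ Hl)) as (d & Hd & H).
  exists (Rmax 0 (1 - d / 2)); split.
  - split; [apply Rmax_l | apply Rmax_lub_lt; lra].
  - intros t Ht; pose proof (Rmax_l 0 (1 - d / 2)); pose proof (Rmax_r 0 (1 - d / 2)).
    apply H; [|apply stolz_real; lra].
    rewrite <- RtoC_minus, Cmod_R, Rabs_left1 by lra; lra. }
destruct (half_plane_lift_linear_growth B (4 * (alpha + 1)) HB ltac:(lra) Hrad Hlim)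
  as (x1 & Hx1 & Hgrow).
destruct (Rle_lt_or_eq_dec 0 c Hc) as [H|E]; [exact H|exfalso].
set (M := (4 * (4 * (alpha + 1)))%R) in *.
assert (HM : (0 < M)%R) by (unfold M; lra).
destruct (Hsec 1%R (/ (2 * M))%R Rlt_0_1 ltac:(apply Rinv_0_lt_compat; lra)) as (R0 & HR0 & HS).
set (x := (x1 + R0)%R).
destruct (HS (RtoC x)) as [H1 _].
{ rewrite re_RtoC; unfold x; lra. }
{ rewrite re_RtoC, im_RtoC, Rabs_R0; unfold x; lra. }
pose proof (Hgrow x ltac:(unfold x; lra)) as H2.
rewrite <- E, re_RtoC in H1.
replace (half_plane_lift B (RtoC x) - 0 * RtoC x) with (half_plane_lift B (RtoC x)) in H1 by ring.
assert (Hx : (0 < x)%R) by (unfold x; lra).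
apply Rmult_le_compat_l with (r := M) in H1; [|lra].
replace (M * (/ (2 * M) * x))%R with (x / 2)%R in H1 by (field; lra); lra.
Qed.

Lemma sectorial_julia (f B : C -> C) (kappa c : R) :
  holomorphic_self_map f -> holomorphic_self_map B ->
  (forall z, disk z -> (hyp_derivative f z <= hyp_derivative B z)%R) ->
  (0 < c)%R -> (0 < kappa)%R ->
  (forall z, half_plane z -> (kappa * Re z <= Re (half_plane_lift f z))%R) ->
  sectorial_limit (half_plane_lift B) c ->
  exists V : C -> Prop,
    simply_connected_domain V /\ (forall z, V z -> disk z) /\ boundary V 1
    /\ forall v, V v ->
         (Cmod (1 - f v) ^ 2 / (1 - Cmod (f v) ^ 2)
          <= c / kappa * (Cmod (1 - B v) ^ 2 / (1 - Cmod (B v) ^ 2)))%R.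
Proof.
intros Hf HB Hhyp Hc Hk Hjulia Hsec.
destruct (Hsec 1%R (c / 4)%R Rlt_0_1 ltac:(lra)) as (R0 & HR0 & HS).
(* The two bounds required by [triangle_at_1_sector], with R0 taken where F' is within c/4 of c. *)
set (delta := Rmin (4 / 5) (/ (R0 + 1))).
assert (Hd0 : (0 < delta)%R) by (apply Rmin_pos; [lra | apply Rinv_0_lt_compat; lra]).
assert (Hd1 : (delta <= 4 / 5)%R) by apply Rmin_l.
assert (Hd2 : (delta * (R0 + 1) <= 1)%R).
{ apply Rle_trans with (/ (R0 + 1) * (R0 + 1))%R; [|rewrite Rinv_l; lra].
  apply Rmult_le_compat_r; [lra | apply Rmin_r]. }
exists (triangle_at_1 delta); split; [|split; [|split]].
- apply convex_simply_connected; [apply triangle_at_1_open | apply triangle_at_1_convex|].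
  exists (RtoC (1 - delta / 2)); apply triangle_at_1_real; lra.
- intros z Hz; apply (triangle_at_1_disk delta); [lra | exact Hz].
- apply triangle_at_1_boundary; exact Hd0.
- intros v Hv.
  assert (Hdv : disk v) by (apply (triangle_at_1_disk delta); [lra | exact Hv]).
  assert (Hcmp : (kappa * Re (half_plane_lift B (cayley v))
                  <= c * Re (half_plane_lift f (cayley v)))%R).
  { apply (real_part_comparison (half_plane_lift B) (half_plane_lift f) c kappa R0).
    - apply half_plane_lift_map; exact HB.
    - apply half_plane_lift_map; exact Hf.
    - intros z Hz; apply half_plane_lift_pos; assumption.
    - intros z Hz; apply half_plane_lift_pos; assumption.
    - intros z Hz; apply hyp_derivative_half_plane_lift_le; try assumption.
      apply Hhyp, cayley_inv_disk; exact Hz.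
    - exact Hc.
    - lra.
    - lra.
    - exact Hjulia.
    - intros z [Hz1 Hz2]; apply HS; lra.
    - intros eps He; destruct (Hsec 1%R eps Rlt_0_1 He) as (R1 & _ & H1).
      exists R1; intros z [Hz1 Hz2]; destruct (H1 z Hz1 ltac:(lra)) as [H2 _].
      pose proof (Re_le_Cmod (half_plane_lift B z - RtoC c * z)) as H3.
      unfold Cminus in H3; rewrite re_plus, re_opp, re_scal_l in H3.
      change (half_plane_lift B z + - (RtoC c * z)) with (half_plane_lift B z - RtoC c * z) in H3.
      lra.
    - apply (triangle_at_1_sector R0 delta); (assumption || lra). }
  rewrite !half_plane_lift_cayley, !Re_cayley in Hcmp by exact Hdv.
  pose proof (Cmod_sqr_pos _ (disk_minus_neq_0 _ (proj2 Hf v Hdv))) as P1.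
  pose proof (Cmod_sqr_pos _ (disk_minus_neq_0 _ (proj2 HB v Hdv))) as P2.
  assert (D1 : (0 < 1 - Cmod (f v) ^ 2)%R).
  { rewrite Cmod2_alt; pose proof (disk_sqr _ (proj2 Hf v Hdv)); lra. }
  assert (D2 : (0 < 1 - Cmod (B v) ^ 2)%R).
  { rewrite Cmod2_alt; pose proof (disk_sqr _ (proj2 HB v Hdv)); lra. }
  set (a := (Cmod (1 - f v) ^ 2)%R) in *; set (b := (Cmod (1 - B v) ^ 2)%R) in *.
  set (x := (1 - Cmod (f v) ^ 2)%R) in *; set (y := (1 - Cmod (B v) ^ 2)%R) in *.
  assert (Hm : (0 < kappa * (x / a) * (y / b))%R).
  { repeat apply Rmult_lt_0_compat; try apply Rinv_0_lt_compat; assumption. }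
  apply Rmult_le_reg_l with (1 := Hm).
  replace (kappa * (x / a) * (y / b) * (a / x))%R with (kappa * (y / b))%R by (field; lra).
  replace (kappa * (x / a) * (y / b) * (c / kappa * (b / y)))%R with (c * (x / a))%R
    by (field; lra).
  exact Hcmp.
Qed.

Theorem lemma4p1 (f B : C -> C) (alpha : R) (zn : nat -> C)
    (Hf : holomorphic_self_map f)
    (HB : maximal_blaschke_product f B)
    (Halpha : is_LimInf (within disk (locally (1 : C)))
                (fun z => (1 - Cmod (B z)) / (1 - Cmod z))%R alpha)
    (Halpha0 : (0 < alpha)%R)
    (HB1 : angular_limit B 1 1)
    (Hzn : forall n, disk (zn n))
    (Hnt : nontangential zn 1)
    (HO : bigO (fun n => f (zn n) - B (zn n)) (fun n => 1 - zn n)) :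
  exists A : R,
    is_lim_seq (fun n => (1 - Cmod (f (zn n))) / (1 - Cmod (B (zn n))))%R A
    /\ (0 < A)%R
    /\ (exists V : C -> Prop,
          simply_connected_domain V
          /\ (forall z, V z -> disk z)
          /\ boundary V 1
          /\ forall v, V v ->
               (Cmod (1 - f v) ^ 2 / (1 - Cmod (f v) ^ 2)
                <= A * (Cmod (1 - B v) ^ 2 / (1 - Cmod (B v) ^ 2)))%R)
    /\ (littleo (fun n => f (zn n) - B (zn n)) (fun n => 1 - zn n) -> A = 1%R).
Proof.
destruct HB as (HBm & _ & Hcrit & Hmax).
destruct (angular_derivative_at_infinity _ (half_plane_lift_map B HBm))
  as (c & Hc0 & _ & HsecB).
assert (Hc : (0 < c)%R) by (apply (positive_angular_derivative B alpha); assumption).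
destruct (angular_derivative_at_infinity _ (half_plane_lift_map f Hf))
  as (kappa & Hk0 & Hjulia & Hsecf).
destruct (nontangential_cayley zn Hzn Hnt) as (Hinf & K & HK & HKsec).
assert (Hzh : forall n, half_plane (cayley (zn n))) by (intros n; apply cayley_half_plane, Hzn).
set (D := fun n => Cmod (1 - zn n)).
assert (HD : forall n, (0 < D n)%R)
  by (intros n; apply Cmod_gt_0, disk_minus_neq_0, Hzn).
(* Both asymptotics of the lift read in the disk; the second expression is Re of the lift divided by
   Re of [cayley (zn n)]. *)
assert (Hratio : forall (g : C -> C) (k : R), holomorphic_self_map g ->
  sectorial_limit (half_plane_lift g) k -> (0 <= k)%R ->
  is_lim_seq (fun n => (D n / Cmod (1 - g (zn n)))%R) k
  /\ is_lim_seq (fun n =>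
       ((1 - Cmod (g (zn n)) ^ 2) / (1 - Cmod (zn n) ^ 2) * (D n / Cmod (1 - g (zn n))) ^ 2)%R) k).
{ intros g k Hg Hs Hk.
  pose proof (sectorial_limit_Re _ _ _ _ Hs HK Hzh Hinf HKsec) as L1.
  pose proof (sectorial_limit_Cmod _ _ _ _ Hs Hk HK Hzh Hinf HKsec) as L2.
  split.
  - revert L2; apply is_lim_seq_ext; intros n.
    rewrite half_plane_lift_cayley by apply Hzn; unfold D.
    rewrite !Cmod_one_minus by (try apply (proj2 Hg); apply Hzn).
    assert (P1 : (0 < Cmod (cayley (zn n) + 1))%R)
      by (apply Cmod_gt_0, half_plane_plus_1_neq_0, Hzh).
    assert (P2 : (0 < Cmod (cayley (g (zn n)) + 1))%R)
      by (apply Cmod_gt_0, half_plane_plus_1_neq_0, cayley_half_plane, Hg, Hzn).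
    field; split; lra.
  - revert L1; apply is_lim_seq_ext; intros n.
    rewrite half_plane_lift_cayley by apply Hzn; rewrite !Re_cayley; unfold D.
    pose proof (proj1 (Cmod_gt_0 _) (disk_minus_neq_0 _ (Hzn n))) as P1.
    pose proof (proj1 (Cmod_gt_0 _) (disk_minus_neq_0 _ (proj2 Hg _ (Hzn n)))) as P2.
    pose proof (disk_sqr _ (Hzn n)) as P3; rewrite <- Cmod2_alt in P3.
    field; repeat split; apply Rgt_not_eq; (assumption || lra). }
destruct (Hratio B c HBm HsecB Hc0) as [LB1 LB2].
destruct (Hratio f kappa Hf Hsecf Hk0) as [Lf1 Lf2].
set (rB := fun n => (D n / Cmod (1 - B (zn n)))%R) in *.
set (rf := fun n => (D n / Cmod (1 - f (zn n)))%R) in *.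
assert (PB : forall n, (0 < Cmod (1 - B (zn n)))%R)
  by (intros n; apply Cmod_gt_0, disk_minus_neq_0, HBm, Hzn).
assert (Pf : forall n, (0 < Cmod (1 - f (zn n)))%R)
  by (intros n; apply Cmod_gt_0, disk_minus_neq_0, Hf, Hzn).
assert (PrB : forall n, (0 < rB n)%R) by (intros n; apply Rdiv_lt_0_compat; auto).
assert (Prf : forall n, (0 < rf n)%R) by (intros n; apply Rdiv_lt_0_compat; auto).
assert (LBinv : is_lim_seq (fun n => / rB n)%R (/ c)%R).
{ apply (is_lim_seq_inv rB c LB1); intros E; injection E; lra. }
assert (Hk : (0 < kappa)%R).
{ destruct HO as [M HM].
  (* Dividing |1 - f| <= |1 - B| + M |1 - z| by |1 - f| and passing to the limit along z_n; kappa =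
     0 would give 1 <= 0. *)
  assert (Hle : Rbar_le 1%R (kappa * (/ c + M))%R).
  { apply (is_lim_seq_le_loc (fun _ => 1%R) (fun n => rf n * (/ rB n + M))%R).
    - revert HM; apply filter_imp; intros n Hn.
      pose proof (Cmod_triangle (1 - B (zn n)) (- (f (zn n) - B (zn n)))) as T.
      replace (1 - B (zn n) + - (f (zn n) - B (zn n))) with (1 - f (zn n)) in T by ring.
      rewrite Cmod_opp in T; fold (D n) in Hn.
      assert (H1 : (Cmod (1 - f (zn n)) <= Cmod (1 - B (zn n)) + M * D n)%R) by lra.
      replace (rf n * (/ rB n + M))%R
        with ((Cmod (1 - B (zn n)) + M * D n) / Cmod (1 - f (zn n)))%R.
      + apply Rmult_le_reg_r with (Cmod (1 - f (zn n))); [apply Pf|].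
        unfold Rdiv; rewrite Rmult_assoc, Rinv_l by (apply Rgt_not_eq, Pf); lra.
      + unfold rf, rB; pose proof (HD n); pose proof (PB n); pose proof (Pf n).
        field; repeat split; lra.
    - apply is_lim_seq_const.
    - apply is_lim_seq_mult'; [exact Lf1|].
      apply is_lim_seq_plus'; [exact LBinv | apply is_lim_seq_const]. }
  destruct (Rle_lt_or_eq_dec 0 kappa Hk0) as [H|E]; [exact H|].
  simpl in Hle; rewrite <- E in Hle; lra. }
assert (Lfinv : is_lim_seq (fun n => / rf n)%R (/ kappa)%R).
{ apply (is_lim_seq_inv rf kappa Lf1); intros E; injection E; lra. }
assert (LD : is_lim_seq D 0%R).
{ apply is_lim_seq_spec; intros eps.
  destruct (filterlim_C_seq zn 1 eps (proj1 Hnt) (cond_pos eps)) as [N HN].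
  exists N; intros n Hn; rewrite Rminus_0_r, Rabs_pos_eq by (left; apply HD).
  unfold D; rewrite Cmod_minus_sym; apply HN; exact Hn. }
(* The limits are known for 1 - |g|^2; the factor 1 + |g|, which tends to 2, converts them to 1 -
   |g|. *)
assert (Lmod : forall (g : C -> C) (r : nat -> R) (l : R),
  (forall n, Cmod (1 - g (zn n)) = (D n * / r n)%R) -> is_lim_seq (fun n => / r n)%R l ->
  is_lim_seq (fun n => 1 + Cmod (g (zn n)))%R 2%R).
{ intros g r l Hg Hl.
  assert (H0 : is_lim_seq (fun n => Cmod (1 - g (zn n))) 0%R).
  { apply is_lim_seq_ext with (fun n => D n * / r n)%R; [intros n; symmetry; apply Hg|].
    replace 0%R with (0 * l)%R by ring; apply is_lim_seq_mult'; assumption. }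
  apply is_lim_seq_spec in H0; apply is_lim_seq_spec; intros eps.
  generalize (H0 eps); apply filter_imp; intros n Hn.
  rewrite Rminus_0_r, Rabs_pos_eq in Hn by apply Cmod_ge_0.
  apply Rle_lt_trans with (2 := Hn).
  pose proof (Cmod_triangle (1 - g (zn n)) (g (zn n))) as T1.
  replace (1 - g (zn n) + g (zn n)) with (RtoC 1) in T1 by ring.
  pose proof (Cmod_triangle 1 (- (1 - g (zn n)))) as T2.
  replace (1 + - (1 - g (zn n))) with (g (zn n)) in T2 by ring.
  rewrite Cmod_opp in T2; rewrite Cmod_1 in T1, T2.
  apply Rabs_le; lra. }
assert (EB : forall n, Cmod (1 - B (zn n)) = (D n * / rB n)%R).
{ intros n; unfold rB; specialize (HD n); specialize (PB n); field; split; lra. }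
assert (Ef : forall n, Cmod (1 - f (zn n)) = (D n * / rf n)%R).
{ intros n; unfold rf; specialize (HD n); specialize (Pf n); field; split; lra. }
pose proof (Lmod B rB (/ c)%R EB LBinv) as MB.
pose proof (Lmod f rf (/ kappa)%R Ef Lfinv) as Mf.
exists (c / kappa)%R; split; [|split; [|split]].
- set (uB := fun n => ((1 - Cmod (B (zn n)) ^ 2) / (1 - Cmod (zn n) ^ 2) * rB n ^ 2)%R) in *.
  set (uf := fun n => ((1 - Cmod (f (zn n)) ^ 2) / (1 - Cmod (zn n) ^ 2) * rf n ^ 2)%R) in *.
  (* The three factors tend to kappa / c, (c / kappa)^2 and 1. *)
  apply is_lim_seq_ext with (fun n =>
    uf n / uB n * (rB n * / rf n * (rB n * / rf n))
      * ((1 + Cmod (B (zn n))) / (1 + Cmod (f (zn n)))))%R.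
  + intros n; unfold uf, uB.
    pose proof (proj2 Hf _ (Hzn n)) as Q1; pose proof (proj2 HBm _ (Hzn n)) as Q2.
    unfold disk in Q1, Q2.
    pose proof (Cmod_ge_0 (f (zn n))); pose proof (Cmod_ge_0 (B (zn n))).
    pose proof (disk_sqr _ (Hzn n)) as P3; rewrite <- Cmod2_alt in P3.
    specialize (PrB n); specialize (Prf n).
    field; repeat split; try (apply Rgt_not_eq; nra).
  + replace (c / kappa)%R with (kappa / c * (c * / kappa * (c * / kappa)) * (2 / 2))%R
      by (field; split; lra).
    apply is_lim_seq_mult'; [apply is_lim_seq_mult'|].
    * apply is_lim_seq_div'; [exact Lf2 | exact LB2 | lra].
    * apply is_lim_seq_mult'; apply is_lim_seq_mult'; assumption.
    * apply is_lim_seq_div'; [exact MB | exact Mf | lra].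
- apply Rdiv_lt_0_compat; assumption.
- apply sectorial_julia; try assumption.
  intros z Hz; apply Hmax; assumption.
- intros Ho.
  (* Here 1/rf - 1/rB is (|1 - f| - |1 - B|) / |1 - z|, hence at most |f - B| / |1 - z| in
     modulus. *)
  assert (Hsmall : forall eps, (0 < eps)%R -> (Rabs (/ kappa - / c) <= eps)%R).
  { intros eps He.
    assert (HL : is_lim_seq (fun n => Rabs (/ rf n - / rB n)) (Rabs (/ kappa - / c))).
    { apply (is_lim_seq_abs _ (Finite (/ kappa - / c))), is_lim_seq_minus'; assumption. }
    apply (is_lim_seq_le_loc _ (fun _ => eps) _ (Finite eps)) with (2 := HL);
      [|apply is_lim_seq_const].
    generalize (Ho (mkposreal eps He)); apply filter_imp; intros n Hn.
    change (Cmod (f (zn n) - B (zn n)) <= eps * D n)%R in Hn.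
    apply Rmult_le_reg_l with (D n); [apply HD|].
    rewrite <- (Rabs_pos_eq (D n)) at 1 by (left; apply HD).
    rewrite <- Rabs_mult, Rmult_minus_distr_l, <- EB, <- Ef.
    apply Rle_trans with (Cmod (f (zn n) - B (zn n))); [|lra].
    pose proof (Cmod_triangle (1 - B (zn n)) (- (f (zn n) - B (zn n)))) as T1.
    replace (1 - B (zn n) + - (f (zn n) - B (zn n))) with (1 - f (zn n)) in T1 by ring.
    pose proof (Cmod_triangle (1 - f (zn n)) (f (zn n) - B (zn n))) as T2.
    replace (1 - f (zn n) + (f (zn n) - B (zn n))) with (1 - B (zn n)) in T2 by ring.
    rewrite Cmod_opp in T1; apply Rabs_le; lra. }
  assert (E : (/ kappa - / c = 0)%R).
  { apply NNPP; intros Hne; apply Rabs_pos_lt in Hne.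
    pose proof (Hsmall (Rabs (/ kappa - / c) / 2)%R ltac:(lra)); lra. }
  assert (E2 : (c * (/ kappa - / c) = 0)%R) by (rewrite E; ring).
  replace (c * (/ kappa - / c))%R with (c / kappa - 1)%R in E2 by (field; split; lra); lra.
Qed.
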